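(* Let $p$ be a prime. Up to pre- and post-compositions with affine maps $x\mapsto ax+b$, a polynomial $F\in\mathbb{F}_{p^4}[x]$ is a minimal value set polynomial over $\mathbb{F}_{p^4}$ with value set $V_F$ satisfying $r:=\#V_F-1\ge 2$ if and only if $F$ is of one of the following types: (i) $x^v$, where $v$ is a proper divisor of $p^4-1$; (ii) $g(x)^t$, where $t$ is a proper divisor of $p-1$, and $g\in\mathbb{F}_{p^4}[x]$ is a minimal value set polynomial with $V_g=\mathbb{F}_p$, i.e., $g$ is a nonconstant polynomial of the form \begin{align*} & ax^{p^3+p^2+p+1}+bx^{p^3+p^2+p}+b^px^{p^3+p^2+1}+b^{p^2}x^{p^3+p+1}+b^{p^3}x^{p^2+p+1}\\ &+cx^{p^3+p^2}+c^px^{p^3+1}+c^{p^2}x^{p+1}+c^{p^3}x^{p^2+p}+dx^{p^3+p}+d^px^{p^2+1}\\ &+ex^{p^3}+e^px+e^{p^2}x^p+e^{p^3}x^{p^2}+f, \end{align*} where $a,f\in\mathbb{F}_p$, $d\in\mathbb{F}_{p^2}$, and $b,c,e\in\mathbb{F}_{p^4}$; (iii) $g(x)^t$, where $t$ is a proper divisor of $p^2-1$, and $g\in\mathbb{F}_{p^4}[x]$ is a minimal value set polynomial with $V_g=\mathbb{F}_{p^2}$, i.e., $g$ is a nonconstant polynomial of the form $$ax^{p^2+1}+bx^{p^2}+b^{p^2}x+c,$$ where $a,c\in\mathbb{F}_{p^2}$ and $b\in\mathbb{F}_{p^4}$; (iv) $\left(x^{p^2}+\left(1+(\beta^{p^3}-\beta^{p^2})^{p-1}\right)x^p-(\beta^p-\beta)^{1-p}x\right)^v$,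 where $\beta\in\mathbb{F}_{p^4}\setminus\mathbb{F}_p$ and $v$ divides $p-1$; (v) $(x^p-x)^v$, where $v$ divides $p-1$.
   Context: For $F\in\mathbb{F}_q[x]$, with $q=p^4$, $V_F=\{F(\alpha):\alpha\in\mathbb{F}_q\}$. A polynomial $F\in\mathbb{F}_q[x]$ of positive degree is a minimal value set polynomial (MVSP) over $\mathbb{F}_q$ if $\#V_F=\lfloor (q-1)/\deg F\rfloor+1$. ''Up to pre- and post-compositions with affine maps'' means: $F$ is an MVSP with $\#V_F\ge 3$ if and only if there are $a_1,b_1,a_2,b_2\in\mathbb{F}_{p^4}$ with $a_1,a_2\ne0$ such that $F(x)=a_2\,G(a_1x+b_1)+b_2$ for some polynomial $G$ of one of the listed types. A proper divisor of a positive integer $N$ is a positive divisor different from $N$ (it may be $1$). *)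

(* Defs.v *)
From HB Require Import structures.
From mathcomp Require Import all_boot all_order all_algebra.

Set Implicit Arguments.
Unset Strict Implicit.
Unset Printing Implicit Defensive.

Import GRing.Theory.
Local Open Scope ring_scope.

Section MinimalValueSet.
Variable F : finFieldType.

Definition value_set (f : {poly F}) : {set F} := [set f.[x] | x : F].

(* [size f] is the degree plus one, so [1 < size f] is "positive degree". *)
Definition mvsp (f : {poly F}) : Prop :=
  (1 < size f)%N /\
  #|value_set f| = ((#|F| - 1) %/ (size f).-1 + 1)%N.

(* When #|F| = q ^ m, the roots of X^q - X in F form the unique subfield of F
   with q elements. *)
Definition subfield_of_order (q : nat) : {set F} := [set x : F | x ^+ q == x].

Definition affine_equiv (f g : {poly F}) : Prop :=
  exists a1 b1 a2 b2 : F,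
    [/\ a1 != 0, a2 != 0 & f = a2 *: (g \Po (a1 *: 'X + b1%:P)) + b2%:P].

Definition proper_divisor (d n : nat) : Prop := (d %| n)%N /\ d <> n.

Section Types.
Variable p : nat.

Definition formFp (g : {poly F}) : Prop :=
  exists a b c d e f : F,
    [/\ a \in subfield_of_order p, f \in subfield_of_order p,
        d \in subfield_of_order (p ^ 2) &
        g = a *: 'X^(p ^ 3 + p ^ 2 + p + 1)
          + b *: 'X^(p ^ 3 + p ^ 2 + p)
          + (b ^+ p) *: 'X^(p ^ 3 + p ^ 2 + 1)
          + (b ^+ (p ^ 2)) *: 'X^(p ^ 3 + p + 1)
          + (b ^+ (p ^ 3)) *: 'X^(p ^ 2 + p + 1)
          + c *: 'X^(p ^ 3 + p ^ 2)
          + (c ^+ p) *: 'X^(p ^ 3 + 1)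
          + (c ^+ (p ^ 2)) *: 'X^(p + 1)
          + (c ^+ (p ^ 3)) *: 'X^(p ^ 2 + p)
          + d *: 'X^(p ^ 3 + p)
          + (d ^+ p) *: 'X^(p ^ 2 + 1)
          + e *: 'X^(p ^ 3)
          + (e ^+ p) *: 'X
          + (e ^+ (p ^ 2)) *: 'X^p
          + (e ^+ (p ^ 3)) *: 'X^(p ^ 2)
          + f%:P].

Definition formFp2 (g : {poly F}) : Prop :=
  exists a b c : F,
    [/\ a \in subfield_of_order (p ^ 2), c \in subfield_of_order (p ^ 2) &
        g = a *: 'X^(p ^ 2 + 1) + b *: 'X^(p ^ 2)
          + (b ^+ (p ^ 2)) *: 'X + c%:P].

Definition type_i (G : {poly F}) : Prop :=
  exists2 v : nat, proper_divisor v (p ^ 4 - 1) & G = 'X^v.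

Definition type_ii (G : {poly F}) : Prop :=
  exists (t : nat) (g : {poly F}),
    [/\ proper_divisor t (p - 1), mvsp g,
        value_set g = subfield_of_order p & G = g ^+ t].

Definition type_iii (G : {poly F}) : Prop :=
  exists (t : nat) (g : {poly F}),
    [/\ proper_divisor t (p ^ 2 - 1), mvsp g,
        value_set g = subfield_of_order (p ^ 2) & G = g ^+ t].

Definition type_iv (G : {poly F}) : Prop :=
  exists (beta : F) (v : nat),
    [/\ beta \notin subfield_of_order p, (v %| p - 1)%N &
        G = ('X^(p ^ 2)
             + (1 + (beta ^+ (p ^ 3) - beta ^+ (p ^ 2)) ^+ (p - 1)) *: 'X^p
             - ((beta ^+ p - beta) ^- (p - 1)) *: 'X) ^+ v].

Definition type_v (G : {poly F}) : Prop :=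
  exists2 v : nat, (v %| p - 1)%N & G = ('X^p - 'X) ^+ v.

End Types.
End MinimalValueSet.

(* Main.v *)
Require Import Defs.
From HB Require Import structures.
From mathcomp Require Import all_boot all_order all_algebra all_field.
From mathcomp Require Import ring zify.

Set Implicit Arguments.
Unset Strict Implicit.
Unset Printing Implicit Defensive.

Import GRing.Theory.
Local Open Scope ring_scope.

(* Let f be an MVSP of degree d with value set V, #V = r + 1 >= 3, and let P be
   the monic polynomial with simple roots V.  Since r d <= q - 1, the product of
   the quotients of f - y (y in V) by their split squarefree parts has degree
   < d, which forces P' to be constant, say c, on V minus one value y0, and
   P(f) = - c f' (x^q - x).  Put F = f - y0, let L be the monic polynomial with
   simple roots the zeros of F, and let R be P / (y - y0) minus its value at y0,
   shifted to y0 = 0.  Then R(F) L = - c0 (L + (x^q - x) L'), F' L = t F L' and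
   R + t y R' = 0.

   Taking p-th roots as long as possible yields, at level k,
   F = L^v A^(p^k), L = B^(p^k) + x C^(p^k), R = y^j S^(p^k) and
   kap (B + x^(q/p^k) C) = L^M A^j S(F), where v j + 1 = p^k M.  Differentiating
   the last identity shows that either L divides the Wronskian of B and C, in
   which case the Wronskian vanishes and level k + 1 is available, or M = 1.
   Degrees at levels 2 and 3 leave only the types (i) and (iii); at level 1 with
   S constant F satisfies (t - 1) F'^2 = t F F'', an equation inherited by the
   components of F over the p-th powers, so that F is a constant times a t-th
   power, of type (ii).  At level 1 with M = 1 and S not constant,
   uniqueness of base-F expansions makes L a linearized polynomial plus a
   constant, and F a constant times a power of L, which are the types (iv) and
   (v); for t = 1 this may require exchanging y0 for another value. *)

(** * Degrees of polynomials *)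

(** Wronskians appear because 'X^(q/p^k) has derivative 0 for k <= 3: it is eliminated between the
    level identity and its derivative, leaving a polynomial of degree less than deg L. Divisibility
    by L therefore means vanishing, and coprime B and C with zero Wronskian have zero derivative,
    hence p-th roots.

    Type (ii) cannot be reached by degrees alone, since it has many free coefficients. What replaces
    them is a self-similarity: for t r = p - 1 one has F = A (L A^r)^t, the level identity turns L
    A^r into B + x^(p^3) C up to a constant, and the coefficients of F in powers of x^(p^3) are
    then, up to a constant, its components over the p-th powers.

    The obstacle is t = 1. There deg F may be too small for the terms of the Wronskian identity to
    be base-F digits, and a different combination has to be expanded. It can end in (F + lam) D' = u
    D^(p+1) with F' = D^p, a relation centred at the value y0 - lam. As P'(y0) = t c = c, no value
    is distinguished when t = 1, and y0 - lam may replace y0. *)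

Local Notation deg f := (size f%R).-1.

(* The [size] terms are abstracted up to conversion, since [lia] would see
   distinct atoms when their ring instances are only convertible. *)
Ltac size_lia :=
  repeat match goal with
    | H : is_true (leq _ _) |- _ => revert H
    | H : @eq nat _ _ |- _ => revert H
    end;
  repeat match goal with |- context [@size ?T ?x] =>
    let n := fresh "n" in set n := (@size T x); move: n end; clear; lia.

Section PolyField.
Variable K : fieldType.
Implicit Types f g h : {poly K}.

Lemma degM f g : f != 0 -> g != 0 -> deg (f * g) = (deg f + deg g)%N.
Proof.
move=> f0 g0; rewrite size_mul //.
by move: f0 g0; rewrite -!size_poly_gt0; size_lia.
Qed.

Lemma degM_leq f g : (deg (f * g) <= deg f + deg g)%N.
Proof.
have [->|f0] := eqVneq f 0; first by rewrite mul0r size_poly0.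
have [->|g0] := eqVneq g 0; first by rewrite mulr0 size_poly0.
by rewrite degM.
Qed.

Lemma degD_leq f g : (deg (f + g) <= maxn (deg f) (deg g))%N.
Proof. by have := size_polyD f g; size_lia. Qed.

Lemma deg_opp f : deg (- f) = deg f. Proof. by rewrite size_polyN. Qed.

Lemma deg_scale_leq (c : K) f : (deg (c *: f) <= deg f)%N.
Proof. by have := size_scale_leq c f; size_lia. Qed.

Lemma deg_scale (c : K) f : c != 0 -> deg (c *: f) = deg f.
Proof. by move=> c0; rewrite size_scale. Qed.

Lemma deg_deriv_leq f : (deg f^`() <= (deg f).-1)%N.
Proof.
have [->|f0] := eqVneq f 0; first by rewrite deriv0 size_poly0.
by have := lt_size_deriv f0; size_lia.
Qed.

Lemma deg_deriv_lt f : f^`() != 0 -> (deg f^`() < deg f)%N.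
Proof.
move=> f'0; have f0 : f != 0 by apply: contraNneq f'0 => ->; rewrite deriv0.
have := lt_size_deriv f0; move: f'0; rewrite -size_poly_gt0. size_lia.
Qed.

Lemma dvdp_deg_eq0 f g : f %| g -> (deg g < deg f)%N -> g = 0.
Proof.
move=> fg lt; apply/eqP/negPn/negP => g0.
by have := dvdp_leq g0 fg; move: lt; size_lia.
Qed.

Lemma dvdp_deg f g : g != 0 -> f %| g -> (deg f <= deg g)%N.
Proof. by move=> g0 /(dvdp_leq g0); size_lia. Qed.

Lemma deg0_polyC f : deg f = 0%N -> exists c, f = c%:P.
Proof. by move=> d0; exists f`_0; apply: size1_polyC; size_lia. Qed.

Lemma mulp_inj f g h : f != 0 -> f * g = f * h -> g = h.
Proof. by move=> f0 /(mulfI f0). Qed.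

Lemma deg_subC f c : (0 < deg f)%N -> deg (f - c%:P) = deg f.
Proof.
move=> d0; rewrite size_polyDl // size_polyN; have := size_polyC_leq1 c.
by move: d0; size_lia.
Qed.

Lemma subC_neq0 f c : (0 < deg f)%N -> f - c%:P != 0.
Proof. by move=> d0; have := deg_subC c d0; rewrite -size_poly_gt0; size_lia. Qed.

Lemma deg_expn f n : deg (f ^+ n) = (n * deg f)%N.
Proof. by rewrite size_exp mulnC. Qed.

Lemma deg_comp f g : deg (f \Po g) = (deg f * deg g)%N.
Proof. exact: size_comp_poly. Qed.

(** The two summands cannot cancel at the top: their degrees are 0 and 1 modulo [n]. The formula
    covers [f = 0] because [deg 0] is 0. *)
Lemma deg_split n f g : (1 < n)%N -> g != 0 ->
  deg (f ^+ n + 'X * g ^+ n) = maxn (n * deg f) (n * deg g).+1.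
Proof.
move=> n1 g0; have dX : deg ('X * g ^+ n) = (n * deg g).+1.
  by rewrite degM ?polyX_eq0 ?expf_neq0 // size_polyX deg_expn add1n.
have [->|f0] := eqVneq f 0.
  by rewrite expr0n (gtn_eqF (ltnW n1)) add0r dX size_poly0 muln0 max0n.
have Xg0 : 'X * g ^+ n != 0 by rewrite mulf_neq0 ?polyX_eq0 ?expf_neq0.
have fn0 : f ^+ n != 0 by rewrite expf_neq0.
rewrite -deg_expn -dX.
have ne : size (f ^+ n) != size ('X * g ^+ n).
  apply/eqP => eq; have := dX; rewrite -eq deg_expn => eqn.
  have : (n %| n * deg g + 1)%N by rewrite addn1 -eqn dvdn_mulr.
  by rewrite dvdn_addr ?dvdn_mulr // dvdn1 (gtn_eqF n1).
have [lt|lt|eq] := ltngtP (size (f ^+ n)) (size ('X * g ^+ n)); last by rewrite eq eqxx in ne.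
  by rewrite addrC size_polyDl //; move: lt; size_lia.
by rewrite size_polyDl //; move: lt; size_lia.
Qed.

(* Uniqueness of base-[G] expansions. *)
Lemma horner_small_eq0 (G : {poly K}) (N : {poly {poly K}}) :
  (forall i, (size (N`_i)%R < size G)%N) -> N.[G] = 0 -> N = 0.
Proof.
elim/poly_ind: N => [//|N c IH] sm.
rewrite hornerMXaddC => eq0.
have sc : (size c < size G)%N by have := sm 0%N; rewrite coefD coefMX coefC /= add0r.
have NG0 : N.[G] = 0.
  apply/eqP/negPn/negP => n0.
  have : G %| c.
    by rewrite -[c](addKr (N.[G] * G)) eq0 addr0 dvdpNr dvdp_mull.
  case: (eqVneq c 0) => [c0|c0].
    move: eq0; rewrite c0 addr0 => /eqP; rewrite mulf_eq0 (negPf n0) /=.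
    by move=> /eqP G0; move: sc; rewrite G0 size_poly0 ltn0.
  by move=> /(dvdp_leq c0); rewrite leqNgt sc.
have c0 : c = 0 by move: eq0; rewrite NG0 mul0r add0r.
rewrite IH ?mul0r ?add0r ?c0 // => i.
by have := sm i.+1; rewrite coefD coefMX coefC /= addr0.
Qed.

End PolyField.

(** * Polynomials in characteristic p *)

Section CharP.
Variables (K : finFieldType) (p e : nat).
Hypotheses (p_pr : prime p) (cardK : #|K| = (p ^ e.+1)%N).
Implicit Types (f g h : {poly K}) (Z : {set K}).

Let chp : p \in [pchar K] := card_finPcharP cardK p_pr.

Lemma pchar_polyK : p \in [pchar {poly K}].
Proof. by rewrite pchar_poly. Qed.
Let chP := pchar_polyK.

Lemma pnat_pchar k : [pchar {poly K}].-nat (p ^ k)%N.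
Proof. by rewrite pnatX (pi_pnat (pnat_id p_pr)). Qed.

Lemma pnat_pcharK k : [pchar K].-nat (p ^ k)%N.
Proof. by rewrite pnatX (pi_pnat (pnat_id p_pr)). Qed.

Lemma expDp k f g : (f + g) ^+ (p ^ k) = f ^+ (p ^ k) + g ^+ (p ^ k).
Proof. exact/exprDn_pchar/pnat_pchar. Qed.

Lemma expNp k f : (- f) ^+ (p ^ k) = - f ^+ (p ^ k).
Proof. exact/exprNn_pchar/pnat_pchar. Qed.

Lemma expBp k f g : (f - g) ^+ (p ^ k) = f ^+ (p ^ k) - g ^+ (p ^ k).
Proof. by rewrite expDp expNp. Qed.

Lemma expDpK k (a b : K) : (a + b) ^+ (p ^ k) = a ^+ (p ^ k) + b ^+ (p ^ k).
Proof. exact/exprDn_pchar/pnat_pcharK. Qed.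

Lemma expNpK k (a : K) : (- a) ^+ (p ^ k) = - a ^+ (p ^ k).
Proof. exact/exprNn_pchar/pnat_pcharK. Qed.

Lemma expp_inj k f g : f ^+ (p ^ k) = g ^+ (p ^ k) -> f = g.
Proof.
move=> /eqP; rewrite -subr_eq0 -expBp expf_eq0 subr_eq0.
by case/andP=> _ /eqP.
Qed.

Lemma exppK_inj k (a b : K) : a ^+ (p ^ k) = b ^+ (p ^ k) -> a = b.
Proof.
move=> /eqP; rewrite -subr_eq0 -expNpK -expDpK expf_eq0 subr_eq0.
by case/andP=> _ /eqP.
Qed.

Lemma pmul_eq0 (n : nat) f : (p %| n)%N -> f *+ n = 0.
Proof. by rewrite -mulr_natr (dvdn_pcharf chP) => /eqP ->; rewrite mulr0. Qed.

Lemma deriv_expp k f : (0 < k)%N -> (f ^+ (p ^ k))^`() = 0.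
Proof. by move=> k0; rewrite deriv_exp pmul_eq0 // dvdn_exp. Qed.

Lemma deriv_mul_expp k f g : (0 < k)%N ->
  (f * g ^+ (p ^ k))^`() = f^`() * g ^+ (p ^ k).
Proof. by move=> k0; rewrite derivM deriv_expp // mulr0 addr0. Qed.

Definition proot : K -> K := invF (fmorph_inj (pFrobenius_aut chp)).

Lemma prootK a : proot a ^+ p = a.
Proof. by rewrite -(pFrobenius_autE chp) /proot f_invF. Qed.

Lemma proot_exp k (a : K) : exists b, b ^+ (p ^ k) = a.
Proof.
elim: k a => [|k IH] a; first by exists a.
have [b eb] := IH (proot a).
by exists b; rewrite expnSr exprM eb prootK.
Qed.

Lemma coef_expp f i :
  (f ^+ p)`_i = if (p %| i)%N then f`_(i %/ p) ^+ p else 0.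
Proof.
have -> : f ^+ p = map_poly (pFrobenius_aut chp) f \Po 'X^p.
  elim/poly_ind: f => [|f c IH].
    by rewrite rmorph0 comp_poly0 expr0n; case: p p_pr.
  rewrite -[p in LHS]expn1 expDp expn1 exprMn IH rmorphD rmorphM /= map_polyX.
  by rewrite map_polyC /= pFrobenius_autE comp_polyD comp_polyM comp_polyX
    comp_polyC rmorphXn.
rewrite coef_comp_poly_Xn ?prime_gt0 // coef_map /= pFrobenius_autE.
by [].
Qed.

(** Only exponents divisible by p survive, and coefficients have p-th roots because [K] is
    finite. *)
Lemma deriv_eq0_expp f : f^`() = 0 -> exists g, f = g ^+ p.
Proof.
move=> f'0; exists (\poly_(i < size f) proot (f`_(i * p))).
apply/polyP => i; rewrite coef_expp; case: ifPn => [/dvdnP[j ->]|npi].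
  rewrite mulnK ?prime_gt0 // coef_poly.
  case: ltnP => [_|le]; first by rewrite prootK.
  rewrite nth_default ?expr0n ?(gtn_eqF (prime_gt0 p_pr)) //.
  by rewrite (leq_trans le) // leq_pmulr // prime_gt0.
case: i npi => [|i] npi; first by rewrite dvdn0 in npi.
have := congr1 (fun h : {poly K} => h`_i) f'0; rewrite coef_deriv coef0 => /eqP.
by rewrite -mulr_natr mulf_eq0 -(dvdn_pcharf chp) (negPf npi) orbF => /eqP.
Qed.

(** Here f' = c^p, and f - x f' has derivative - x f'' = 0. *)
Lemma deriv2_eq0_split f : f^`()^`() = 0 ->
  exists b c, f = b ^+ p + 'X * c ^+ p.
Proof.
move=> f2; have [c f'c] := deriv_eq0_expp f2.
have [b fb] : exists b, f - 'X * f^`() = b ^+ p.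
  by apply: deriv_eq0_expp; rewrite derivB derivM derivX f2; ring.
by exists b, c; rewrite -fb -f'c; ring.
Qed.

(** * Split squarefree polynomials *)

Definition lin_prod (Z : {set K}) : {poly K} := \prod_(a in Z) ('X - a%:P).

Lemma lin_prod_neq0 Z : lin_prod Z != 0.
Proof. by apply/prodf_neq0 => a _; rewrite polyXsubC_eq0. Qed.

Lemma deg_lin_prod Z : deg (lin_prod Z) = #|Z|.
Proof. by rewrite /lin_prod -big_enum /= size_prod_XsubC -cardE. Qed.

Lemma root_lin_prod Z a : root (lin_prod Z) a = (a \in Z).
Proof. by rewrite /lin_prod -big_enum /= root_prod_XsubC mem_enum. Qed.

Lemma lin_prod_dvdP Z f :
  reflect (forall a, a \in Z -> f.[a] = 0) (lin_prod Z %| f).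
Proof.
apply: (iffP idP) => [dv a aZ|rt].
  case/dvdpP: dv => h ->; apply/eqP; rewrite -/(root _ _) rootM.
  by rewrite root_lin_prod aZ orbT.
rewrite /lin_prod -big_enum /=; apply: uniq_roots_dvdp.
  by apply/allP => a; rewrite mem_enum => /rt /eqP.
by rewrite uniq_rootsE enum_uniq.
Qed.

Lemma coprime_lin_prodP Z f :
  reflect (forall a, a \in Z -> f.[a] != 0) (coprimep (lin_prod Z) f).
Proof.
apply: (iffP idP) => [co a aZ|nrt].
  by apply/(coprimep_root co); rewrite root_lin_prod.
rewrite /lin_prod; apply: (big_ind (fun g => coprimep g f)) => [|g h cg ch|a aZ].
- by rewrite coprime1p.
- by rewrite coprimepMl cg.
- by rewrite coprimep_sym coprimep_XsubC; apply: nrt.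
Qed.

Lemma lin_prodC Z : lin_prod Z * lin_prod (~: Z) = 'X^#|K| - 'X.
Proof.
rewrite finField_genPoly /lin_prod [RHS](bigID (mem Z)) /=.
by congr (_ * _); apply: eq_bigl => a; rewrite ?inE.
Qed.

(** Differentiating [lin_prodC] gives a Bezout relation with right side -1. *)
Lemma lin_prod_coprime_deriv Z : coprimep (lin_prod Z) (lin_prod Z)^`().
Proof.
apply/Bezout_eq1_coprimepP.
exists (- (lin_prod (~: Z))^`(), - lin_prod (~: Z)) => /=.
have := congr1 (@deriv _) (lin_prodC Z).
rewrite derivM derivB derivX derivXn cardK pmul_eq0 ?dvdn_exp // sub0r => eq1.
by rewrite -[RHS]opprK -eq1; ring.
Qed.

Lemma lin_prod_dvd_exp Z f n : lin_prod Z %| f ^+ n -> lin_prod Z %| f.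
Proof.
move=> /lin_prod_dvdP rt; apply/lin_prod_dvdP => a /rt.
by rewrite horner_exp => /eqP; rewrite expf_eq0 => /andP[_ /eqP].
Qed.

(* [f * L ^ (p - t)] has zero derivative, hence is a p-th power. *)
Lemma logderiv_factor Z f t : (t < p)%N ->
    f^`() * lin_prod Z = (f * (lin_prod Z)^`()) *+ t ->
  exists g, f = lin_prod Z ^+ t * g ^+ p.
Proof.
set L := lin_prod Z => tp eqf.
have [g eg] : exists g, f * L ^+ (p - t) = g ^+ p.
  apply: deriv_eq0_expp; rewrite derivM deriv_exp.
  have [n en] : exists n, (p - t = n.+1)%N by exists (p - t).-1; lia.
  rewrite en /= exprS.
  have -> : f^`() * (L * L ^+ n) + f * (L^`() * L ^+ n *+ n.+1)
     = (f^`() * L) * L ^+ n + f * L^`() * L ^+ n *+ n.+1 by rewrite mulrnAr !mulrA.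
  rewrite eqf mulrnAl -mulrnDr -en subnKC 1?ltnW //.
  exact: pmul_eq0.
have : L %| g.
  apply: (@lin_prod_dvd_exp _ _ p); rewrite -eg dvdp_mull //.
  by rewrite -[X in X %| _]expr1 dvdp_exp2l // subn_gt0.
case/dvdpP => h eh; exists h.
apply: (@mulp_inj _ (L ^+ (p - t))); first by rewrite expf_neq0 ?lin_prod_neq0.
by rewrite mulrC eg eh exprMn mulrA -exprD subnK 1?ltnW // mulrC.
Qed.

End CharP.

(** * The exceptional value *)

Lemma deg_prod (K : fieldType) (I : finType) (A : {pred I}) (G : I -> {poly K}) :
  (forall i, i \in A -> G i != 0) ->
  deg (\prod_(i in A) G i) = (\sum_(i in A) deg (G i))%N.
Proof.
move=> nz; suff [] : deg (\prod_(i in A) G i) = (\sum_(i in A) deg (G i))%N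
    /\ \prod_(i in A) G i != 0 by [].
pose Q (x : {poly K}) (n : nat) := deg x = n /\ x != 0.
apply: (big_ind2 Q); rewrite /Q; first by rewrite size_poly1 oner_eq0.
  by move=> x n y m [<- x0] [<- y0]; rewrite degM // mulf_neq0.
by move=> i /nz.
Qed.

Section Structure.
Variables (K : finFieldType) (p e : nat).
Hypotheses (p_pr : prime p) (cardK : #|K| = (p ^ e.+1)%N).

Definition fiber (f : {poly K}) (y : K) : {set K} := [set a | f.[a] == y].

Lemma horner_genPoly (a : K) : ('X^#|K| - 'X : {poly K}).[a] = 0.
Proof. by rewrite !hornerE expf_card subrr. Qed.

Lemma deriv_genPoly : ('X^#|K| - 'X : {poly K})^`() = - 1.
Proof.
by rewrite derivB derivX derivXn cardK (pmul_eq0 p_pr cardK) ?dvdn_exp // sub0r.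
Qed.

Variable f : {poly K}.
Hypotheses (f_mvsp : mvsp f) (V_gt2 : (2 < #|value_set f|)%N).

Let V := value_set f.
Let P := lin_prod V.
Let L y := lin_prod (fiber f y).
Let h y : {poly K} := (f - y%:P) %/ L y.
Let d := deg f.

Let d_gt0 : (0 < d)%N.
Proof. by case: f_mvsp; rewrite /d; case: (size f). Qed.

Lemma mvsp_deg_leq : ((#|value_set f| - 1) * deg f <= #|K| - 1)%N.
Proof. by case: f_mvsp => _ ->; rewrite addnK leq_trunc_div. Qed.

Let hL y : f - y%:P = h y * L y.
Proof.
rewrite /h divpK //; apply/lin_prod_dvdP => a; rewrite inE => /eqP <-.
by rewrite !hornerE subrr.
Qed.

Let h_neq0 y : h y != 0.
Proof. by have := subC_neq0 y d_gt0; rewrite hL mulf_eq0 => /norP[]. Qed.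

Let L_neq0 y : L y != 0.
Proof. exact: lin_prod_neq0. Qed.

Let deg_h y : (deg (h y) + #|fiber f y|)%N = d.
Proof. by rewrite /d -(deg_subC y d_gt0) hL degM // deg_lin_prod. Qed.

Let sum_fiber : (\sum_(y in V) #|fiber f y|)%N = #|K|.
Proof.
rewrite -sum1_card [RHS](partition_big (fun a => f.[a]) (mem V)) /=; last first.
  by move=> a _; apply: imset_f.
apply: eq_bigr => y _; rewrite -sum1_card.
by apply: eq_bigl => a; rewrite inE.
Qed.

Let H : {poly K} := \prod_(y in V) h y.

Let H_neq0 : H != 0.
Proof. by apply/prodf_neq0 => y _. Qed.

(** Summing deg h_y + #fiber = d over V makes the left side equal to #V d - q, and (#V - 1) d <= q -
    1 leaves less than d. *)
Let sum_deg_h : (\sum_(y in V) deg (h y) < d)%N.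
Proof.
have : (\sum_(y in V) deg (h y) + #|K| = #|V| * d)%N.
  rewrite -sum_fiber -big_split /= (eq_bigr (fun=> d)) => [|y _]; last exact: deg_h.
  by rewrite sum_nat_const.
have := mvsp_deg_leq; have : (0 < #|K|)%N by rewrite cardK expn_gt0 prime_gt0.
rewrite -/V -/d; move: V_gt2; rewrite -/V => V2 K0 le eqs.
have eqV : (#|V| * d = (#|V| - 1) * d + d)%N.
  by rewrite -mulSnr subn1 prednK // (ltn_trans _ V2).
by move: eqs; rewrite eqV; lia.
Qed.

Let deg_H : (deg H < d)%N.
Proof. by rewrite deg_prod. Qed.

Let P_comp : P \Po f = H * ('X^#|K| - 'X).
Proof.
rewrite /P /lin_prod rmorph_prod /=.
under eq_bigr do rewrite comp_polyB comp_polyX comp_polyC hL.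
rewrite big_split /=; congr (_ * _); rewrite finField_genPoly /L /lin_prod.
rewrite [RHS](partition_big (fun a => f.[a]) (mem V)) /=; last first.
  by move=> a _; apply: imset_f.
by apply: eq_bigr => y _; apply: eq_bigl => a; rewrite inE.
Qed.

(** Differentiating [P_comp] at a point of the fibre leaves P'(y) f' = - H there. The fibre enters
    only through the slope P'(y). *)
Let fiber_cond y a : a \in fiber f y -> (P^`().[y] *: f^`() + H).[a] = 0.
Proof.
rewrite inE => /eqP fa; have := congr1 (fun g => g^`().[a]) P_comp.
rewrite /= deriv_comp derivM deriv_genPoly !hornerM hornerD !hornerM.
rewrite horner_comp fa horner_genPoly mulr0 add0r hornerN hornerC mulrN1.
by rewrite hornerD hornerZ => ->; rewrite addNr.
Qed.

Let deg_comb (c : K) : (size (c *: f^`() + H)%R <= d)%N.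
Proof.
have := degD_leq (c *: f^`()) H; have := deg_scale_leq c f^`().
have := deg_deriv_leq f; move: deg_H d_gt0; rewrite /d; size_lia.
Qed.

(** The two fibres together have 2 d - deg h_y1 - deg h_y2 > d points, too many zeros for a nonzero
    combination of size at most d. *)
Let same_slope y1 y2 : y1 \in V -> y2 \in V -> y1 != y2 ->
  P^`().[y1] = P^`().[y2] -> H = - P^`().[y1] *: f^`().
Proof.
move=> V1 V2 ne eqc; apply/eqP; rewrite scaleNr -addr_eq0 addrC; apply/eqP.
apply: (@dvdp_deg_eq0 _ (lin_prod (fiber f y1 :|: fiber f y2))).
  apply/lin_prod_dvdP => a; rewrite in_setU => /orP[]; first exact: fiber_cond.
  by rewrite eqc; apply: fiber_cond.
rewrite deg_lin_prod cardsU.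
have -> : fiber f y1 :&: fiber f y2 = set0.
  apply/setP => a; rewrite !inE; apply: contraNF ne => /andP[/eqP <- /eqP <-] //.
rewrite cards0 subn0.
have : (deg (h y1) + deg (h y2) < d)%N.
  apply: leq_ltn_trans sum_deg_h; rewrite (bigD1 y1) //= leq_add2l.
  by rewrite (bigD1 y2) ?leq_addr // V2 eq_sym.
have := deg_h y1; have := deg_h y2; have := deg_comb P^`().[y1].
move: d_gt0; size_lia.
Qed.


Let slope_quot y : exists2 A : {poly K}, P^`().[y] *: f^`() + H = A * L y
                                       & (size A <= deg (h y))%N.
Proof.
have /lin_prod_dvdP := @fiber_cond y; case/dvdpP => A eA; exists A => //.
have [->|A0] := eqVneq A 0; first by rewrite size_poly0.
have := deg_comb P^`().[y]; rewrite eA size_mul ?lin_prod_neq0 //.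
have := deg_h y; rewrite -deg_lin_prod -/(L y).
have := lin_prod_neq0 (fiber f y); rewrite -size_poly_gt0 -/(L y).
by size_lia.
Qed.

(* Eliminating [f^`()] and [H] between three fibres leaves a relation
   [f * X = Y] with [size X, size Y < size f], hence [X = Y = 0]. *)
Let not_three_slopes y1 y2 y3 : y1 \in V -> y2 \in V -> y3 \in V ->
  y1 != y2 -> y2 != y3 -> y3 != y1 ->
  [|| P^`().[y1] == P^`().[y2], P^`().[y2] == P^`().[y3]
    | P^`().[y3] == P^`().[y1]].
Proof.
move=> V1 V2 V3 n12 n23 n31; apply/negPn/negP; rewrite !negb_or.
move: P^`().[y1] P^`().[y2] P^`().[y3] (slope_quot y1) (slope_quot y2) (slope_quot y3).
move=> c1 c2 c3 [A1 e1 s1] [A2 e2 s2] [A3 e3 s3] /and3P[c12 c23 c31].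
pose X1 : {poly K} := (c2 - c3)%:P * (A1 * (h y2 * h y3)).
pose X2 : {poly K} := (c3 - c1)%:P * (A2 * (h y3 * h y1)).
pose X3 : {poly K} := (c1 - c2)%:P * (A3 * (h y1 * h y2)).
have shift y (A : {poly K}) c : c *: f^`() + H = A * L y ->
    A * (f - y%:P) = h y * (c%:P * f^`() + H).
  by move=> eA; rewrite hL mul_polyC eA; ring.
(* The weights c2 - c3, c3 - c1, c1 - c2 are orthogonal to (c1, c2, c3) and to (1, 1, 1), so f' and
   [H] both drop out. *)
have rel : f * (X1 + X2 + X3) = y1%:P * X1 + y2%:P * X2 + y3%:P * X3.
  apply/eqP; rewrite -subr_eq0; apply/eqP.
  transitivity ((c2 - c3)%:P * (h y2 * h y3) * (A1 * (f - y1%:P))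
     + (c3 - c1)%:P * (h y3 * h y1) * (A2 * (f - y2%:P))
     + (c1 - c2)%:P * (h y1 * h y2) * (A3 * (f - y3%:P))).
    by rewrite /X1 /X2 /X3; ring.
  rewrite (shift _ _ _ e1) (shift _ _ _ e2) (shift _ _ _ e3) !polyCB; ring.
have sum3 : (deg (h y1) + deg (h y2) + deg (h y3) < d)%N.
  apply: leq_ltn_trans sum_deg_h; rewrite (bigD1 y1) //= -addnA leq_add2l.
  rewrite (bigD1 y2) ?V2 1?eq_sym //= leq_add2l.
  by rewrite (bigD1 y3) ?leq_addr // V3 n31 eq_sym.
have size_X (c : K) (A : {poly K}) x y z : (size A <= deg (h x))%N ->
    (deg (h x) + deg (h y) + deg (h z) < d)%N ->
    (size (c%:P * (A * (h y * h z)))%R < d)%N.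
  move=> sA lt; rewrite mul_polyC; apply: leq_ltn_trans (size_scale_leq _ _) _.
  have [->|A0] := eqVneq A 0; first by rewrite mul0r size_poly0.
  have := h_neq0 y; have := h_neq0 z; move: A0; rewrite -!size_poly_gt0 => A0 z0 y0.
  rewrite size_mul ?mulf_neq0 ?size_mul -?size_poly_gt0 //.
  by move: sA lt A0 z0 y0; size_lia.
have sX1 : (size X1 < d)%N by apply: (size_X _ _ y1).
have sX2 : (size X2 < d)%N by apply: (size_X _ _ y2) => //; size_lia.
have sX3 : (size X3 < d)%N by apply: (size_X _ _ y3) => //; size_lia.
have sC (y : K) (X : {poly K}) : (size X < d)%N -> (size (y%:P * X)%R < d)%N.
  by rewrite mul_polyC; apply: leq_ltn_trans (size_scale_leq _ _).
have sD (X Y : {poly K}) : (size X < d)%N -> (size Y < d)%N -> (size (X + Y)%R < d)%N.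
  by move=> sX sY; apply: leq_ltn_trans (size_polyD _ _) _; rewrite gtn_max sX.
have Y0 : y1%:P * X1 + y2%:P * X2 + y3%:P * X3 = 0.
  apply: (@dvdp_deg_eq0 _ f); first by rewrite -rel dvdp_mulr.
  have : (size (y1%:P * X1 + y2%:P * X2 + y3%:P * X3)%R < d)%N
    by apply: (sD); [apply: (sD) |]; apply: (sC).
  rewrite -/d; size_lia.
have f0 : f != 0 by rewrite -size_poly_gt0; move: d_gt0; rewrite /d; size_lia.
have X0 : X1 + X2 + X3 = 0.
  by apply: (mulp_inj f0); rewrite rel Y0 mulr0.
(* The products [h y1 * L y1] and [h y2 * L y2] differ by the nonzero constant y2 - y1. *)
have cop : coprimep (h y1) (h y2).
  apply/Bezout_eq1_coprimepP.
  exists (- (y1 - y2)^-1%:P * L y1, (y1 - y2)^-1%:P * L y2) => /=.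
  transitivity ((y1 - y2)^-1%:P * (h y2 * L y2 - h y1 * L y1)); first by ring.
  rewrite -!hL (_ : _ - _ = (y1 - y2)%:P); last by rewrite polyCB; ring.
  by rewrite -polyCM mulVf // subr_eq0.
have rel2 : h y3 * ((y1 - y3)%:P * (c2 - c3)%:P * (A1 * h y2)
     + (y2 - y3)%:P * (c3 - c1)%:P * (A2 * h y1)) = 0.
  transitivity (y1%:P * X1 + y2%:P * X2 + y3%:P * X3 - y3%:P * (X1 + X2 + X3)).
    rewrite /X1 /X2 /X3 !polyCB; ring.
  by rewrite X0 Y0 mulr0 subrr.
have {}rel2 : (y1 - y3)%:P * (c2 - c3)%:P * (A1 * h y2)
     + (y2 - y3)%:P * (c3 - c1)%:P * (A2 * h y1) = 0.
  by move/eqP: rel2; rewrite mulf_eq0 (negPf (h_neq0 _)) => /eqP.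
(* As the size of [A1] is at most deg (h y1), this gives A1 = 0 and then A2 = 0; two different
   slopes with c f' + H = 0 leave f' = H = 0. *)
have dv : h y1 %| A1.
  rewrite -(Gauss_dvdpl _ cop).
  set k := (y1 - y3) * (c2 - c3).
  have k0 : k != 0 by rewrite mulf_neq0 // subr_eq0 // eq_sym.
  have -> : A1 * h y2 = k^-1%:P * (k%:P * (A1 * h y2)).
    by rewrite !mul_polyC scalerA mulVf ?scale1r.
  rewrite dvdp_mull // polyCM; move/eqP: rel2; rewrite addr_eq0 => /eqP ->.
  by rewrite -mulNr !dvdp_mull.
have A10 : A1 = 0.
  apply/eqP/negPn/negP => A0; have := dvdp_leq A0 dv.
  by have := h_neq0 y1; rewrite -size_poly_gt0; move: s1; size_lia.
have A20 : A2 = 0.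
  move/eqP: rel2; rewrite A10 mul0r mulr0 add0r -polyCM mulf_eq0 polyC_eq0.
  rewrite !mulf_eq0 !subr_eq0 (negPf n23) (negPf c31) (negPf (h_neq0 _)) orbF /=.
  by rewrite orbF => /eqP.
have eqH c : c *: f^`() + H = 0 -> H = - c *: f^`().
  by move/eqP; rewrite addrC addr_eq0 -scaleNr => /eqP.
have H1 := eqH _ (etrans e1 (etrans (congr1 ( *%R^~ (L y1)) A10) (mul0r _))).
have H2 := eqH _ (etrans e2 (etrans (congr1 ( *%R^~ (L y2)) A20) (mul0r _))).
move: H1; rewrite H2 !scaleNr => /eqP; rewrite eqr_opp -subr_eq0 -scalerBl scaler_eq0.
rewrite subr_eq0 eq_sym (negPf c12) /= => /eqP f'0.
by move/eqP: H_neq0; rewrite H2 f'0 scaler0.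
Qed.

(** The slope at [y0] is left free. When it is also [c], every value is exceptional for the same
    [c]. *)
Definition exceptional_value (g : {poly K}) (y0 c : K) :=
  [/\ y0 \in value_set g, c != 0,
      forall y, y \in value_set g -> y != y0 -> (lin_prod (value_set g))^`().[y] = c
    & lin_prod (value_set g) \Po g = - c *: (g^`() * ('X^#|K| - 'X))].

Lemma mvsp_exceptional_value : exists y0 c, exceptional_value f y0 c.
Proof.
have [y1 [y2 [y3 [[V1 V2 V3] [n12 n23 n31]]]]] := card_gt2P V_gt2.
have [ya [yb [Va Vb nab eqab]]] : exists ya yb,
    [/\ ya \in V, yb \in V, ya != yb & P^`().[ya] = P^`().[yb]].
  have := not_three_slopes V1 V2 V3 n12 n23 n31.
  by case/or3P => /eqP eq; [exists y1, y2 | exists y2, y3 | exists y3, y1].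
set c := P^`().[ya]; have Hc : H = - c *: f^`() := same_slope Va Vb nab eqab.
have c0 : c != 0 by apply: contraNneq H_neq0 => c0; rewrite Hc c0 oppr0 scale0r.
have f'0 : f^`() != 0.
  by apply: contraNneq H_neq0 => f'0; rewrite Hc f'0 scaler0.
have Pc : P \Po f = - c *: (f^`() * ('X^#|K| - 'X)).
  by rewrite P_comp Hc scalerAl.
have [allc|] := boolP [forall (y | y \in V), P^`().[y] == c].
  exists ya, c; split=> // y Vy _.
  by apply/eqP; move/forall_inP: allc; apply.
(* A slope other than [c] at a further value [y] would have to agree with the one at [y0], and
   [same_slope] would give a second proportionality between [H] and f'. *)
rewrite negb_forall_in => /exists_inP[y0 V0 ny0]; exists y0, c; split=> // y Vy nyy0.
apply/eqP/negPn/negP => nyc.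
have := not_three_slopes V0 Vy Va; rewrite -/c.
have ne0a : y0 != ya by apply: contraNneq ny0 => ->.
have nea : y != ya by apply: contraNneq nyc => ->.
rewrite eq_sym nyy0 nea (eq_sym ya) ne0a => /(_ isT isT isT).
rewrite (negPf nyc) (eq_sym c) (negPf ny0) !orbF => /eqP eqs.
have := same_slope V0 Vy; rewrite eq_sym nyy0 => /(_ isT eqs).
rewrite Hc => /eqP; rewrite -subr_eq0 -scalerBl scaler_eq0 (negPf f'0) orbF.
by rewrite subr_eq0 eqr_opp eq_sym (negPf ny0).
Qed.

End Structure.

(** * Normal form at the exceptional value *)

Section Normal.
Variables (K : finFieldType) (p e : nat).
Hypotheses (p_pr : prime p) (cardK : #|K| = (p ^ e.+1)%N).

Let chp : p \in [pchar K] := card_finPcharP cardK p_pr.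

(* [R] is [P / ('X - y0) - c0] shifted to [y0 = 0], where [P] is the polynomial
   with roots the values of [f]. *)
Record normal_form (f : {poly K}) (y0 : K) (R : {poly K}) (c0 : K) (t : nat) : Prop :=
  NormalForm {
  nf_c0 : c0 != 0;
  nf_t : (0 < t < p)%N;
  nf_R0 : R.[0] = 0;
  nf_sizeR : size R = #|value_set f|;
  nf_eq : (R \Po (f - y0%:P)) * lin_prod (fiber f y0)
    = - c0 *: (lin_prod (fiber f y0)
               + ('X^#|K| - 'X) * (lin_prod (fiber f y0))^`());
  nf_logderiv : f^`() * lin_prod (fiber f y0)
    = ((f - y0%:P) * (lin_prod (fiber f y0))^`()) *+ t;
  nf_euler : R + ('X * R^`()) *+ t = 0;
  nf_deriv2 : (lin_prod (fiber f y0))^`()^`() = 0 }.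

Variables (f : {poly K}) (y0 c : K).
Hypotheses (f_mvsp : mvsp f) (V_gt2 : (2 < #|value_set f|)%N).
Hypothesis y0P : exceptional_value f y0 c.

Let V := value_set f.
Let L := lin_prod (fiber f y0).
Let P0 := lin_prod (V :\ y0).
Let c0 := P0.[y0].
Let F := f - y0%:P.

Let V0 : y0 \in V. Proof. by case: y0P. Qed.
Let c_neq0 : c != 0. Proof. by case: y0P. Qed.

Let P_eq : lin_prod V = ('X - y0%:P) * P0.
Proof.
rewrite /lin_prod (bigD1 y0) //=; congr (_ * _).
by apply: eq_bigl => y; rewrite !inE andbC.
Qed.

Let slope_eq y : y \in V -> y != y0 -> P0.[y] + (y - y0) * P0^`().[y] = c.
Proof.
case: y0P => _ _ sl _ Vy ny; rewrite -(sl y Vy ny) -/V P_eq derivM derivXsubC mul1r.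
by rewrite hornerD hornerM !hornerE.
Qed.

Let c0_neq0 : c0 != 0.
Proof.
have := root_lin_prod (V :\ y0) y0; rewrite !inE eqxx /= => /negbT.
by [].
Qed.

Let d_gt0 : (0 < deg f)%N.
Proof. by case: f_mvsp; case: (size f). Qed.

Let F_neq0 : F != 0. Proof. exact: subC_neq0 d_gt0. Qed.

Let comp_eq : F * (P0 \Po f) = - c *: (f^`() * ('X^#|K| - 'X)).
Proof.
case: y0P => _ _ _ <-; rewrite -/V P_eq comp_polyM comp_polyB comp_polyX.
by rewrite comp_polyC.
Qed.

(** After cancelling L in [comp_eq], the quotient h = F / L divides c f' times the product over the
    complement of the fibre. It has no zero in that complement, so it divides f'. *)
Let y1_ex : exists y1, f^`() = (F %/ L) * y1 /\
  (P0 \Po f) * L = - c *: (y1 * ('X^#|K| - 'X)).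
Proof.
have FL : F = (F %/ L) * L.
  rewrite divpK //; apply/lin_prod_dvdP => a; rewrite inE => /eqP fa.
  by rewrite /F !hornerE fa subrr.
set h := F %/ L in FL *.
have h0 : h != 0 by apply: contraNneq F_neq0 => h0; rewrite FL h0 mul0r.
have cop : coprimep h (lin_prod (~: fiber f y0)).
  rewrite coprimep_sym; apply/coprime_lin_prodP => a; rewrite !inE => na.
  apply: contraNneq na => ha; rewrite -subr_eq0.
  by have := congr1 (horner^~ a) FL; rewrite /F !hornerE ha mul0r => ->.
have eq1 : h * (P0 \Po f) = - c *: (f^`() * lin_prod (~: fiber f y0)).
  apply: (mulp_inj (lin_prod_neq0 (fiber f y0))); rewrite -/L mulrA [L * h]mulrC -FL.
  by rewrite comp_eq -(lin_prodC (fiber f y0)) -!mul_polyC -/L; ring.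
have /dvdpP[y1 ey1] : h %| f^`().
  rewrite -(Gauss_dvdpl _ cop) -(@dvdpZr _ (- c)) ?oppr_eq0 //.
  by rewrite -eq1 dvdp_mulr.
exists y1; split; first by rewrite mulrC.
apply: (mulp_inj h0); rewrite mulrA eq1 ey1 -(lin_prodC (fiber f y0)).
by rewrite -!mul_polyC -/L; ring.
Qed.

(** Differentiating the last identity at a zero a of L gives c y1(a) = c0 L'(a). Hence c y1 - c0 L'
    vanishes on the fibre, and its degree is below deg L because deg f' < deg f. *)
Let y1_eq : exists2 y1, f^`() = (F %/ L) * y1 &
  c *: y1 = c0 *: L^`() /\ (P0 \Po f) * L = - c *: (y1 * ('X^#|K| - 'X)).
Proof.
have [y1 [f'E PL]] := y1_ex; exists y1 => //; split => //.
apply/eqP; rewrite -subr_eq0; apply/eqP.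
apply: (@dvdp_deg_eq0 _ L).
  apply/lin_prod_dvdP => a aF; have fa : f.[a] = y0 by move: aF; rewrite inE => /eqP.
  have La : L.[a] = 0 by apply/eqP; rewrite -/(root _ _) root_lin_prod.
  have := congr1 (fun g => g^`().[a]) PL; rewrite /= derivZ !derivM (deriv_genPoly p_pr cardK).
  rewrite !hornerE horner_comp fa La !mulr0 add0r expf_card subrr mulr0 add0r => eqa.
  by rewrite -/c0 in eqa; rewrite eqa; ring.
have L0 : (0 < deg L)%N.
  rewrite deg_lin_prod card_gt0; apply/set0Pn.
  by case/imsetP: V0 => a _ ->; exists a; rewrite inE.
have FL : F = (F %/ L) * L.
  rewrite divpK //; apply/lin_prod_dvdP => a; rewrite inE => /eqP fa.
  by rewrite /F !hornerE fa subrr.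
have h_neq0 : F %/ L != 0.
  by apply: contraNneq F_neq0 => h0; rewrite FL h0 mul0r.
have dy1 : (deg y1 < deg L)%N.
  have [->|y1n] := eqVneq y1 0; first by rewrite size_poly0.
  have f'0 : f^`() != 0 by rewrite f'E mulf_neq0.
  have := deg_deriv_lt f'0; rewrite [in X in (X < _)%N]f'E degM // => lt.
  have : deg F = (deg (F %/ L) + deg L)%N.
    by rewrite -degM ?lin_prod_neq0 // -FL.
  by rewrite (deg_subC y0 d_gt0); move: lt; size_lia.
have dL' := deg_deriv_leq L.
have := degD_leq (c *: y1) (- (c0 *: L^`())); rewrite deg_opp.
have := deg_scale_leq c y1; have := deg_scale_leq c0 L^`().
move: dL' dy1 L0; size_lia.
Qed.

Lemma exceptional_normal_form :
  exists R t, normal_form f y0 R (c *+ t) t /\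
              (lin_prod (value_set f))^`().[y0] = c *+ t.
Proof.
have [y1 f'E [y1E PL]] := y1_eq.
pose tau := c0 / c.
have y1E' : y1 = tau *: L^`().
  by rewrite /tau mulrC -scalerA -y1E scalerA mulVf // scale1r.
have FL : F = (F %/ L) * L.
  rewrite divpK //; apply/lin_prod_dvdP => a; rewrite inE => /eqP fa.
  by rewrite /F !hornerE fa subrr.
have logd : f^`() * L = tau *: (F * L^`()).
  by rewrite f'E y1E' [in RHS]FL -!mul_polyC; ring.
have [a aF] : exists a, a \in fiber f y0.
  by case/imsetP: V0 => a _ ->; exists a; rewrite inE.
have [m [g ga eFg]] := multiplicity_XsubC F a.
(* Comparing leading local terms of f' L = tau F L' at a zero of F of multiplicity [m]. The exponent
   t of the normal form is m modulo p; it is nonzero because [c0] is. *)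
have tauE : tau = m%:R.
  move: ga; rewrite F_neq0 /= => ga.
  have [L1 eL] : exists L1, L = ('X - a%:P) * L1.
    have /factor_theorem[L1 eL] : root L a by rewrite root_lin_prod.
    by exists L1; rewrite eL mulrC.
  have L1a : L1.[a] != 0.
    have := lin_prod_coprime_deriv p_pr cardK (fiber f y0); rewrite -/L => cop.
    have := coprimep_root cop; move=> /(_ a); rewrite root_lin_prod => /(_ aF).
    by rewrite eL derivM derivXsubC mul1r !hornerE subrr mul0r addr0.
  have m_gt0 : (0 < m)%N.
    rewrite lt0n; apply: contraNneq ga => m0; rewrite m0 mulr1 in eFg.
    by move: aF; rewrite inE -eFg /root /F !hornerE subr_eq0.
  have f'F : f^`() = F^`() by rewrite /F derivB derivC subr0.
  move: logd; rewrite f'F eFg eL derivM deriv_exp derivXsubC mul1r.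
  rewrite derivM derivXsubC mul1r => logd.
  have linm : ('X - a%:P) ^+ m = ('X - a%:P) ^+ m.-1 * ('X - a%:P).
    by rewrite -exprSr prednK.
  have lin0 : ('X - a%:P) ^+ m != 0 by rewrite expf_neq0 // polyXsubC_eq0.
  have eqa : (g^`() * ('X - a%:P) + m%:R * g) * L1
      = tau%:P * (g * (L1 + ('X - a%:P) * L1^`())).
    apply: (mulp_inj lin0); move: logd.
    rewrite -mulr_natl -mul_polyC linm; move: (m%:R : {poly K}) => n.
    move: ('X - a%:P) (('X - a%:P) ^+ m.-1) => l lm eql.
    transitivity ((g^`() * (lm * l) + g * (n * lm)) * (l * L1)); first by ring.
    by rewrite eql; ring.
  have := congr1 (horner^~ a) eqa; rewrite !hornerE subrr !mul0r !mulr0 addr0 add0r.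
  rewrite -polyC_natr !hornerE => eqb.
  have gL : g.[a] * L1.[a] != 0 by rewrite mulf_neq0.
  by apply: (mulIf gL); rewrite !mulrA in eqb *.
have tau0 : tau != 0 by rewrite mulf_neq0 ?invr_eq0.
have tauE' : tau = (m %% p)%:R.
  by rewrite tauE [in LHS](divn_eq m p) natrD natrM (pcharf0 chp) mulr0 add0r.
have scal (u : {poly K}) : tau *: u = u *+ (m %% p) by rewrite tauE' scaler_nat.
have c0E : c0 = c *+ (m %% p).
  by rewrite -[RHS]mulr_natr -tauE' /tau mulrC divfK.
pose R := (P0 \Po ('X + y0%:P)) - c0%:P.
have RF : R \Po F = (P0 \Po f) - c0%:P.
  rewrite /R comp_polyB comp_polyC -comp_polyA comp_polyD comp_polyX comp_polyC.
  by rewrite /F subrK.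
have eqn : (R \Po F) * L = - c0 *: (L + ('X^#|K| - 'X) * L^`()).
  by rewrite RF mulrBl PL scaleNr scalerAl y1E -!mul_polyC; ring.
have V_card : (#|V| = #|V :\ y0|.+1)%N by rewrite (cardsD1 y0) V0.
have dP0 : deg P0 = #|V :\ y0| by rewrite deg_lin_prod.
have sR : size R = #|V|.
  have s2 : size ('X + y0%:P : {poly K}) = 2 by rewrite size_XaddC.
  have sP : size (P0 \Po ('X + y0%:P)) = #|V|.
    rewrite size_comp_poly2 // V_card -dP0; have := lin_prod_neq0 (V :\ y0).
    by rewrite -size_poly_gt0 -/P0; size_lia.
  rewrite size_polyDl // size_polyN sP.
  by apply: leq_ltn_trans (size_polyC_leq1 _) _; apply: ltnW.
have R0 : R.[0] = 0.
  by rewrite /R hornerD hornerN hornerC horner_comp hornerD hornerX hornerC add0r subrr.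
have euler : R + ('X * R^`()) *+ (m %% p) = 0.
  apply: (@roots_geq_poly_eq0 _ _ [seq y - y0 | y <- enum V]).
  - apply/allP => z /mapP[y]; rewrite mem_enum => Vy ->; rewrite /root.
    have [->|ny] := eqVneq y y0.
      by rewrite subrr hornerD hornerMn hornerM hornerX mul0r mul0rn R0 addr0.
    have Py : P0.[y] = 0.
      by apply/eqP; rewrite -/(root _ _) root_lin_prod !inE ny.
    have := slope_eq Vy ny; rewrite Py add0r => sl.
    rewrite hornerD hornerMn hornerM hornerX derivB derivC subr0 deriv_comp.
    rewrite derivD derivX derivC addr0 mulr1 /R hornerD hornerN hornerC.
    by rewrite !horner_comp hornerD hornerX hornerC subrK Py sl c0E sub0r addNr.
  - by rewrite map_inj_uniq ?enum_uniq // => u v /addIr.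
  - rewrite size_map -cardE -sR.
    have R_neq0 : R != 0 by rewrite -size_poly_gt0 sR V_card.
    have := lt_size_deriv R_neq0; have := size_mul_leq 'X R^`(); rewrite size_polyX.
    have := size_scale_leq (m %% p)%:R ('X * R^`()); rewrite -scaler_nat.
    by have := size_polyD R ((m %% p)%:R *: ('X * R^`())); size_lia.
exists R, (m %% p)%N; rewrite -c0E; split; last first.
  by rewrite -/V P_eq derivM derivXsubC mul1r !hornerE subrr mul0r addr0.
split=> //.
- rewrite ltn_mod (prime_gt0 p_pr) andbT lt0n; apply: contraNneq tau0 => m0.
  by rewrite tauE' m0.
- by rewrite logd scal.
(* Differentiating the identity for R(F) L: the left side becomes (R + t x R')(F) L' = 0, and on the
   right only (x^q - x) L'' survives. *)
have := congr1 (@deriv _) eqn; rewrite derivZ derivM deriv_comp derivD derivM.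
rewrite (deriv_genPoly p_pr cardK) mulN1r addNKr.
have -> : F^`() = f^`() by rewrite /F derivB derivC subr0.
have -> : (R^`() \Po F) * f^`() * L + (R \Po F) * L^`()
    = ((R + 'X * R^`() *+ (m %% p)) \Po F) * L^`().
  rewrite -mulrA logd scal -scaler_nat !linearE /= comp_polyM comp_polyX.
  by rewrite -scaler_nat -!mul_polyC; ring.
rewrite euler comp_poly0 mul0r => /esym/eqP.
rewrite scaler_eq0 oppr_eq0 (negPf c0_neq0) mulf_eq0 /= => /orP[/eqP q0|/eqP //].
by have := congr1 (fun g => g^`()) q0; rewrite /= (deriv_genPoly p_pr cardK) deriv0 => /eqP;
  rewrite oppr_eq0 oner_eq0.
Qed.

Lemma exceptional_value_any y :
  (lin_prod (value_set f))^`().[y0] = c -> y \in value_set f ->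
  exceptional_value f y c.
Proof.
case: y0P => _ cn sl eqP P0c Vy; split=> // z Vz _.
by have [->|/(sl z Vz)] := eqVneq z y0.
Qed.

End Normal.

(** * Levels *)

Section Levels.
Variables (K : finFieldType) (p : nat).
Hypotheses (p_pr : prime p) (cardK : #|K| = (p ^ 4)%N).

Let chp : p \in [pchar K] := card_finPcharP cardK p_pr.
Let p_gt1 : (1 < p)%N := prime_gt1 p_pr.

Variables (Z : {set K}) (F R : {poly K}) (c0 : K) (j : nat).
Hypotheses (Z_gt0 : (0 < #|Z|)%N) (F_gt0 : (0 < deg F)%N) (c0_neq0 : c0 != 0).
Let L := lin_prod Z.
Hypothesis RF : (R \Po F) * L = - c0 *: (L + ('X^#|K| - 'X) * L^`()).

(** The exponent [j], the multiplicity of the root 0 of R, is common to all levels. The divisibility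
    in [lv_v] is what makes F^j L a p^k-th power. *)
Record level (k v : nat) (A B C S : {poly K}) : Prop := Level {
  lv_F : F = L ^+ v * A ^+ (p ^ k);
  lv_L : L = B ^+ (p ^ k) + 'X * C ^+ (p ^ k);
  lv_R : R = 'X^j * S ^+ (p ^ k);
  lv_S : S.[0] != 0;
  lv_v : (p ^ k %| v * j + 1)%N }.

Let L_neq0 : L != 0. Proof. exact: lin_prod_neq0. Qed.
Let F_neq0 : F != 0. Proof. by rewrite -size_poly_gt0; move: F_gt0; size_lia. Qed.
Let degL : deg L = #|Z|. Proof. exact: deg_lin_prod. Qed.

Lemma pk_gt1 k : (0 < k)%N -> (1 < p ^ k)%N.
Proof. by case: k => // k _; rewrite (leq_trans p_gt1) // expnS leq_pmulr ?expn_gt0 ?prime_gt0. Qed.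

Let cop_LL' : coprimep L L^`(). Proof. exact: (lin_prod_coprime_deriv p_pr cardK). Qed.

Let L'_neq0 : L^`() != 0.
Proof.
apply: contraTneq Z_gt0 => L'0; have := cop_LL'; rewrite L'0 coprimep0.
by rewrite -size_poly_eq1 -leqNgt -degL => /eqP ->.
Qed.

Section At.
Variables (k v : nat) (A B C S : {poly K}).
Hypotheses (k_gt0 : (0 < k)%N) (lv : level k v A B C S).

Let M := ((v * j + 1) %/ p ^ k)%N.

Lemma level_M : (v * j + 1 = p ^ k * M)%N.
Proof. by rewrite [RHS]mulnC /M divnK // (lv_v lv). Qed.

Lemma level_M_gt0 : (0 < M)%N.
Proof. by have := level_M; case: M => //; rewrite muln0 addn1. Qed.

Lemma level_deriv : L^`() = C ^+ (p ^ k).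
Proof.
rewrite {1}(lv_L lv) derivD (deriv_expp p_pr cardK) // add0r.
by rewrite (deriv_mul_expp p_pr cardK) // derivX mul1r.
Qed.

Lemma level_C_neq0 : C != 0.
Proof.
by apply: contraNneq L'_neq0 => C0; rewrite level_deriv C0 expr0n gtn_eqF // ltnW ?pk_gt1.
Qed.

Lemma level_A_neq0 : A != 0.
Proof.
apply: contraNneq F_neq0 => A0; rewrite (lv_F lv) A0.
by rewrite expr0n gtn_eqF ?mulr0 // ltnW ?pk_gt1.
Qed.

Lemma level_degL : #|Z| = maxn (p ^ k * deg B) (p ^ k * deg C).+1.
Proof. by rewrite -degL {1}(lv_L lv) deg_split ?pk_gt1 ?level_C_neq0. Qed.

Lemma level_degF : deg F = (v * #|Z| + p ^ k * deg A)%N.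
Proof.
by rewrite {1}(lv_F lv) degM ?expf_neq0 ?level_A_neq0 // !deg_expn degL.
Qed.

Lemma level_v_neq0 : v%:R != 0 :> K.
Proof.
rewrite -(dvdn_pcharf chp); apply/negP => pv.
have : (p %| v * j + 1)%N by rewrite level_M dvdn_mulr // dvdn_exp.
by rewrite dvdn_addr ?dvdn_mulr // dvdn1 gtn_eqF.
Qed.

Lemma level_vj : v%:R * j%:R = - 1 :> K.
Proof.
apply/eqP; rewrite -addr_eq0 -natrM natr1 -addn1 -(dvdn_pcharf chp) level_M.
by rewrite dvdn_mulr // dvdn_exp.
Qed.

Lemma level_coprime : coprimep B C.
Proof.
apply/coprimepP => D DB DC.
have DL : D %| L.
  rewrite (lv_L lv) dvdp_add ?dvdp_mull //.
    by apply: dvdp_trans DB _; rewrite -[X in X %| _]expr1 dvdp_exp2l // expn_gt0 prime_gt0.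
  by apply: dvdp_trans DC _; rewrite -[X in X %| _]expr1 dvdp_exp2l // expn_gt0 prime_gt0.
have DL' : D %| L^`().
  by rewrite level_deriv; apply: dvdp_trans DC _;
    rewrite -[X in X %| _]expr1 dvdp_exp2l // expn_gt0 prime_gt0.
by have /coprimepP := cop_LL'; apply.
Qed.

(** Both sides of [RF] are p^k-th powers: the left one of L^M A^j S(F), since v j + 1 = p^k M, and
    on the right L + (x^q - x) L' = B^(p^k) + x^q C^(p^k), since L' = C^(p^k). The constant [kap] is
    a root of - c0. *)
Lemma level_E : (k <= 4)%N -> exists2 kap, kap != 0 &
  kap *: (B + 'X^(p ^ (4 - k)) * C) = L ^+ M * A ^+ j * (S \Po F).
Proof.
move=> k4; have [kap ekap] := proot_exp p_pr cardK k (- c0).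
exists kap.
  apply: contra c0_neq0 => /eqP kap0; move: ekap.
  rewrite kap0 expr0n (gtn_eqF (ltnW (pk_gt1 k_gt0))) => /esym/eqP.
  by rewrite oppr_eq0.
apply: (expp_inj p_pr cardK (k := k)).
rewrite exprZn ekap (expDp p_pr cardK) exprMn -exprM -expnD subnK //.
have -> : B ^+ (p ^ k) + 'X^(p ^ 4) * C ^+ (p ^ k) = L + ('X^#|K| - 'X) * L^`().
  by rewrite level_deriv [in RHS](lv_L lv) cardK; move: (_ ^+ _) (_ ^+ _) => x y; ring.
rewrite -RF (lv_R lv) rmorphM /= !rmorphXn /= comp_polyX !exprMn.
rewrite -!exprM [in (F ^+ j)](lv_F lv) exprMn -!exprM [(M * _)%N]mulnC -level_M addn1 exprSr.
by rewrite [(p ^ k * j)%N]mulnC; ring.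
Qed.

Definition wronskian (f g : {poly K}) := f^`() * g - f * g^`().

(** With E the right side of [level_E], forming C E' - C' E eliminates 'X^(p^(4-k)), whose
    derivative is 0. *)
Lemma level_wronskian : (k <= 3)%N -> exists2 kap, kap != 0 &
  kap *: wronskian B C =
    C * (L ^+ M * A ^+ j * (S \Po F))^`() - C^`() * (L ^+ M * A ^+ j * (S \Po F)).
Proof.
move=> k3; have [kap kap0 <-] := level_E (leqW k3); exists kap => //.
rewrite derivZ derivD derivM derivXn (pmul_eq0 p_pr cardK) ?dvdn_exp ?subn_gt0 ?ltnS //.
by rewrite /wronskian -!mul_polyC; ring.
Qed.

(** The degree of L, the maximum of p^k deg B and p^k deg C + 1, exceeds that of the Wronskian,
    which is thus 0. By coprimality C then divides C'. *)
Lemma level_wronskian_eq0 : L %| wronskian B C -> B^`() = 0 /\ C^`() = 0.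
Proof.
move=> LW; have W0 : wronskian B C = 0.
  apply: (dvdp_deg_eq0 LW); rewrite degL level_degL /wronskian.
  have := degD_leq (B^`() * C) (- (B * C^`())); rewrite deg_opp.
  have := degM_leq B^`() C; have := degM_leq B C^`().
  have := deg_deriv_leq B; have := deg_deriv_leq C.
  have n2 := pk_gt1 k_gt0.
  have := leq_mul n2 (leqnn (deg B)); have := leq_mul n2 (leqnn (deg C)).
  move: (p ^ k * _)%N (p ^ k * _)%N; clear n2; move=> x y; size_lia.
have BC : B^`() * C = B * C^`() by apply/eqP; rewrite -subr_eq0; apply/eqP.
have C'0 : C^`() = 0.
  apply/eqP/negPn/negP => C'0; have := deg_deriv_lt C'0; rewrite ltnNge => /negP; apply.
  apply: dvdp_deg => //; rewrite -(Gauss_dvdpr _ (_ : coprimep C B)).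
    by rewrite -BC dvdp_mull.
  by rewrite coprimep_sym level_coprime.
split=> //; apply/eqP; move/eqP: BC; rewrite C'0 mulr0 mulf_eq0.
by rewrite (negPf level_C_neq0) orbF.
Qed.

Lemma level_M_gt1 : (k <= 3)%N -> (1 < M)%N -> L %| wronskian B C.
Proof.
move=> k3 M1; have [kap kap0 eW] := level_wronskian k3.
rewrite -(@dvdpZr _ kap) // eW.
have [m ->] : exists m, M = m.+2 by exists M.-2; move: M1; case: (M) => [|[|]].
set Y := L ^+ m * A ^+ j * (S \Po F).
have -> : L ^+ m.+2 * A ^+ j * (S \Po F) = L * (L * Y) by rewrite /Y !exprS; ring.
apply: dvdp_sub; last by rewrite dvdp_mull // dvdp_mulr.
rewrite dvdp_mull // derivM; apply: dvdp_add; first by rewrite dvdp_mull // dvdp_mulr.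
by rewrite dvdp_mulr.
Qed.

(** Once B' = C' = 0, the Wronskian identity gives E' = 0 for E = L^M A^j S(F). As S(F) is prime to
    F and to A, it divides L' S'(F), which by degrees requires S' = 0. What is left of E' = 0
    relates the logarithmic derivatives of A and L, and a power of L splits off from A. *)
Lemma level_up : (k <= 3)%N -> (0 < j)%N -> L %| wronskian B C ->
  exists v' A' B' C' S', level k.+1 v' A' B' C' S'.
Proof.
move=> k3 j0 LW; have [B'0 C'0] := level_wronskian_eq0 LW.
have [kap kap0 eW] := level_wronskian k3.
set E := L ^+ M * A ^+ j * (S \Po F) in eW.
have E'0 : E^`() = 0.
  have : C * E^`() = 0.
    move: eW; rewrite /wronskian B'0 C'0 !(mul0r, mulr0) subr0 scaler0 subr0.
    by move=> <-.
  by move/eqP; rewrite mulf_eq0 (negPf level_C_neq0) => /eqP.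
have F'L : F^`() * L = v%:R * (F * L^`()).
  rewrite {1}(lv_F lv) (deriv_mul_expp p_pr cardK) // deriv_exp (lv_F lv).
  case: (v) => [|n]; first by rewrite mulr0n !mul0r.
  rewrite /= [L ^+ n.+1]exprS -mulr_natl; move: (n.+1%:R : {poly K}) => x; ring.
set G := S \Po F.
have key : L^`() * A * (M%:R * G + v%:R * F * (S^`() \Po F)) + j%:R * L * A^`() * G = 0.
  have AL0 : L ^+ M.-1 * A ^+ j.-1 * L != 0.
    by rewrite !mulf_neq0 ?expf_neq0 ?level_A_neq0.
  apply: (mulp_inj AL0); rewrite mulr0 -[RHS](mulr0 L) -E'0 /E.
  rewrite !derivM deriv_comp -/G.
  have -> : (L ^+ M)^`() = M%:R * (L^`() * L ^+ M.-1) by rewrite deriv_exp mulr_natl.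
  have -> : (A ^+ j)^`() = j%:R * (A^`() * A ^+ j.-1) by rewrite deriv_exp mulr_natl.
  have eM : L ^+ M = L * L ^+ M.-1 by rewrite -exprS prednK ?level_M_gt0.
  have ej : A ^+ j = A * A ^+ j.-1 by rewrite -exprS prednK.
  rewrite eM ej.
  move: (M%:R : {poly K}) (j%:R : {poly K}) (L ^+ M.-1) (A ^+ j.-1) => m i x y.
  have e1 : L * ((S^`() \Po F) * F^`()) = (S^`() \Po F) * (v%:R * (F * L^`())).
    by rewrite -F'L; ring.
  transitivity (L * ((m * (L^`() * x) * (A * y) + L * x * (i * (A^`() * y))) * G)
    + L * x * (A * y) * (L * ((S^`() \Po F) * F^`()))); last by ring.
  by rewrite e1; move: (v%:R : {poly K}) => n; ring.
have AF : A %| F.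
  rewrite (lv_F lv) dvdp_mull // -[X in X %| _]expr1 dvdp_exp2l //.
  exact: ltnW (pk_gt1 k_gt0).
have copFG : coprimep F G.
  have := lv_S lv; rewrite /G; have /factor_theorem[S1 eS] : root (S - (S.[0])%:P) 0.
    by rewrite /root !hornerE subrr.
  have -> : S = S1 * 'X + (S.[0])%:P.
    by apply/eqP; rewrite -subr_eq; apply/eqP; rewrite eS polyC0 subr0.
  move: S.[0] => s0; rewrite hornerD hornerM hornerX mulr0 add0r hornerC => s00.
  rewrite comp_polyD comp_polyM comp_polyX comp_polyC coprimep_addl_mul.
  by rewrite -[s0%:P]mulr1 mul_polyC coprimepZr // coprimep1.
have S'0 : S^`() = 0.
  have GS : G %| L^`() * (S^`() \Po F).
    have cop : coprimep G (A * F).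
      by rewrite coprimep_sym coprimepMl copFG (coprimep_dvdr AF copFG).
    rewrite -(Gauss_dvdpr _ cop) -(@dvdpZr _ v%:R) ?level_v_neq0 //.
    have -> : v%:R *: (A * F * (L^`() * (S^`() \Po F)))
      = - (G * (M%:R * L^`() * A + j%:R * L * A^`())).
      rewrite scaler_nat -[LHS]mulr_natl; apply/eqP; rewrite -addr_eq0 -key; apply/eqP.
      move: (M%:R : {poly K}) (j%:R : {poly K}) (v%:R : {poly K}) => m i n; ring.
    by rewrite dvdpNr dvdp_mulr.
  apply/eqP/negPn/negP => S'0.
  have SF0 : S^`() \Po F != 0.
    by rewrite comp_poly_eq0 //; move: F_gt0; size_lia.
  have := dvdp_deg (mulf_neq0 L'_neq0 SF0) GS; rewrite degM // /G !deg_comp.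
  have lt1 := deg_deriv_lt S'0; have lt2 := deg_deriv_lt L'_neq0.
  have leF : (deg L <= deg F)%N.
    rewrite level_degF degL; have := level_v_neq0; case: (v) => [|n _].
      by rewrite eqxx.
    by rewrite mulSn -addnA leq_addr.
  rewrite leqNgt => /negP; apply.
  apply: leq_trans (_ : (deg S^`()).+1 * deg F <= _)%N; last by rewrite leq_mul2r lt1 orbT.
  rewrite mulSn ltn_add2r; exact: leq_trans lt2 leF.
have [S1 eS1] := deriv_eq0_expp p_pr cardK S'0.
have [B1 eB1] := deriv_eq0_expp p_pr cardK B'0.
have [C1 eC1] := deriv_eq0_expp p_pr cardK C'0.
have G0 : G != 0.
  rewrite comp_poly_eq0; last by move: F_gt0; size_lia.
  by apply: contraNneq (lv_S lv) => ->; rewrite horner0.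
have key2 : j%:R * (A^`() * L) = - (M%:R * (A * L^`())).
  apply/eqP; rewrite -addr_eq0 -(mulrI_eq0 _ (mulfI G0)) -[X in _ == X]key S'0.
  rewrite comp_poly0 mulr0 addr0; apply/eqP.
  move: (M%:R : {poly K}) (j%:R : {poly K}) => m i; ring.
(* Since v j = -1 in [K], the relation j A' L = - M A L' solves to A' L = v M A L'. The same
   congruence makes (v + t1 p^k) j + 1 divisible by p^(k+1). *)
pose t1 := ((v * M) %% p)%N.
have logA : A^`() * L = (A * L^`()) *+ t1.
  have t1E : t1%:R = v%:R * M%:R :> {poly K}.
    rewrite -natrM [in RHS](divn_eq (v * M) p) natrD natrM.
    by rewrite (pcharf0 (pchar_polyK p_pr cardK)) mulr0 add0r.
  have vj : v%:R * j%:R = - 1 :> {poly K}.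
    by have := congr1 polyC level_vj; rewrite polyCM polyCN !polyC_natr.
  rewrite -mulr_natl t1E; apply: oppr_inj; rewrite -[LHS]mulN1r -vj.
  transitivity (v%:R * (j%:R * (A^`() * L))); first by rewrite mulrA.
  rewrite key2.
  by move: (M%:R : {poly K}) (v%:R : {poly K}) => m n; ring.
have t1p : (t1 < p)%N by rewrite ltn_mod prime_gt0.
have [A1 eA1] := logderiv_factor p_pr cardK t1p logA.
exists (v + t1 * p ^ k)%N, A1, B1, C1, S1; split.
- by rewrite {1}(lv_F lv) eA1 exprMn -!exprM -expnS mulrA -exprD.
- by rewrite {1}(lv_L lv) eB1 eC1 -!exprM -expnS.
- by rewrite {1}(lv_R lv) eS1 -exprM -expnS.
- by have := lv_S lv; rewrite eS1 horner_exp expf_eq0 negb_and prime_gt0.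
rewrite mulnDl addnAC level_M [(_ * _ * j)%N]mulnAC [(t1 * j * _)%N]mulnC -mulnDr.
rewrite expnSr dvdn_pmul2l ?expn_gt0 ?prime_gt0 // (dvdn_pcharf chp).
rewrite natrD natrM; have -> : t1%:R = v%:R * M%:R :> K.
  rewrite -natrM [in RHS](divn_eq (v * M) p) natrD natrM.
  by rewrite (pcharf0 chp) mulr0 add0r.
by rewrite mulrAC level_vj mulN1r addrN.
Qed.

End At.
End Levels.

(** * Digits of polynomials *)

Section Digits.
Variables (K : finFieldType) (p e : nat).
Hypotheses (p_pr : prime p) (cardK : #|K| = (p ^ e.+1)%N).
Let p_gt0 : (0 < p)%N := prime_gt0 p_pr.
Implicit Types (f g h : {poly K}) (i k t : nat).

Local Notation proot := (proot p_pr cardK).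

Lemma prootD : {morph proot : a b / a + b}.
Proof.
move=> a b; apply: (exppK_inj p_pr cardK (k := 1)).
by rewrite (expDpK p_pr cardK) expn1 !prootK.
Qed.

Lemma prootM : {morph proot : a b / a * b}.
Proof.
move=> a b; apply: (exppK_inj p_pr cardK (k := 1)).
by rewrite expn1 exprMn !prootK.
Qed.

Lemma proot0 : proot 0 = 0.
Proof. by apply: (addrI (proot 0)); rewrite -prootD !addr0. Qed.

Lemma proot_expp a : proot (a ^+ p) = a.
Proof. by apply: (exppK_inj p_pr cardK (k := 1)); rewrite expn1 prootK. Qed.

(* The components of [f] in the basis 1, X, .., X^(p-1) over the p-th powers:
   [f] is the sum of the ['X^i * digit i f ^+ p] for [i < p]. *)
Definition digit i f : {poly K} := \poly_(k < size f) proot (f`_(k * p + i)).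

Lemma coef_digit i f k : (digit i f)`_k = proot f`_(k * p + i).
Proof.
rewrite coef_poly; case: ltnP => // le; rewrite nth_default ?proot0 //.
by rewrite (leq_trans le) // (leq_trans (leq_pmulr k p_gt0)) // leq_addr.
Qed.

Lemma digitD i : {morph digit i : f g / f + g}.
Proof. by move=> f g; apply/polyP => k; rewrite coefD !coef_digit coefD prootD. Qed.

Lemma digitZ i a f : digit i (a *: f) = proot a *: digit i f.
Proof. by apply/polyP => k; rewrite coefZ !coef_digit coefZ prootM. Qed.

Lemma digit0 i : digit i 0 = 0.
Proof. by apply/polyP => k; rewrite coef_digit !coef0 proot0. Qed.

Lemma digit_sum i n (G : nat -> {poly K}) :
  digit i (\sum_(k < n) G k) = \sum_(k < n) digit i (G k).
Proof. exact: (big_morph (digit i) (digitD i) (digit0 i)). Qed.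

Lemma digitMn i f n : digit i (f *+ n) = digit i f *+ n.
Proof. by elim: n => [|n IH]; rewrite ?mulr0n ?digit0 // !mulrS digitD IH. Qed.

Lemma digitXnM i m f : (i < p)%N -> digit i ('X^(p * m) * f) = 'X^m * digit i f.
Proof.
move=> ip; apply/polyP => k; rewrite coef_digit !coefXnM.
have -> : (k * p + i < p * m)%N = (k < m)%N.
  rewrite mulnC; apply/idP/idP => [lt|lt].
    by rewrite -(ltn_pmul2l p_gt0); apply: leq_ltn_trans lt; apply: leq_addr.
  by apply: leq_trans (_ : p * k.+1 <= _)%N; rewrite ?leq_pmul2l // mulnS addnC ltn_add2r.
case: ltnP => lt; first by rewrite proot0.
by rewrite coef_digit mulnBl [(p * m)%N]mulnC addnBAC // leq_mul2r lt orbT.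
Qed.

Lemma digitM i f h : (i < p)%N -> digit i (h ^+ p * f) = h * digit i f.
Proof.
move=> ip; elim/poly_ind: h => [|h c IH].
  by rewrite expr0n gtn_eqF // !mul0r digit0.
have := expDp p_pr cardK 1 (h * 'X) c%:P; rewrite expn1 => ->.
rewrite mulrDl digitD exprMn [h ^+ p * _]mulrC -mulrA.
rewrite -{1}[p in 'X^p]muln1 digitXnM // IH expr1 -rmorphXn /= mul_polyC digitZ proot_expp.
by rewrite -mul_polyC; ring.
Qed.

Lemma digitXn i k : (i < p)%N -> (k < p)%N -> digit i 'X^k = (i == k)%:R.
Proof.
move=> ip kp; apply/polyP => m; rewrite coef_digit coefXn.
case: m => [|m].
  rewrite mul0n add0n; case: eqP => _; rewrite ?coef1 ?coef0 ?proot0 //=.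
  by rewrite -[X in proot X](expr1n _ p) proot_expp.
rewrite gtn_eqF ?proot0; first by case: eqP; rewrite ?coef1 ?coef0.
by rewrite mulSn -addnA (leq_trans kp) // leq_addr.
Qed.

Lemma digit_expn i t b c : (i <= t)%N -> (t < p)%N ->
  digit i ((b ^+ p + 'X * c ^+ p) ^+ t) = (b ^+ (t - i) * c ^+ i) *+ 'C(t, i).
Proof.
move=> it tp; rewrite exprDn (big_morph (digit i) (digitD i) (digit0 i)) (bigD1 (Ordinal (it : (i < t.+1)%N))) //=.
have term k : (k <= t)%N ->
    digit i ((b ^+ p) ^+ (t - k) * ('X * c ^+ p) ^+ k *+ 'C(t, k))
    = (b ^+ (t - k) * c ^+ k) * (i == k)%:R *+ 'C(t, k).
  move=> kt; rewrite digitMn; congr (_ *+ _).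
  have -> : (b ^+ p) ^+ (t - k) * ('X * c ^+ p) ^+ k = (b ^+ (t - k) * c ^+ k) ^+ p * 'X^k.
    by rewrite !exprMn -!exprM ![(p * _)%N]mulnC mulrA -!mulrA ['X^k * _]mulrC.
  by rewrite digitM ?(leq_ltn_trans it) // digitXn // ?(leq_ltn_trans it) // (leq_ltn_trans kt).
rewrite term // eqxx mulr1 big1 ?addr0 // => k /eqP ni; rewrite term -1?ltnS //.
by case: eqP => [ik|_]; [case: ni; apply: val_inj | rewrite mulr0 mul0rn].
Qed.

Lemma deg_digit i f T : (i < p)%N -> (deg f < p * T.+1)%N -> (deg (digit i f) <= T)%N.
Proof.
move=> ip df; suff : (size (digit i f) <= T.+1)%N by size_lia.
apply/leq_sizeP => k lek; rewrite coef_digit nth_default ?proot0 //.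
have := leq_mul (leqnn p) lek; move: df; rewrite [(k * p)%N]mulnC.
by move: (p * _)%N (p * _)%N => x y; size_lia.
Qed.

(* Satisfied by [u * g ^+ t] whenever [u^`() = 0] and [g^`()^`() = 0]. *)
Definition power_ode t f := f^`() ^+ 2 *+ (t - 1) = (f * f^`()^`()) *+ t.

Lemma power_odeZ t a f : a != 0 -> power_ode t (a *: f) -> power_ode t f.
Proof.
move=> a0; rewrite /power_ode !derivZ exprZn -scalerAl -scalerAr scalerA -expr2 !scalerMnr.
by apply: scalerI; rewrite expf_neq0.
Qed.

(* [f / f^`()] has derivative [1 / t], so [f] is, up to p-th powers,
   the t-th power of a polynomial of degree 1 over the field of p-th powers. *)
Lemma power_ode_factor t f : (0 < t < p)%N -> f != 0 -> power_ode t f ->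
  f^`() = 0 /\ (exists g, f = g ^+ p) \/
  exists c N, [/\ c != 0, digit t f != 0 & f * c ^+ (p * t) = digit t f ^+ p * N ^+ t].
Proof.
move=> /andP[t0 tp] f0 ode; have [f'0|c0] := eqVneq f^`() 0.
  by left; split=> //; apply: (deriv_eq0_expp p_pr cardK).
right; set c := f^`() in ode c0 *.
(* By the equation, t f / c - x has derivative 0; the factor c^p clears the denominator. *)
have [b eb] : exists b, (f *+ t - 'X * c) * c ^+ (p - 1) = b ^+ p.
  apply: (deriv_eq0_expp p_pr cardK); rewrite derivM deriv_exp derivB derivMn derivM derivX.
  have -> : ((p - 1).-1 = p - 2)%N by lia.
  have eqc : c ^+ (p - 1) = c * c ^+ (p - 2).
    by rewrite -exprS; congr (_ ^+ _); have := prime_gt1 p_pr; lia.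
  have -> : c^`() * c ^+ (p - 2) *+ (p - 1) = - (c^`() * c ^+ (p - 2)).
    have := pmul_eq0 p_pr cardK (c^`() * c ^+ (p - 2)) (dvdnn p).
    rewrite -{2}(subnK p_gt0) addn1 mulrS => /eqP.
    by rewrite addrC addr_eq0 => /eqP.
  have ode' : c * c *+ t - c * c = f * c^`() *+ t.
    by rewrite -ode expr2 -{1}(subnK t0) addn1 mulrSr addrK.
  rewrite eqc -/c; transitivity (c ^+ (p - 2) * ((c * c *+ t - c * c) - f * c^`() *+ t)).
    by move: (c ^+ (p - 2)) (c^`()) => x y; ring.
  by rewrite ode' subrr mulr0.
have cp : c ^+ p = c * c ^+ (p - 1) by rewrite -exprS subn1 prednK.
pose N := b ^+ p + 'X * c ^+ p.
have NE : N = f * c ^+ (p - 1) *+ t.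
  by rewrite /N -eb cp; move: (c ^+ (p - 1)) => y; ring.
have N' : N^`() = c ^+ p.
  have d k (u : {poly K}) : (u ^+ p)^`() = 0.
    by rewrite deriv_exp (pmul_eq0 p_pr cardK).
  by rewrite /N derivD derivM !d // derivX; ring.
(* As N = t f c^(p-1) and N' = c^p, the logarithmic derivative of f is t times that of N. *)
have [h eh] : exists h, f * N ^+ (p - t) = h ^+ p.
  apply: (deriv_eq0_expp p_pr cardK); rewrite derivM deriv_exp N' -/c.
  have -> : (p - t = (p - t).-1.+1)%N by lia.
  set n := (p - t).-1; rewrite /= exprS.
  have -> : c ^+ p * N ^+ n *+ n.+1 = - (c ^+ p * N ^+ n *+ t).
    apply/eqP; rewrite -addr_eq0 -mulrnDr; apply/eqP/(pmul_eq0 p_pr cardK).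
    by rewrite /n prednK ?subn_gt0 // subnK // ltnW.
  rewrite {1}NE cp; move: (c ^+ _) (N ^+ _) => x y.
  by ring.
have N0 : N != 0.
  by apply: contraNneq c0 => N0; move/eqP: N'; rewrite N0 deriv0 eq_sym expf_eq0 => /andP[_].
have fN : f * N ^+ p = h ^+ p * N ^+ t.
  by rewrite -eh -mulrA -exprD subnK // ltnW.
(* The t-th digit of N^t is its top coefficient c^t, so the unknown [h] can be expressed through
   [digit t f]. *)
have dN : digit t f * N = h * c ^+ t.
  rewrite mulrC -digitM // [_ * f]mulrC fN digitM // /N digit_expn //.
  by rewrite subnn mul1r binn mulr1n.
have h0 : h != 0.
  apply: contraNneq f0 => h0; move/eqP: fN; rewrite h0 expr0n gtn_eqF // mul0r mulf_eq0.
  by rewrite expf_eq0 (negPf N0) andbF orbF.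
exists c, N; split=> //.
  apply: contraNneq h0 => d0; move/eqP: dN; rewrite d0 mul0r eq_sym mulf_eq0.
  by rewrite expf_eq0 (negPf c0) andbF orbF.
have Np0 : N ^+ p != 0 by rewrite expf_neq0.
apply: (mulp_inj Np0); transitivity (h ^+ p * N ^+ t * c ^+ (p * t)).
  by rewrite -fN; ring.
transitivity ((digit t f * N) ^+ p * N ^+ t); last by rewrite exprMn; ring.
by rewrite dN exprMn -exprM [(t * p)%N]mulnC; ring.
Qed.

(** The number t (p^n - 1) / (p - 1), written in base p with n digits t: passing to a component over
    the p-th powers removes one digit. For n = 4 and t r = p - 1 it is (q - 1) / r, the bound on the
    degree of an MVSP with r + 1 values. *)
Fixpoint digit_bound t n : nat := if n is m.+1 then (p * digit_bound t m + t)%N else 0%N.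

Lemma digit_boundE t n : ((p - 1) * digit_bound t n + t = t * p ^ n)%N.
Proof.
elim: n => [|n IH] /=; first by rewrite muln0 muln1.
rewrite expnS mulnCA -IH; have pE : (p = (p - 1) + 1)%N by rewrite subnK.
move: (digit_bound t n) => B {IH}; move: (p - 1)%N pE => x ->; ring.
Qed.

Definition digits w f : {poly K} := foldl (fun g i => digit i g) f w.

(** Induction on n, ending at constants. Either f is the p-th power of its digit 0, or
    [power_ode_factor] recovers it from its digit t; this is why only words in 0 and t occur. *)
Lemma digits_power t n f : (0 < t < p)%N -> f != 0 -> (deg f <= digit_bound t n)%N ->
  (forall w, (size w < n)%N -> all (fun i => (i == 0%N) || (i == t)) w ->
     power_ode t (digits w f)) ->
  exists c g, c != 0 /\ f = c *: g ^+ t.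
Proof.
move=> tp; have /andP[t0 t_p] := tp; elim: n f => [|n IH] f f0 df ode.
  have [c fc] : exists c, f = c%:P by apply: deg0_polyC; apply/eqP; rewrite -leqn0.
  exists c, 1; rewrite expr1n -[f]/(f : {poly K}) fc alg_polyC; split=> //.
  by move: f0; rewrite fc polyC_eq0.
have step i : (i == 0%N) || (i == t) -> digit i f != 0 ->
    exists c g, c != 0 /\ digit i f = c *: g ^+ t.
  move=> it di0; apply: IH => //.
    apply: deg_digit; first by case/orP: it => /eqP ->.
    by rewrite (leq_ltn_trans df) //= mulnS addnC ltn_add2r.
  by move=> w sw aw; apply: (ode (i :: w)); rewrite /= ?it.
have [[f'0 [h fh]]|[c [N [c0 dt0 eq]]]] := power_ode_factor tp f0 (ode [::] isT isT).
  have dh : digit 0 f = h.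
    by rewrite fh -[h ^+ p]mulr1 digitM // -[1](expr0 'X) digitXn // mulr1.
  have h0 : h != 0 by apply: contraNneq f0 => h0; rewrite fh h0 expr0n gtn_eqF.
  have [|c [g [c0 dE]]] := step 0%N isT; first by rewrite dh.
  exists (c ^+ p), (g ^+ p); split; first by rewrite expf_neq0.
  by rewrite fh -dh dE exprZn -!exprM mulnC.
have [|a [g [a0 dE]]] := step t _ dt0; first by rewrite eqxx orbT.
(* Divisibility may be tested on t-th powers, where it is the equation just obtained. *)
have /dvdpP[u eu] : c ^+ p %| g ^+ p * N.
  rewrite -(dvdp_pexp2r _ _ t0) -exprM -(@dvdpZr _ (a ^+ p)) ?expf_neq0 //.
  have -> : a ^+ p *: (g ^+ p * N) ^+ t = f * c ^+ (p * t).
    by rewrite eq dE exprZn -scalerAl exprMn -!exprM mulnC.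
  by rewrite dvdp_mull.
exists (a ^+ p), u; split; first by rewrite expf_neq0.
have cpt : c ^+ (p * t) != 0 by rewrite expf_neq0.
apply: (mulp_inj cpt); rewrite mulrC eq dE exprZn -scalerAl -scalerAr; congr (_ *: _).
by rewrite exprAC -exprMn eu exprMn -exprM mulrC.
Qed.

Lemma size_poly_coefM s (A B : {poly {poly K}}) i :
  (forall i, (size (A`_i)%R <= s.+1)%N) -> (forall i, (size (B`_i)%R <= s.+1)%N) ->
  (size ((A * B)`_i)%R <= (s + s).+1)%N.
Proof.
move=> sA sB; rewrite coefM; apply: leq_trans (size_sum _ _ _) _.
apply/bigmax_leqP => k _; apply: leq_trans (size_mul_leq _ _) _.
by have := sA k; have := sB (i - k)%N; size_lia.
Qed.

Lemma coefM_top t (A B : {poly {poly K}}) : (size A <= t.+1)%N -> (size B <= t.+1)%N ->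
  (A * B)`_(t + t) = A`_t * B`_t.
Proof.
move=> sA sB; have lt : (t < (t + t).+1)%N by rewrite ltnS leq_addr.
rewrite coefM (bigD1 (Ordinal lt)) //= addnK big1 ?addr0 // => k /eqP nk.
have [lk|lk|ek] := ltngtP (nat_of_ord k) t.
- rewrite [X in _ * X]nth_default ?mulr0 // (leq_trans sB) //.
  by rewrite -addnBA ?(ltnW lk) // addnC -addn1 addnC leq_add2r subn_gt0.
- by rewrite nth_default ?mul0r // (leq_trans sA).
by case: nk; apply: val_inj; rewrite /= ek.
Qed.

(* The equation holds with ['X^P] replaced by an indeterminate, because its
   coefficients have degree less than [P]. *)
Lemma power_ode_ends t s P (E : nat -> {poly K}) f : (p %| P)%N -> (s + s < P)%N ->
  (forall i, (i <= t)%N -> (deg (E i) <= s)%N) ->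
  f = \sum_(i < t.+1) 'X^(P * i) * E i -> power_ode t f ->
  power_ode t (E 0%N) /\ power_ode t (E t).
Proof.
move=> pP sP dE fE ode.
pose Psi (G : nat -> {poly K}) : {poly {poly K}} := \poly_(i < t.+1) G i.
have hornerPsi G : (Psi G).['X^P] = \sum_(i < t.+1) 'X^(P * i) * G i.
  rewrite horner_poly; apply: eq_bigr => i _; by rewrite -exprM mulrC.
have dterm (g : {poly K}) i : ('X^(P * i) * g)^`() = 'X^(P * i) * g^`().
  by rewrite derivM derivXn (pmul_eq0 p_pr cardK) ?dvdn_mulr // mul0r add0r.
have dsum (G : nat -> {poly K}) : (\sum_(i < t.+1) 'X^(P * i) * G i)^`()
    = \sum_(i < t.+1) 'X^(P * i) * (G i)^`().
  elim: t.+1 => [|n IH]; first by rewrite !big_ord0 deriv0.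
  by rewrite !big_ord_recr /= derivD IH dterm.
pose E1 i := (E i)^`(); pose E2 i := (E1 i)^`().
have f1 : f^`() = (Psi E1).['X^P] by rewrite hornerPsi fE dsum.
have f2 : f^`()^`() = (Psi E2).['X^P] by rewrite f1 hornerPsi dsum hornerPsi.
pose N := (Psi E1 * Psi E1) *+ (t - 1) - (Psi E * Psi E2) *+ t.
have coefPsi (G : nat -> {poly K}) : (forall i, (i <= t)%N -> (deg (G i) <= s)%N) ->
    forall i, (size ((Psi G)`_i)%R <= s.+1)%N.
  move=> dG i; rewrite coef_poly; case: ltnP => [it|_]; last by rewrite size_poly0.
  by have := dG i it; size_lia.
have dE1 i : (i <= t)%N -> (deg (E1 i) <= s)%N.
  by move=> it; have := dE i it; have := deg_deriv_leq (E i); rewrite /E1; size_lia.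
have dE2 i : (i <= t)%N -> (deg (E2 i) <= s)%N.
  by move=> it; have := dE1 i it; have := deg_deriv_leq (E1 i); rewrite /E2; size_lia.
have N0 : N = 0.
  apply: (@horner_small_eq0 _ 'X^P); last first.
    rewrite /N hornerD hornerN !hornerMn !hornerM -f1 -f2 -expr2 ode.
    have -> : (Psi E).['X^P] = f by rewrite hornerPsi.
    by rewrite subrr.
  move=> i; rewrite size_polyXn ltnS coefB !coefMn.
  have szMn (u : {poly K}) n : (size (u *+ n)%R <= size u)%N.
    by rewrite -scaler_nat size_scale_leq.
  apply: leq_trans (size_polyD _ _) _; rewrite size_polyN geq_max.
  by apply/andP; split; apply: leq_trans (szMn _ _) _;
    apply: leq_trans (size_poly_coefM _ (s := s) _ _) _ => //; apply: coefPsi.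
have szPsi (G : nat -> {poly K}) : (size (Psi G) <= t.+1)%N by apply: size_poly.
have c (G : nat -> {poly K}) i : (i <= t)%N -> (Psi G)`_i = G i by move=> it; rewrite coef_poly ltnS it.
split; rewrite /power_ode; apply/eqP; rewrite -subr_eq0; apply/eqP.
  have := congr1 (fun g : {poly {poly K}} => g`_0) N0.
  by rewrite /N coefB !coefMn !coef0M !c // coef0 expr2.
have := congr1 (fun g : {poly {poly K}} => g`_(t + t)) N0.
by rewrite /N coefB !coefMn !coefM_top // !c // coef0 expr2.
Qed.

Lemma digitsZ w a f : a != 0 -> exists2 b, b != 0 & digits w (a *: f) = b *: digits w f.
Proof.
elim: w a f => [|i w IH] a f a0; first by exists a.
rewrite /= digitZ; apply: IH; apply: contraNneq a0 => r0.
by rewrite -(prootK p_pr cardK a) r0 expr0n gtn_eqF.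
Qed.

Lemma digits_sum w m n (G : nat -> {poly K}) : all (fun i => i < p)%N w ->
  digits w (\sum_(k < n) 'X^(p ^ (size w + m) * k) * G k)
  = \sum_(k < n) 'X^(p ^ m * k) * digits w (G k).
Proof.
elim: w G => [|i w IH] G //= /andP[ip wp].
rewrite -(IH (fun k => digit i (G k)) wp); congr (digits w _).
rewrite (digit_sum i n (fun k => 'X^(p ^ (size w + m).+1 * k) * G k)).
by apply: eq_bigr => k _; rewrite expnS -mulnA digitXnM.
Qed.

Lemma deg_digits w t m f : (t < p)%N -> all (fun i => i < p)%N w ->
  (deg f <= digit_bound t (size w + m))%N -> (deg (digits w f) <= digit_bound t m)%N.
Proof.
move=> tp; elim: w f => [|i w IH] f //= /andP[ip wp] df; apply: IH => //.
by apply: deg_digit => //; rewrite (leq_ltn_trans df) // mulnS addnC ltn_add2r.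
Qed.

Lemma digit_bound_double t m : (t + t <= p - 1)%N -> (0 < t)%N ->
  (digit_bound t m + digit_bound t m < p ^ m)%N.
Proof.
move=> tp t0; have p1 : (0 < p - 1)%N by apply: leq_trans tp; rewrite addn_gt0 t0.
have := leq_mul tp (leqnn (p ^ m)); rewrite mulnDl -digit_boundE => le.
rewrite -(ltn_pmul2l p1) mulnDr; apply: leq_trans le.
by move: (_ * _)%N => x; move: t0; clear; lia.
Qed.

Lemma split_power_ode t (L A : {poly K}) : L^`()^`() = 0 -> power_ode t (L ^+ t * A ^+ p).
Proof.
move=> L2; have dA (u : {poly K}) : (u * A ^+ p)^`() = u^`() * A ^+ p.
  by have := deriv_mul_expp p_pr cardK (k := 1) u A isT; rewrite expn1.
rewrite /power_ode !dA deriv_exp; case: t => [|[|n]] /=.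
- by rewrite mulr0n.
- by rewrite expr0 mulr1 mulr1n L2 mul0r mulr0 mul0rn.
rewrite derivMn derivM L2 mul0r add0r deriv_exp /= subn1 /= !exprS.
by move: (L ^+ n) (A ^+ p) (L^`()) => x y z; ring.
Qed.

(** F = A (L A^r)^t expands in powers of x^(p^n) with coefficients kap^t binom(t, i) A B^(t-i) C^i.
    These are kap^t times the digits of F = A^p (B^p + x C^p)^t, so [power_ode_ends] passes the
    equation from F to its digits 0 and t, and the same expansion serves for every further digit. *)
Lemma split_power t r (L A B C : {poly K}) kap n :
    (0 < t)%N -> (1 < r)%N -> (t * r = p - 1)%N ->
    L = B ^+ p + 'X * C ^+ p -> L ^+ t * A ^+ p != 0 -> kap != 0 ->
    kap *: (B + 'X^(p ^ n) * C) = L * A ^+ r ->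
    (deg (L ^+ t * A ^+ p) <= digit_bound t n.+1)%N ->
    (forall i, (i <= t)%N -> (deg (A * (B ^+ (t - i) * C ^+ i))%R <= digit_bound t n)%N) ->
  exists c g, c != 0 /\ L ^+ t * A ^+ p = c *: g ^+ t.
Proof.
move=> t0 r1 tr LE F0 kap0 EE dF dE; set F := L ^+ t * A ^+ p in F0 dF *.
have p1 := prime_gt1 p_pr.
(* This is where r >= 2 matters: products of two coefficients stay below degree p^m, as
   [power_ode_ends] requires. *)
have tt : (t + t <= p - 1)%N by rewrite -tr addnn -muln2 leq_mul2l r1 orbT.
have tp : (t < p)%N by move: tt t0 p1; clear; lia.
have L2 : L^`()^`() = 0.
  have d (u : {poly K}) : (u ^+ p)^`() = 0 by rewrite deriv_exp (pmul_eq0 p_pr cardK).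
  by rewrite LE derivD derivM !d derivX mul1r mulr0 addr0 add0r d.
pose E i := kap ^+ t *: ((A * (B ^+ (t - i) * C ^+ i)) *+ 'C(t, i)).
have FE : F = \sum_(i < t.+1) 'X^(p ^ n * i) * E i.
  have -> : F = A * (L * A ^+ r) ^+ t.
    by rewrite exprMn -exprM [(r * t)%N]mulnC tr mulrCA -exprS subn1 prednK.
  rewrite -EE exprZn -scalerAr exprDn mulr_sumr scaler_sumr; apply: eq_bigr => i _.
  rewrite /E -scalerAr exprMn -exprM; congr (_ *: _).
  by move: ('X^_) (B ^+ _) (C ^+ _) => x y z; ring.
have digE i : (i == 0%N) || (i == t) -> E i = kap ^+ t *: digit i F.
  move=> it; have ip : (i < p)%N by case/orP: it => /eqP ->.
  have i_le : (i <= t)%N by case/orP: it => /eqP ->.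
  have -> : F = A ^+ p * L ^+ t by rewrite mulrC.
  by rewrite digitM // LE digit_expn // mulrnAr.
have words w : (size w <= n)%N -> all (fun i => (i == 0%N) || (i == t)) w ->
    power_ode t (digits w F).
  elim: w => [|i w IH] /= sw; first by move=> _; apply: split_power_ode.
  case/andP=> it aw; have wp : all (fun i => i < p)%N w.
    by apply: sub_all aw => k /orP[] /eqP ->.
  have ode := IH (ltnW sw) aw; pose m := (n - size w)%N.
  have nm : (n = size w + m)%N by rewrite /m subnKC // ltnW.
  have m0 : (0 < m)%N by rewrite subn_gt0.
  have dFE : digits w F = \sum_(k < t.+1) 'X^(p ^ m * k) * digits w (E k).
    by rewrite FE {1}nm digits_sum.
  have [] := @power_ode_ends t (digit_bound t m) (p ^ m) (fun k => digits w (E k)) _ _ _ _ dFE ode.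
  - by rewrite dvdn_exp.
  - exact: digit_bound_double.
  - move=> k kt; apply: deg_digits => //; rewrite -nm /E.
    apply: leq_trans (deg_scale_leq _ _) _; rewrite -scaler_nat.
    by apply: leq_trans (deg_scale_leq _ _) _; apply: dE.
  have kt0 : kap ^+ t != 0 by rewrite expf_neq0.
  move=> ode0 odet; have odei : power_ode t (digits w (E i)).
    by case/orP: it => /eqP ->.
  have [b b0 bE] := digitsZ w (digit i F) kt0.
  by move: odei; rewrite digE // bE; apply: power_odeZ.
apply: (@digits_power t n.+1) => //.
by rewrite t0.
Qed.

End Digits.

(** * Minimal value set polynomials with a subfield as value set *)

Section Sufficiency.
Variables (K : finFieldType) (p : nat).
Hypotheses (p_pr : prime p) (cardK : #|K| = (p ^ 4)%N).
Let p_gt1 : (1 < p)%N := prime_gt1 p_pr.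

Lemma card_roots_leq (g : {poly K}) (W : {set K}) : g != 0 ->
  (forall w, w \in W -> g.[w] = 0) -> (#|W| <= deg g)%N.
Proof. by move=> g0 /lin_prod_dvdP /(dvdp_deg g0); rewrite deg_lin_prod. Qed.

Lemma card_leq_value_set (f : {poly K}) : (0 < deg f)%N ->
  (#|K| <= #|value_set f| * deg f)%N.
Proof.
move=> d0; rewrite -sum_nat_const -sum1_card.
rewrite (partition_big (fun a => f.[a]) (mem (value_set f))) /=; last first.
  by move=> a _; apply: imset_f.
apply: leq_sum => y _; rewrite sum1_card -(deg_subC y d0).
rewrite -(eq_card (_ : fiber f y =i _)); last by move=> a; rewrite !inE.
apply: card_roots_leq (subC_neq0 y d0) _ => a; rewrite inE => /eqP fa.
by rewrite !hornerE fa subrr.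
Qed.

(** A value is taken at most deg f times, so q <= #V deg f. Together with r deg f <= q - 1 this
    excludes #V <= r. *)
Lemma mvsp_of_card_leq (f : {poly K}) r : (0 < deg f)%N ->
  (#|value_set f| <= r.+1)%N -> (r * deg f <= #|K| - 1)%N ->
  mvsp f /\ #|value_set f| = r.+1.
Proof.
move=> d0 Vr rd; have qV := card_leq_value_set d0.
have K0 : (0 < #|K|)%N by rewrite cardK expn_gt0 prime_gt0.
have eV : #|value_set f| = r.+1.
  apply/eqP; rewrite eqn_leq Vr /= ltnNge; apply/negP => le.
  have := leq_trans qV (leq_mul le (leqnn (deg f))).
  by move: rd K0; move: (r * _)%N => x; lia.
split=> //; split; first by move: d0; size_lia.
rewrite eV -addn1; congr addn; apply/esym/eqP; rewrite eqn_leq; apply/andP; split.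
  rewrite -ltnS ltn_divLR // -eV; move: qV K0; move: (_ * _)%N => x; lia.
by rewrite leq_divRL.
Qed.

Lemma card_subfield_leq n : (1 < n)%N -> (#|subfield_of_order K n| <= n)%N.
Proof.
move=> n1; have s : size ('X^n - 'X : {poly K}) = n.+1.
  by rewrite size_polyDl ?size_polyXn // size_polyN size_polyX ltnS.
have := @card_roots_leq ('X^n - 'X) (subfield_of_order K n); rewrite s; apply.
  by rewrite -size_poly_eq0 s.
by move=> w; rewrite inE !hornerE => /eqP ->; rewrite subrr.
Qed.

Lemma mvsp_subfield (g : {poly K}) n : (1 < n)%N -> (0 < deg g)%N ->
  (forall x, g.[x] ^+ n = g.[x]) -> ((n - 1) * deg g <= #|K| - 1)%N ->
  mvsp g /\ value_set g = subfield_of_order K n.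
Proof.
move=> n1 d0 gn le; have sub : value_set g \subset subfield_of_order K n.
  by apply/subsetP => _ /imsetP[x _ ->]; rewrite inE gn.
have [|||mg cg] := @mvsp_of_card_leq g (n - 1); rewrite ?d0 //.
  apply: leq_trans (subset_leq_card sub) _; rewrite subn1 (prednK (ltnW n1)) //.
  exact: card_subfield_leq.
split=> //; apply/eqP; rewrite eqEcard sub cg subn1 (prednK (ltnW n1)) //.
exact: card_subfield_leq.
Qed.

(* The norm ['X^T] to the subfield of order [n] takes [n] values. *)
Lemma card_subfield n T : (1 < n)%N -> ((n - 1) * T = #|K| - 1)%N ->
  #|subfield_of_order K n| = n.
Proof.
move=> n1 nT; have q1 : (1 < #|K|)%N by rewrite cardK -(exp1n 4) ltn_exp2r.
have T0 : (0 < T)%N by move: nT; case: T => //; rewrite muln0; lia.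
have TE : (T * n = T.-1 + #|K|)%N.
  have -> : (T * n = (n - 1) * T + T)%N by rewrite -mulSnr subn1 (prednK (ltnW n1)) mulnC.
  by rewrite nT; move: T0 q1; clear; move: #|_| => q; lia.
have [_ VE] : mvsp ('X^T : {poly K}) /\ value_set 'X^T = subfield_of_order K n.
  apply: mvsp_subfield; rewrite ?size_polyXn ?nT // => x.
  by rewrite hornerXn -exprM TE exprD expf_card -exprSr prednK.
apply/eqP; rewrite eqn_leq card_subfield_leq //= -VE.
have := @card_leq_value_set 'X^T; rewrite size_polyXn => /(_ T0) le.
rewrite leqNgt; apply/negP => lt; have : (#|value_set ('X^T : {poly K})| * T <= (n - 1) * T)%N.
  by rewrite leq_mul2r; apply/orP; right; move: lt n1; move: #|_| => x; clear; lia.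
by move/(leq_trans le); rewrite nT leqNgt subn1 (prednK (ltnW q1)) leqnn.
Qed.

Lemma mvsp_subfieldP (g : {poly K}) n T : (1 < n)%N -> ((n - 1) * T = #|K| - 1)%N ->
  mvsp g /\ value_set g = subfield_of_order K n <->
  [/\ (0 < deg g)%N, (deg g <= T)%N & forall x, g.[x] ^+ n = g.[x]].
Proof.
move=> n1 nT; split=> [[mg Vg]|[d0 dT gn]]; last first.
  by apply: mvsp_subfield => //; rewrite -nT leq_mul2l dT orbT.
split.
- by case: mg; size_lia.
- have := mvsp_deg_leq mg; rewrite Vg (card_subfield n1 nT) -nT leq_pmul2l //.
  by rewrite subn_gt0.
move=> x; have : g.[x] \in value_set g by apply: imset_f.
by rewrite Vg inE => /eqP.
Qed.

(** For n m = q and j = h m + l, n j = h q + n l is congruent to h + n l modulo q - 1. Unlike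
    reduction modulo q - 1, this permutes the exponents below q and keeps 0 and q - 1 apart. *)
Definition rotate (n m j : nat) := (j %/ m + n * (j %% m))%N.

(** The sum of the g_i^n x^(rotate i) represents g^n as a function on [K], hence g. Both polynomials
    have size at most q, so they are equal. *)
Lemma rotate_coef (g : {poly K}) n m k : (n * m = #|K|)%N -> n = (p ^ k)%N ->
  (size g <= #|K|)%N -> (forall x, g.[x] ^+ n = g.[x]) ->
  forall j, (j < #|K|)%N -> g`_(rotate n m j) = g`_j ^+ n.
Proof.
move=> nm nk sg gn j jq.
have K0 : (0 < #|K|)%N by rewrite cardK expn_gt0 prime_gt0.
have /andP[n0 m0] : (0 < n)%N && (0 < m)%N by rewrite -muln_gt0 nm.
have hi_lt i : (i < #|K|)%N -> (i %/ m < n)%N by rewrite ltn_divLR ?nm.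
have rot_lt i : (i < #|K|)%N -> (rotate n m i < #|K|)%N.
  move=> iq; rewrite /rotate -nm; apply: leq_trans (_ : n + n * (i %% m) <= _)%N.
    by rewrite ltn_add2r hi_lt.
  by rewrite -mulnS leq_mul2l ltn_mod m0 orbT.
have rot_inj i i' : (i < #|K|)%N -> (i' < #|K|)%N ->
    rotate n m i = rotate n m i' -> i = i'.
  move=> iq i'q eqr; rewrite (divn_eq i m) (divn_eq i' m).
  have mod_rot h : (h < #|K|)%N -> (rotate n m h %% n)%N = (h %/ m)%N.
    by move=> hq; rewrite /rotate addnC mulnC modnMDl modn_small ?hi_lt.
  have div_rot h : (h < #|K|)%N -> (rotate n m h %/ n)%N = (h %% m)%N.
    by move=> hq; rewrite /rotate addnC mulnC divnMDl // divn_small ?hi_lt ?addn0.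
  by rewrite -!mod_rot // -!div_rot // eqr.
pose g2 := \sum_(i < #|K|) (g`_i ^+ n) *: 'X^(rotate n m i).
have eg : g = g2.
  apply/eqP; rewrite -subr_eq0; apply/eqP.
  apply: (@roots_geq_poly_eq0 _ _ (enum K)); rewrite ?enum_uniq //; last first.
    rewrite -cardE; apply: leq_trans (size_polyD _ _) _; rewrite size_polyN geq_max sg.
    apply: leq_trans (size_sum _ _ _) _; apply/bigmax_leqP => i _.
    by apply: leq_trans (size_scale_leq _ _) _; rewrite size_polyXn rot_lt.
  apply/allP => x _; rewrite /root hornerD hornerN subr_eq0 -gn; apply/eqP.
  rewrite horner_sum nk {1}(horner_coef_wide x sg).
  rewrite (big_morph (fun y : K => y ^+ (p ^ k)) (expDpK p_pr cardK k) (_ : _ = 0)); last first.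
    by rewrite expr0n gtn_eqF // expn_gt0 prime_gt0.
  apply: eq_bigr => i _; rewrite hornerZ hornerXn exprMn -nk; congr (_ * _).
  rewrite /rotate -exprM {1}(divn_eq i m) mulnDl [(_ * m * n)%N]mulnAC -mulnA nm.
  by rewrite !exprD mulnC exprM expf_card [(n * _)%N]mulnC.
rewrite {1}eg coef_sum (bigD1 (Ordinal jq)) //= coefZ coefXn eqxx mulr1 big1 ?addr0 //.
move=> i ni; rewrite coefZ coefXn; case: eqP => [/rot_inj eqi|_]; last by rewrite mulr0.
by case/eqP: ni; apply: val_inj; rewrite /= eqi.
Qed.

Lemma poly_of_support (E : seq nat) (g : {poly K}) : uniq E ->
  (forall i, g`_i != 0 -> i \in E) -> g = \sum_(e <- E) g`_e *: 'X^e.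
Proof.
move=> uE sup; apply/polyP => i; rewrite coef_sum.
have [iE|niE] := boolP (i \in E).
  rewrite (bigD1_seq i) //= coefZ coefXn eqxx mulr1 big1_seq ?addr0 // => e /andP[ne _].
  by rewrite coefZ coefXn eq_sym (negPf ne) mulr0.
have -> : g`_i = 0 by apply/eqP; apply: contraNT niE => /sup.
rewrite big1_seq // => e /andP[_ eE]; rewrite coefZ coefXn.
case: eqP => [ie|_]; last by rewrite mulr0.
by rewrite -ie (negPf niE) in eE.
Qed.

(** A nonzero coefficient at h n + l forces one at l n + h. Both exponents are at most n + 1, so h
    and l are 0 or 1. *)
Lemma formFp2P (g : {poly K}) :
  (mvsp g /\ value_set g = subfield_of_order K (p ^ 2)) <->
  ((1 < size g)%N /\ formFp2 p g).
Proof.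
set n := (p ^ 2)%N; have n1 : (1 < n)%N by rewrite -(exp1n 2) ltn_exp2r.
have nn : (n * n = #|K|)%N by rewrite cardK /n -expnD.
have nT : ((n - 1) * (n + 1) = #|K| - 1)%N by rewrite -nn; nia.
rewrite (mvsp_subfieldP g n1 nT); split=> [[d0 dT gn]|[s1 [a [b [c [aE cE gE]]]]]].
  split; first by move: d0; size_lia.
  have sg : (size g <= #|K|)%N by have := leq_mul n1 (leqnn n); rewrite -nn; move: (n * n)%N dT n1 => x; size_lia.
  have rot := rotate_coef nn (erefl n) sg gn.
  have sup i : g`_i != 0 -> i \in [:: n + 1; n; 1; 0]%N.
    move=> gi; have lt h : g`_h != 0 -> (h <= n + 1)%N.
      apply: contraNT; rewrite -ltnNge => lt; rewrite nth_default //.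
      by move: dT lt; clear; size_lia.
    have iq : (i < #|K|)%N.
      have := lt _ gi; have := leq_mul n1 (leqnn n); rewrite -nn; move: n1.
      by move: (n * n)%N => x; move: (n) => m; clear; lia.
    have := lt (rotate n n i); rewrite rot // expf_neq0 // => /(_ isT).
    have := lt _ gi; rewrite /rotate; have := divn_eq i n; have := ltn_pmod i (ltnW n1).
    move: (i %/ n)%N (i %% n)%N => h l; move: n1; move: (n) => m; clear => n1 ln ei le1 le2.
    have h1 : (h <= 1)%N by nia.
    have l1 : (l <= 1)%N by nia.
    by rewrite !inE ei; case: h h1 {ei le1 le2} => [|[|//]] _; case: l l1 {ln} => [|[|//]] _;
      rewrite ?mul0n ?mul1n ?addn0 ?add0n ?eqxx ?orbT.
  have uE : uniq [:: n + 1; n; 1; 0]%N by rewrite /= !inE; move: n1; move: (n) => m; clear; lia.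
  have q_gt : (n + 1 < #|K|)%N.
    by have := leq_mul n1 (leqnn n); rewrite -nn; move: n1;
      move: (n * n)%N => x; move: (n) => m; clear; lia.
  have r0 : g`_0 = g`_0 ^+ n.
    by rewrite -rot ?(ltn_trans _ q_gt) ?addn1 // /rotate div0n mod0n muln0.
  have r1 : g`_1 = g`_n ^+ n.
    rewrite -rot ?(leq_trans _ q_gt) ?addn1 // /rotate divnn modnn muln0 addn0.
    by rewrite (ltnW n1).
  have rn1 : g`_(n + 1) = g`_(n + 1) ^+ n.
    rewrite -rot // /rotate divnDl // divnn (ltnW n1) divn_small // addn0.
    by rewrite modnDl modn_small // muln1 addnC.
  exists g`_(n + 1), g`_n, g`_0; split; rewrite ?inE -?r0 -?rn1 //.
  rewrite [LHS](poly_of_support uE sup) !big_cons big_nil addr0 -r1 expr0 alg_polyC expr1.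
  by rewrite !addrA.
have Kn (x : K) : x ^+ n ^+ n = x by rewrite -exprM nn expf_card.
split; first by move: s1; size_lia.
  rewrite gE -ltnS; have sE e c' : (e <= n + 1)%N -> (size (c' *: 'X^e : {poly K})%R <= n + 2)%N.
    move=> le; rewrite (leq_trans (size_scale_leq _ _)) // size_polyXn.
    by rewrite addn2 ltnS -addn1.
  have sD (f1 f2 : {poly K}) : (size f1 <= n + 2)%N -> (size f2 <= n + 2)%N ->
      (size (f1 + f2)%R <= n + 2)%N.
    by move=> l1 l2; rewrite (leq_trans (size_polyD _ _)) // geq_max l1.
  suff : (size g <= n + 2)%N by rewrite gE; size_lia.
  have sX c' : (size (c' *: 'X : {poly K}) <= n + 2)%N by apply: (sE 1%N); rewrite addn1.
  have sC c' : (size (c'%:P : {poly K}) <= n + 2)%N.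
    by rewrite (leq_trans (size_polyC_leq1 _)) // addn2.
  by rewrite gE; do !apply: (sD) => //; apply: (sE) => //; rewrite leq_addr.
move=> x; rewrite gE !(hornerD, hornerZ, hornerXn, hornerC, hornerX) /n !(expDpK p_pr cardK) !exprMn -/n.
move: aE cE; rewrite !inE => /eqP -> /eqP ->; rewrite exprD expr1 !exprMn !Kn.
by move: (x ^+ n) (b ^+ n) => y b'; ring.
Qed.

Let dig d3 d2 d1 d0 := (d3 * p ^ 3 + d2 * p ^ 2 + d1 * p + d0)%N.

Let dig_lt d2 d1 d0 : (d2 < p)%N -> (d1 < p)%N -> (d0 < p)%N ->
  (d2 * p ^ 2 + d1 * p + d0 < p ^ 3)%N.
Proof.
move=> h2 h1 h0; apply: leq_trans (_ : d2.+1 * p ^ 2 <= _)%N; last first.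
  by rewrite [(p ^ 3)%N]expnS leq_mul2r h2 orbT.
rewrite mulSn -addnA addnC ltn_add2r; apply: leq_trans (_ : d1.+1 * p <= _)%N.
  by rewrite mulSn addnC ltn_add2r.
by rewrite -mulnn leq_mul2r h1 orbT.
Qed.

Let rotate_dig d3 d2 d1 d0 : (d2 < p)%N -> (d1 < p)%N -> (d0 < p)%N ->
  rotate p (p ^ 3) (dig d3 d2 d1 d0) = dig d2 d1 d0 d3.
Proof.
move=> h2 h1 h0; have := dig_lt h2 h1 h0; rewrite /rotate /dig -!addnA => lt.
rewrite divnMDl ?expn_gt0 ?prime_gt0 // modnMDl divn_small // modn_small // addn0.
by rewrite (expnS p 2) -mulnn; ring.
Qed.

Let digits j : (j < p ^ 4)%N -> exists d3 d2 d1 d0,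
  [/\ (d3 < p)%N, (d2 < p)%N, (d1 < p)%N & (d0 < p)%N] /\ j = dig d3 d2 d1 d0.
Proof.
move=> lt; have p0 := ltnW p_gt1.
exists (j %/ p ^ 3)%N, (j %/ p ^ 2 %% p)%N, (j %/ p %% p)%N, (j %% p)%N.
rewrite !ltn_mod p0 ltn_divLR ?expn_gt0 ?p0 // -expnS; split=> //.
rewrite /dig {1}(divn_eq j p) {1}(divn_eq (j %/ p) p) -divnMA.
rewrite {1}(divn_eq (j %/ (p * p)) p) -divnMA -mulnn.
by rewrite (_ : p * p * p = p ^ 3)%N 1?mulnC ?expnSr ?expn0 ?mul1n //; nia.
Qed.

(** Reads the four base-p digits off the rotations. As a left inverse of [dig] it shows that the
    sixteen exponents of [formFp] are distinct. *)
Let decode j := [seq iter i (rotate p (p ^ 3)) j %/ p ^ 3 | i <- iota 0 4]%N.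

Let decode_dig d3 d2 d1 d0 : (d3 < p)%N -> (d2 < p)%N -> (d1 < p)%N -> (d0 < p)%N ->
  decode (dig d3 d2 d1 d0) = [:: d3; d2; d1; d0].
Proof.
move=> h3 h2 h1 h0; have top e3 e2 e1 e0 : (e2 < p)%N -> (e1 < p)%N -> (e0 < p)%N ->
    (dig e3 e2 e1 e0 %/ p ^ 3)%N = e3.
  move=> l2 l1 l0; have := dig_lt l2 l1 l0; rewrite /dig -!addnA => lt.
  by rewrite divnMDl ?expn_gt0 ?prime_gt0 // divn_small ?addn0.
by rewrite /decode /= !rotate_dig // !top.
Qed.

(** All four rotations of an exponent in the support are at most p^3 + p^2 + p + 1, so its base-p
    digits are 0 or 1. Within an orbit of rotations the coefficients are Frobenius conjugates. *)
Lemma formFpP (g : {poly K}) :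
  (mvsp g /\ value_set g = subfield_of_order K p) <->
  ((1 < size g)%N /\ formFp p g).
Proof.
set T := (p ^ 3 + p ^ 2 + p + 1)%N.
have p2 : (p * 2 <= p ^ 2)%N by rewrite -mulnn leq_mul2l p_gt1 orbT.
have p3 : (p ^ 2 * 2 <= p ^ 3)%N by rewrite (expnSr p 2) leq_mul2l p_gt1 orbT.
have p4 : (p ^ 3 * 2 <= p ^ 4)%N by rewrite (expnSr p 3) leq_mul2l p_gt1 orbT.
have pT : ((p - 1) * T = #|K| - 1)%N.
  by rewrite cardK /T mulnBl mul1n !mulnDr muln1 -!expnS mulnn; lia.
have e2 (y : K) : y ^+ (p ^ 2) = y ^+ p ^+ p by rewrite -mulnn exprM.
have e3 (y : K) : y ^+ (p ^ 3) = y ^+ p ^+ p ^+ p by rewrite (expnSr p 2) exprM e2.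
rewrite (mvsp_subfieldP g p_gt1 pT); split=> [[dg0 dT gn]|[s1 fE]].
  split; first by move: dg0; size_lia.
  have T_lt : (T < p ^ 4)%N.
    by rewrite /T; move: (p ^ 2)%N (p ^ 3)%N (p ^ 4)%N p2 p3 p4 => P2 P3 P4;
      move: p_gt1; clear; move: p => n; lia.
  have sg : (size g <= #|K|)%N by rewrite cardK; move: dT T_lt; clear; size_lia.
  have rot d3 d2 d1 d0 : (d3 < p)%N -> (d2 < p)%N -> (d1 < p)%N -> (d0 < p)%N ->
      g`_(dig d2 d1 d0 d3) = g`_(dig d3 d2 d1 d0) ^+ p.
    move=> h3 h2 h1 h0; rewrite -rotate_dig // (@rotate_coef g p (p ^ 3) 1) ?expn1 ?cardK //; first by rewrite -cardK.
    have := dig_lt h2 h1 h0; rewrite /dig -!addnA => lt_rest.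
    apply: leq_trans (_ : d3.+1 * p ^ 3 <= _)%N; last first.
      by rewrite (expnS p 3) leq_mul2r h3 orbT.
    by rewrite mulSnr ltn_add2l.
  have lt h : g`_h != 0 -> (h <= T)%N.
    apply: contraNT; rewrite -ltnNge => lt; rewrite nth_default //.
    by move: dT lt; clear; size_lia.
  pose E := [:: dig 1 1 1 1; dig 1 1 1 0; dig 1 1 0 1; dig 1 0 1 1; dig 0 1 1 1;
    dig 1 1 0 0; dig 1 0 0 1; dig 0 0 1 1; dig 0 1 1 0; dig 1 0 1 0; dig 0 1 0 1;
    dig 1 0 0 0; dig 0 0 0 1; dig 0 0 1 0; dig 0 1 0 0; dig 0 0 0 0].
  have uE : uniq E.
    by apply: (@map_uniq _ _ decode); rewrite /E /= !decode_dig // (ltnW p_gt1).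
  have top d3 d2 d1 d0 : g`_(dig d3 d2 d1 d0) != 0 -> (d3 <= 1)%N.
    move/lt; rewrite leqNgt [(d3 <= 1)%N]leqNgt; apply: contra => d3_gt1.
    have := leq_mul d3_gt1 (leqnn (p ^ 3)); rewrite /T /dig.
    move: (d3 * p ^ 3)%N (d2 * p ^ 2)%N (d1 * p)%N => x y z.
    by move: (p ^ 2)%N (p ^ 3)%N p2 p3 p_gt1 => P2 P3; clear; move: p => n; lia.
  have sup i : g`_i != 0 -> i \in E.
    move=> gi; have [d3 [d2 [d1 [d0 [[h3 h2 h1 h0] ei]]]]] := digits (leq_ltn_trans (lt _ gi) T_lt).
    move: gi; rewrite ei => gi {ei}.
    have gi1 : g`_(dig d2 d1 d0 d3) != 0 by rewrite rot // expf_neq0.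
    have gi2 : g`_(dig d1 d0 d3 d2) != 0 by rewrite rot // expf_neq0.
    have gi3 : g`_(dig d0 d3 d2 d1) != 0 by rewrite rot // expf_neq0.
    move: (top _ _ _ _ gi) (top _ _ _ _ gi1) (top _ _ _ _ gi2) (top _ _ _ _ gi3).
    clear; rewrite /E; case: d3 => [|[|//]]; case: d2 => [|[|//]];
    by case: d1 => [|[|//]]; case: d0 => [|[|//]]; rewrite !inE eqxx ?orbT.
  have p0 := ltnW p_gt1.
  exists g`_(dig 1 1 1 1); exists g`_(dig 1 1 1 0); exists g`_(dig 1 1 0 0).
  exists g`_(dig 1 0 1 0); exists g`_(dig 1 0 0 0); exists g`_(dig 0 0 0 0).
  have r1 := rot 1%N 1%N 1%N 0%N p_gt1 p_gt1 p_gt1 p0.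
  have r2 := rot 1%N 1%N 0%N 1%N p_gt1 p_gt1 p0 p_gt1.
  have r3 := rot 1%N 0%N 1%N 1%N p_gt1 p0 p_gt1 p_gt1.
  have s1 := rot 1%N 1%N 0%N 0%N p_gt1 p_gt1 p0 p0.
  have s2 := rot 1%N 0%N 0%N 1%N p_gt1 p0 p0 p_gt1.
  have s3 := rot 0%N 0%N 1%N 1%N p0 p0 p_gt1 p_gt1.
  have t1 := rot 1%N 0%N 1%N 0%N p_gt1 p0 p_gt1 p0.
  have t2 := rot 0%N 1%N 0%N 1%N p0 p_gt1 p0 p_gt1.
  have u1 := rot 1%N 0%N 0%N 0%N p_gt1 p0 p0 p0.
  have u2 := rot 0%N 0%N 0%N 1%N p0 p0 p0 p_gt1.
  have u3 := rot 0%N 0%N 1%N 0%N p0 p0 p_gt1 p0.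
  have a0 := rot 1%N 1%N 1%N 1%N p_gt1 p_gt1 p_gt1 p_gt1.
  have f0 := rot 0%N 0%N 0%N 0%N p0 p0 p0 p0.
  have inF (y : K) n : y ^+ n = y -> y \in subfield_of_order K n by rewrite inE => ->.
  split; [exact: inF | exact: inF | by apply: inF; rewrite -mulnn exprM -t1 -t2 | ].
  rewrite [LHS](poly_of_support uE sup) /E !big_cons big_nil addr0.
  rewrite !e2 !e3 -r1 -r2 -r3 -s1 -s2 -s3 -t1 -u1 -u2 -u3.
  rewrite /dig !mul1n !mul0n !add0n !addn0 expr0 alg_polyC expr1.
  by rewrite !addrA.
case: fE => [a [b [c [d [u [w [aE wE dE gE]]]]]]].
have sE e c' : (e <= T)%N -> (size (c' *: 'X^e : {poly K})%R <= T.+1)%N.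
  by move=> le; rewrite (leq_trans (size_scale_leq _ _)) // size_polyXn.
have sX c' : (size (c' *: 'X : {poly K}) <= T.+1)%N by apply: (sE 1%N); rewrite /T addn1.
have sC c' : (size (c'%:P : {poly K}) <= T.+1)%N by rewrite (leq_trans (size_polyC_leq1 _)).
have sD (f1 f2 : {poly K}) : (size f1 <= T.+1)%N -> (size f2 <= T.+1)%N ->
    (size (f1 + f2)%R <= T.+1)%N.
  by move=> l1 l2; rewrite (leq_trans (size_polyD _ _)) // geq_max l1.
split; first by move: s1; size_lia.
  suff : (size g <= T.+1)%N by size_lia.
  rewrite gE; do !apply: (sD) => //; apply: (sE); rewrite /T;
    by move: (p ^ 2)%N (p ^ 3)%N => P2 P3; clear; move: p => n; lia.
move=> x; rewrite gE !(hornerD, hornerZ, hornerXn, hornerC, hornerX).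
move: aE wE dE; rewrite !inE !e2 !e3 => /eqP ap /eqP wp /eqP dp.
have e4 (y : K) : y ^+ p ^+ p ^+ p ^+ p = y.
  by rewrite -e3 -exprM -expnS -cardK expf_card.
have eD (y z : K) : (y + z) ^+ p = y ^+ p + z ^+ p.
  by have := expDpK p_pr cardK 1 y z; rewrite expn1.
rewrite !eD !exprMn ap wp.
rewrite !exprD !expr1 !e2 !e3 !exprMn !e4 dp.
move: (x ^+ p) (x ^+ p ^+ p) (x ^+ p ^+ p ^+ p) => x1 x2 x3.
move: (b ^+ p) (b ^+ p ^+ p) (b ^+ p ^+ p ^+ p) => b1 b2 b3.
move: (c ^+ p) (c ^+ p ^+ p) (c ^+ p ^+ p ^+ p) => c1 c2 c3.
move: (u ^+ p) (u ^+ p ^+ p) (u ^+ p ^+ p ^+ p) => u1 u2 u3.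
by move: (d ^+ p) => d1; ring.
Qed.

End Sufficiency.

(** * The listed types are minimal value set polynomials *)

Section Types.
Variables (K : finFieldType) (p : nat).
Hypotheses (p_pr : prime p) (cardK : #|K| = (p ^ 4)%N).
Let p_gt1 : (1 < p)%N := prime_gt1 p_pr.
Let q_gt1 : (1 < #|K|)%N.
Proof. by rewrite cardK -(exp1n 4) ltn_exp2r. Qed.

Lemma affine_equiv_mvsp (f g : {poly K}) : affine_equiv f g -> mvsp g ->
  mvsp f /\ #|value_set f| = #|value_set g|.
Proof.
case=> a1 [b1 [a2 [b2 [a10 a20 fE]]]] [s1 cg].
have s2 : size (a1 *: 'X + b1%:P : {poly K}) = 2.
  by rewrite size_polyDl size_scale ?size_polyX // ltnS size_polyC_leq1.
have sf : size f = size g.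
  rewrite fE size_polyDl size_scale // size_comp_poly2 //.
  exact: leq_ltn_trans (size_polyC_leq1 _) s1.
have cV : #|value_set f| = #|value_set g|.
  have inj : injective (fun y => a2 * y + b2) by move=> y z /addIr /(mulfI a20).
  rewrite -[RHS](card_imset _ inj); apply: eq_card => y; apply/imsetP/imsetP.
    case=> x _ ->; exists (g.[a1 * x + b1]); first by apply: imset_f.
    by rewrite fE !hornerE horner_comp !hornerE.
  case=> _ /imsetP[x _ ->] ->; exists ((x - b1) / a1) => //.
  rewrite fE hornerD hornerC hornerZ horner_comp hornerD hornerC hornerZ hornerX.
  by rewrite [a1 * _]mulrC divfK // subrK.
by split=> //; split; rewrite ?sf ?cV.
Qed.

(** All values of g^v are roots of x N, so there are at most deg N + 1 of them; the degree
    hypothesis supplies the other half of [mvsp_of_card_leq]. *)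
Lemma exp_mvsp (g N : {poly K}) v : (0 < v)%N -> (0 < deg g)%N -> N != 0 ->
  (forall x, g.[x] * N.[g.[x] ^+ v] = 0) -> (deg N * (v * deg g) <= #|K| - 1)%N ->
  mvsp (g ^+ v) /\ #|value_set (g ^+ v)| = (deg N).+1.
Proof.
move=> v0 dg N0 gN le; apply: (mvsp_of_card_leq p_pr cardK).
- by rewrite deg_expn muln_gt0 v0.
- have -> : (deg N).+1 = deg ('X * N).
    by rewrite degM ?polyX_eq0 // size_polyX add1n.
  apply: card_roots_leq => [|_ /imsetP[x _ ->]]; first by rewrite mulf_neq0 ?polyX_eq0.
  rewrite hornerM hornerX horner_exp; case: v v0 gN {le} => // v _ gN.
  by rewrite {1}exprSr -mulrA gN mulr0.
by rewrite deg_expn.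
Qed.

Lemma deg_Xn_sub1 n : (0 < n)%N -> deg ('X^n - 1 : {poly K}) = n.
Proof. by move=> n0; rewrite size_XnsubC. Qed.

Lemma type_i_mvsp (G : {poly K}) : type_i p G -> mvsp G /\ (2 <= #|value_set G| - 1)%N.
Proof.
case=> v [/dvdnP[r rv] nv] ->; have q1 : (0 < p ^ 4 - 1)%N by rewrite subn_gt0 -cardK.
have /andP[r0 v0] : (0 < r)%N && (0 < v)%N by rewrite -muln_gt0 -rv.
have r1 : (1 < r)%N by rewrite ltn_neqAle r0 andbT eq_sym; apply/eqP => r1; apply: nv; rewrite rv r1 mul1n.
have dN := deg_Xn_sub1 r0.
have [||||mG cG] := @exp_mvsp 'X ('X^r - 1) v v0; rewrite ?size_polyX ?dN ?muln1 //.
- by rewrite -size_poly_gt0; move: dN r0; size_lia.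
- move=> x; rewrite !hornerE -exprM mulnC -rv -cardK mulrBr mulr1 -exprS.
  by rewrite subn1 prednK ?(ltnW q_gt1) // expf_card subrr.
- by rewrite -rv cardK.
by rewrite cG dN subn1.
Qed.

Lemma exp_subfield_mvsp (g : {poly K}) t n : (1 < n)%N ->
  proper_divisor t (n - 1) -> mvsp g -> value_set g = subfield_of_order K n ->
  #|subfield_of_order K n| = n ->
  mvsp (g ^+ t) /\ (2 <= #|value_set (g ^+ t)| - 1)%N.
Proof.
move=> n1 [/dvdnP[r rt] nt] mg Vg cn.
have n0 : (0 < n - 1)%N by rewrite subn_gt0.
have /andP[r0 t0] : (0 < r)%N && (0 < t)%N by rewrite -muln_gt0 -rt.
have r1 : (1 < r)%N by rewrite ltn_neqAle r0 andbT eq_sym; apply/eqP => r1; apply: nt; rewrite rt r1 mul1n.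
have dN := deg_Xn_sub1 r0.
have [||||mG cG] := @exp_mvsp g ('X^r - 1) t t0; rewrite ?dN //.
- by case: mg; size_lia.
- by rewrite -size_poly_gt0; move: dN r0; size_lia.
- move=> x; have : g.[x] \in value_set g by apply: imset_f.
  rewrite Vg inE => /eqP gx; rewrite !hornerE -exprM mulnC -rt mulrBr mulr1 -exprS.
  by rewrite subn1 (prednK (ltnW n1)) gx subrr.
- by rewrite mulnA -rt -{1}cn -Vg mvsp_deg_leq.
by rewrite cG dN subn1.
Qed.

Lemma card_subfield_p : #|subfield_of_order K p| = p.
Proof.
apply: (card_subfield p_pr cardK (T := p ^ 3 + p ^ 2 + p + 1)) => //.
by rewrite cardK mulnBl mul1n !mulnDr muln1 -!expnS mulnn; lia.
Qed.

Lemma card_subfield_p2 : #|subfield_of_order K (p ^ 2)| = (p ^ 2)%N.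
Proof.
apply: (card_subfield p_pr cardK (T := p ^ 2 + 1)).
  by rewrite -(exp1n 2) ltn_exp2r.
by rewrite cardK mulnBl mul1n mulnDr muln1 -expnD; lia.
Qed.

(** * Types (iv) and (v): powers of linearized polynomials *)

Definition poly_iv (beta : K) : {poly K} :=
  'X^(p ^ 2) + (1 + (beta ^+ (p ^ 3) - beta ^+ (p ^ 2)) ^+ (p - 1)) *: 'X^p
  - ((beta ^+ p - beta) ^- (p - 1)) *: 'X.

(* The monic polynomial with kernel spanned by [1] and [beta] over the prime field. *)
Definition annihilator (beta y : K) : K :=
  y ^+ (p ^ 2) - (1 + (beta ^+ p - beta) ^+ (p - 1)) * y ^+ p
  + (beta ^+ p - beta) ^+ (p - 1) * y.

Lemma expDpp (x y : K) : (x + y) ^+ p = x ^+ p + y ^+ p.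
Proof. by have := expDpK p_pr cardK 1 x y; rewrite expn1. Qed.

Lemma expNpp (x : K) : (- x) ^+ p = - x ^+ p.
Proof. by have := expNpK p_pr cardK 1 x; rewrite expn1. Qed.

Lemma expr_p2 (y : K) : y ^+ (p ^ 2) = y ^+ p ^+ p. Proof. by rewrite -mulnn exprM. Qed.
Lemma expr_p3 (y : K) : y ^+ (p ^ 3) = y ^+ p ^+ p ^+ p.
Proof. by rewrite (expnSr p 2) exprM expr_p2. Qed.
Lemma expr_p4 (y : K) : y ^+ p ^+ p ^+ p ^+ p = y.
Proof. by rewrite -expr_p3 -exprM -expnS -cardK expf_card. Qed.

(** Let g = beta^p - beta, with conjugates g1, g2, g3. The coefficients of [poly_iv] are 1, 1 + g3 /
    g2 and - g / g1, and g has trace 0; eliminating g3 leaves a rational identity. *)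
Lemma poly_iv_annihilated (beta x : K) : beta \notin subfield_of_order K p ->
  annihilator beta (poly_iv beta).[x] = 0.
Proof.
rewrite inE => nb; rewrite /annihilator /poly_iv !(hornerD, hornerN, hornerZ, hornerXn, hornerX).
rewrite !expr_p3 !expr_p2.
set b1 := beta ^+ p; set b2 := b1 ^+ p; set b3 := b2 ^+ p.
set g := b1 - beta.
have g0 : g != 0 by rewrite subr_eq0.
have -> : b3 - b2 = g ^+ p ^+ p by rewrite /g !(expDpp, expNpp).
have gE (k : K) : k != 0 -> k ^+ (p - 1) = k ^+ p / k.
  by move=> k0; rewrite -{2}(subnK (ltnW p_gt1)) addn1 exprS mulrC mulKf.
set g1 := g ^+ p; set g2 := g1 ^+ p; set g3 := g2 ^+ p.
have g10 : g1 != 0 by rewrite expf_neq0.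
have g20 : g2 != 0 by rewrite expf_neq0.
have g30 : g3 != 0 by rewrite expf_neq0.
rewrite !gE // -/g1 -/g3.
have tr : g + g1 + g2 + g3 = 0.
  rewrite /g3 /g2 /g1 /g !(expDpp, expNpp) -/b1 -/b2 -/b3.
  by rewrite /b3 /b2 /b1 expr_p4; ring.
have g4 : g3 ^+ p = g by rewrite /g3 /g2 /g1 expr_p4.
set x1 := x ^+ p; set x2 := x1 ^+ p; set x3 := x2 ^+ p.
have x4 : x3 ^+ p = x by rewrite /x3 /x2 /x1 expr_p4.
have [eg1 eg2 eg3] : [/\ g ^+ p = g1, g1 ^+ p = g2 & g2 ^+ p = g3] by [].
have [ex1 ex2 ex3] : [/\ x ^+ p = x1, x1 ^+ p = x2 & x2 ^+ p = x3] by [].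
clearbody g3 g2 g1 g x3 x2 x1.
set w := x2 + (1 + g3 / g2) * x1 - (g1 / g)^-1 * x.
have w1 : w ^+ p = x3 + (1 + g / g3) * x2 - (g2 / g1)^-1 * x1.
  by rewrite /w !(expDpp, expNpp, exprMn, exprVn, expr1n) g4 eg1 eg2 eg3 ex1 ex2 ex3.
have w2 : w ^+ p ^+ p = x + (1 + g1 / g) * x3 - (g3 / g2)^-1 * x2.
  by rewrite w1 !(expDpp, expNpp, exprMn, exprVn, expr1n) g4 x4 eg1 eg2 eg3 ex2 ex3.
have g3E : g3 = - (g + g1 + g2) by apply/eqP; rewrite -addr_eq0 addrC tr.
rewrite w2 w1 /w; move: g30; rewrite g3E => g30.
by field; rewrite ?g0 ?g10 ?g20 ?g30.
Qed.

Let p2_gt_p : (p < p ^ 2)%N.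
Proof. by rewrite -{1}(expn1 p) ltn_exp2l. Qed.

Lemma size_poly_iv beta : size (poly_iv beta) = (p ^ 2).+1.
Proof.
rewrite /poly_iv -addrA size_polyDl size_polyXn //.
apply: leq_ltn_trans (size_polyD _ _) _; rewrite size_polyN gtn_max !ltnS.
apply/andP; split; apply: leq_trans (size_scale_leq _ _) _.
  by rewrite size_polyXn.
by rewrite size_polyX (leq_trans p_gt1) // ltnW.
Qed.

Lemma type_iv_mvsp (G : {poly K}) : type_iv p G -> mvsp G /\ (2 <= #|value_set G| - 1)%N.
Proof.
case=> beta [v [nb /dvdnP[s sv] ->]]; rewrite -/(poly_iv beta).
have p1 : (0 < p - 1)%N by rewrite subn_gt0.
have /andP[s0 v0] : (0 < s)%N && (0 < v)%N by rewrite -muln_gt0 -sv.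
have p2E : (p ^ 2 = (v * (s * (p + 1))).+1)%N.
  by rewrite mulnA [(v * s)%N]mulnC -sv mulnBl mul1n mulnDr muln1 mulnn; have := p2_gt_p; lia.
have pE : (p = (v * s).+1)%N by rewrite mulnC -sv; have := p_gt1; lia.
set d := (beta ^+ p - beta) ^+ (p - 1).
(* Chosen so that w N(w^v) is the annihilator of w: p - 1 = v s and p^2 - 1 = v s (p + 1). *)
pose N : {poly K} := 'X^(s * (p + 1)) + (d%:P - (1 + d) *: 'X^s).
have sN : size N = (s * (p + 1)).+1.
  rewrite /N size_polyDl size_polyXn //; apply: leq_ltn_trans (size_polyD _ _) _.
  rewrite size_polyN gtn_max; apply/andP; split.
    by rewrite (leq_ltn_trans (size_polyC_leq1 _)) // ltnS muln_gt0 s0 addn1.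
  rewrite (leq_ltn_trans (size_scale_leq _ _)) // size_polyXn ltnS.
  by rewrite -[X in (X < _)%N]muln1 ltn_mul2l s0 addn1 ltnS ltnW.
have [||||mG cG] := @exp_mvsp (poly_iv beta) N v v0; rewrite ?size_poly_iv ?sN //.
- by rewrite expn_gt0 prime_gt0.
- by rewrite -size_poly_eq0 sN.
- move=> x; rewrite -[RHS](poly_iv_annihilated x nb) /annihilator -/d.
  move: (_.[x]) => w; rewrite /N !(hornerD, hornerN, hornerZ, hornerXn, hornerC).
  have e1 : w ^+ (p ^ 2) = w * w ^+ (v * (s * (p + 1))) by rewrite -exprS -p2E.
  have e2 : w ^+ p = w * w ^+ (v * s) by rewrite -exprS -pE.
  rewrite -!exprM e1 e2.
  by move: (w ^+ _) (w ^+ _) => y z; ring.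
- have -> : (s * (p + 1) * (v * p ^ 2) = (p ^ 2 - 1) * p ^ 2)%N.
    by rewrite mulnA [(_ * v)%N]mulnC {2}p2E subn1.
  rewrite cardK mulnBl -expnD mul1n leq_sub2l // expn_gt0 prime_gt0 //.
split=> //; rewrite cG sN subn1 /=; apply: leq_trans p_gt1 _.
exact: leq_trans (leq_addr 1 p) (leq_pmull _ s0).
Qed.

(** The left side is the trace of [w] to the prime field; it yields the polynomial N for type
    (v). *)
Lemma trace_eq0 (x : K) (w := x ^+ p - x) :
  w ^+ (p ^ 3) + w ^+ (p ^ 2) + w ^+ p + w = 0.
Proof. by rewrite /w expr_p3 expr_p2 !(expDpp, expNpp) expr_p4; ring. Qed.

Lemma type_v_mvsp (G : {poly K}) : type_v p G -> mvsp G /\ (2 <= #|value_set G| - 1)%N.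
Proof.
case=> v /dvdnP[s sv] ->.
have p1 : (0 < p - 1)%N by rewrite subn_gt0.
have /andP[s0 v0] : (0 < s)%N && (0 < v)%N by rewrite -muln_gt0 -sv.
have pE : (p = (v * s).+1)%N by rewrite mulnC -sv; have := p_gt1; lia.
have p2E : (p ^ 2 = (v * (s * (p + 1))).+1)%N.
  by rewrite mulnA [(v * s)%N]mulnC -sv mulnBl mul1n mulnDr muln1 mulnn; have := p2_gt_p; lia.
have p3_gt : (p ^ 2 < p ^ 3)%N by rewrite ltn_exp2l.
have p3E : (p ^ 3 = (v * (s * (p ^ 2 + p + 1))).+1)%N.
  rewrite mulnA [(v * s)%N]mulnC -sv mulnBl mul1n !mulnDr muln1 mulnn -expnS.
  by have := p2_gt_p; have := p3_gt; lia.
set n := (s * (p ^ 2 + p + 1))%N.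
pose N : {poly K} := 'X^n + ('X^(s * (p + 1)) + ('X^s + 1)).
have sN : size N = n.+1.
  rewrite /N size_polyDl size_polyXn //; apply: leq_ltn_trans (size_polyD _ _) _.
  rewrite gtn_max size_polyXn ltnS; apply/andP; split.
    by rewrite ltn_mul2l s0 /= -addnA -[X in (X < _)%N]add0n ltn_add2r expn_gt0 prime_gt0.
  apply: leq_ltn_trans (size_polyD _ _) _; rewrite gtn_max size_polyXn size_poly1 !ltnS.
  have n0 : (s < n)%N.
    by rewrite -[X in (X < _)%N]muln1 ltn_mul2l s0 addn1 ltnS addn_gt0 expn_gt0 prime_gt0.
  by rewrite n0 (leq_ltn_trans _ n0).
have dX : size ('X^p - 'X : {poly K}) = p.+1.
  by rewrite size_polyDl ?size_polyXn // size_polyN size_polyX ltnS.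
have [||||mG cG] := @exp_mvsp ('X^p - 'X) N v v0; rewrite ?dX ?sN //.
- by rewrite prime_gt0.
- by rewrite -size_poly_eq0 sN.
- move=> x; have := trace_eq0 x; rewrite !(hornerD, hornerN, hornerXn, hornerX, hornerC) /=.
  move: (_ - x) => w <-.
  have e1 : w ^+ (p ^ 3) = w * w ^+ (v * n) by rewrite -exprS -p3E.
  have e2 : w ^+ (p ^ 2) = w * w ^+ (v * (s * (p + 1))) by rewrite -exprS -p2E.
  have e3 : w ^+ p = w * w ^+ (v * s) by rewrite -exprS -pE.
  rewrite -!exprM e1 e2 e3.
  by move: (w ^+ _) (w ^+ _) (w ^+ _) => y z u; ring.
- have -> : (n * (v * p) = (p ^ 3 - 1) * p)%N.
    by rewrite mulnA [(_ * v)%N]mulnC p3E subn1.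
  by rewrite cardK mulnBl -expnSr mul1n leq_sub2l // prime_gt0.
split=> //; rewrite cG sN subn1 /= /n; apply: leq_trans p_gt1 _.
by apply: leq_trans (leq_pmull _ s0); rewrite -addnA addnCA leq_addr.
Qed.

Lemma classified_mvsp (f : {poly K}) :
  (exists G : {poly K},
     [\/ type_i p G, type_ii p G, type_iii p G | type_iv p G \/ type_v p G]
     /\ affine_equiv f G) ->
  mvsp f /\ (2 <= #|value_set f| - 1)%N.
Proof.
case=> G [tG fG]; suff [mG VG] : mvsp G /\ (2 <= #|value_set G| - 1)%N.
  by have [mf ->] := affine_equiv_mvsp fG mG.
have p2_gt1 : (1 < p ^ 2)%N by apply: ltn_trans p_gt1 p2_gt_p.
case: tG => [|[t [g [dt mg Vg ->]]]|[t [g [dt mg Vg ->]]]|[|]].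
- exact: type_i_mvsp.
- exact: exp_subfield_mvsp p_gt1 dt mg Vg card_subfield_p.
- exact: exp_subfield_mvsp p2_gt1 dt mg Vg card_subfield_p2.
- exact: type_iv_mvsp.
exact: type_v_mvsp.
Qed.

End Types.

(** * Classification when L divides the Wronskian *)

Section LevelDegrees.
Variables (K : finFieldType) (p : nat).
Hypotheses (p_pr : prime p) (cardK : #|K| = (p ^ 4)%N).
Variables (Z : {set K}) (F R : {poly K}) (c0 : K) (j : nat).
Hypotheses (Z_gt0 : (0 < #|Z|)%N) (F_gt0 : (0 < deg F)%N) (c0_neq0 : c0 != 0).
Hypothesis RF : (R \Po F) * lin_prod Z
  = - c0 *: (lin_prod Z + ('X^#|K| - 'X) * (lin_prod Z)^`()).
Variables (k v : nat) (A B C S : {poly K}).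
Hypotheses (k_gt0 : (0 < k)%N) (k_le4 : (k <= 4)%N) (lv : level p Z F R j k v A B C S).

(** The left side is the degree of L^M A^j S(F). In B + x^(p^(4-k)) C a nonconstant B cannot
    dominate, because M #Z >= p^k deg B > deg B. *)
Lemma level_degE :
  ((v * j + 1) %/ p ^ k * #|Z| + j * deg A + deg S * deg F <= p ^ (4 - k) + deg C)%N.
Proof.
have [kap kap0 eE] := level_E p_pr cardK c0_neq0 RF k_gt0 lv k_le4.
have A0 := level_A_neq0 p_pr Z_gt0 F_gt0 k_gt0 lv.
have C0 := level_C_neq0 p_pr cardK Z_gt0 k_gt0 lv.
have SF0 : S \Po F != 0.
  rewrite comp_poly_eq0; last by move: F_gt0; size_lia.
  by apply: contraNneq (lv_S lv) => ->; rewrite horner0.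
have M0 := level_M_gt0 lv.
have dL := level_degL p_pr cardK Z_gt0 k_gt0 lv.
move: M0; set M := (_ %/ _)%N in eE * => M0.
have := congr1 (fun g : {poly K} => deg g) eE; rewrite /= deg_scale //.
rewrite degM ?mulf_neq0 ?expf_neq0 ?lin_prod_neq0 // degM ?expf_neq0 ?lin_prod_neq0 //.
rewrite !deg_expn deg_lin_prod deg_comp => <-.
have := degD_leq B ('X^(p ^ (4 - k)) * C).
have := degM_leq ('X^(p ^ (4 - k))) C; rewrite size_polyXn /=.
have := congr1 (fun g : {poly K} => deg g) eE; rewrite /= deg_scale //.
rewrite degM ?mulf_neq0 ?expf_neq0 ?lin_prod_neq0 // degM ?expf_neq0 ?lin_prod_neq0 //.
rewrite !deg_expn deg_lin_prod deg_comp.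
have := leq_mul M0 (leqnn #|Z|); rewrite mul1n.
have := leq_mul (pk_gt1 p_pr k_gt0) (leqnn (deg B)).
move: Z_gt0; rewrite dL.
move: (p ^ (4 - k))%N (_ * deg F)%N (j * _)%N (p ^ k * _)%N (p ^ k * _)%N (M * _)%N.
by move=> x y z u w t; size_lia.
Qed.

End LevelDegrees.

Section Classify.
Variables (K : finFieldType) (p : nat).
Hypotheses (p_pr : prime p) (cardK : #|K| = (p ^ 4)%N).
Let chp : p \in [pchar K] := card_finPcharP cardK p_pr.
Let p_gt1 : (1 < p)%N := prime_gt1 p_pr.

Definition classified (f : {poly K}) : Prop :=
  exists G : {poly K},
    [\/ type_i p G, type_ii p G, type_iii p G | type_iv p G \/ type_v p G]
    /\ affine_equiv f G.

Section NormalForm.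
Variables (f : {poly K}) (y0 : K) (R : {poly K}) (c0 : K) (t : nat).
Hypotheses (f_mvsp : mvsp f) (V_gt2 : (2 < #|value_set f|)%N).
Hypothesis (nf : normal_form p f y0 R c0 t).
Hypothesis y0V : y0 \in value_set f.

Let Z := fiber f y0.
Let L := lin_prod Z.
Let F : {poly K} := f - y0%:P.
Let r := deg R.

Let f_gt0 : (0 < deg f)%N.
Proof. by case: f_mvsp; case: (size f). Qed.
Let dF : deg F = deg f. Proof. exact: deg_subC. Qed.
Let F_gt0 : (0 < deg F)%N. Proof. by rewrite dF. Qed.
Let Z_gt0 : (0 < #|Z|)%N.
Proof.
by rewrite card_gt0; apply/set0Pn; case/imsetP: y0V => a _ ya; exists a; rewrite inE ya.
Qed.
Let r_gt1 : (1 < r)%N.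
Proof. by rewrite /r (nf_sizeR nf); move: V_gt2; case: #|_| => [|[|[|n]]]. Qed.
Let rd_leq : (r * deg F <= #|K| - 1)%N.
Proof. by rewrite dF /r (nf_sizeR nf) -subn1 mvsp_deg_leq. Qed.
Let q_gt1 : (1 < #|K|)%N.
Proof. by rewrite cardK -(exp1n 4) ltn_exp2r. Qed.
Let RF : (R \Po F) * L = - c0 *: (L + ('X^#|K| - 'X) * L^`()) := nf_eq nf.
Let c0_neq0 := nf_c0 nf.

Lemma normal_form_level : exists j A B C S,
  (0 < j)%N /\ level p Z F R j 1 t A B C S.
Proof.
have R_neq0 : R != 0 by rewrite -size_poly_gt0; move: r_gt1; rewrite /r; size_lia.
have [j [R2 R20 eR]] := multiplicity_XsubC R 0.
move: R20 eR; rewrite R_neq0 /= subr0 mulrC => R20 eR.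
have j0 : (0 < j)%N.
  rewrite lt0n; apply: contraNneq R20 => j0; rewrite /root.
  by have := nf_R0 nf; rewrite eR j0 expr0 mul1r => ->.
have eu : R2 *+ (t * j + 1) + ('X * R2^`()) *+ t = 0.
  have Xj : 'X^j != 0 :> {poly K} by rewrite expf_neq0 ?polyX_eq0.
  apply: (mulp_inj Xj); rewrite mulr0 -[RHS](nf_euler nf) eR derivM derivXn.
  have -> : 'X * ('X^(j.-1) *+ j * R2 + 'X^j * R2^`())
      = 'X^j * (R2 *+ j + 'X * R2^`()).
    rewrite mulrDr mulrnAl mulrnAr mulrA -exprS prednK // mulrDr mulrnAr; congr (_ + _).
    by rewrite mulrCA.
  rewrite -[X in _ = _ + X]mulrnAr -[RHS]mulrDr; congr (_ * _).
  rewrite mulrnDr mulr1n [in RHS]mulrnDl -mulrnA [(j * t)%N]mulnC [RHS]addrA.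
  by rewrite [R2 + _]addrC.
have ptj : (p %| t * j + 1)%N.
  rewrite (dvdn_pcharf chp); have := congr1 (horner^~ 0) eu.
  rewrite /= hornerD !hornerMn hornerM hornerX mul0r mul0rn addr0 horner0 => /eqP.
  by rewrite -mulr_natr mulf_eq0 -[R2.[0] == 0]/(root R2 0) (negPf R20).
have t_neq0 : t%:R != 0 :> {poly K}.
  rewrite -(dvdn_pcharf (pchar_polyK p_pr cardK)); case/andP: (nf_t nf) => t0 tp.
  by rewrite gtnNdvd.
have R2' : R2^`() = 0.
  move: eu; rewrite (pmul_eq0 p_pr cardK _ ptj) add0r -mulr_natr => /eqP.
  by rewrite !mulf_eq0 polyX_eq0 (negPf t_neq0) orbF => /eqP.
have [S eS] := deriv_eq0_expp p_pr cardK R2'.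
have [B [C eL]] := deriv2_eq0_split p_pr cardK (nf_deriv2 nf).
have [_ tp] := andP (nf_t nf).
have f'F : F^`() = f^`() by rewrite /F derivB derivC subr0.
have [A eA] := logderiv_factor p_pr cardK tp (etrans (congr1 ( *%R^~ L) f'F) (nf_logderiv nf)).
exists j, A, B, C, S; split=> //; split; rewrite ?expn1 //; first by rewrite eR eS.
by apply: contraNneq R20 => S0; rewrite /root eS horner_exp S0 expr0n gtn_eqF ?prime_gt0.
Qed.

(** For L = x - a, [RF] reads R(F) = - c0 (x - a)^(q-1). Since R(0) = 0, F divides this power. *)
Lemma linear_classified : #|Z| = 1%N -> classified f.
Proof.
move/eqP/cards1P => [a Za].
have eL : L = 'X - a%:P by rewrite /L Za /lin_prod big_set1.
have lin0 : 'X - a%:P != 0 :> {poly K} by rewrite polyXsubC_eq0.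
have RFE : R \Po F = - c0 *: ('X - a%:P) ^+ (#|K| - 1).
  apply: (mulp_inj lin0); rewrite mulrC -eL RF eL derivXsubC mulr1.
  rewrite -scalerAr -exprS subn1 prednK ?(ltnW q_gt1) // cardK (expBp p_pr cardK).
  by congr (_ *: _); rewrite -polyC_exp -cardK expf_card; ring.
have [R1 eR] : exists R1, R = 'X * R1.
  have /factor_theorem[R1] : root R 0 by apply/eqP/(nf_R0 nf).
  by rewrite subr0 mulrC => ->; exists R1.
have : F %| ('X - a%:P) ^+ (#|K| - 1).
  rewrite -(@dvdpZr _ (- c0)) ?oppr_eq0 // -RFE eR comp_polyM comp_polyX.
  by rewrite dvdp_mulr.
case/dvdp_exp_XsubCP => m mq /eqpP [[c1 c2] /= /andP[c10 c20] eF].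
have {}eF : F = (c2 / c1) *: ('X - a%:P) ^+ m.
  by rewrite mulrC -scalerA -eF scalerA mulVf // scale1r.
have dm : deg F = m.
  by rewrite eF deg_scale ?mulf_neq0 ?invr_eq0 // size_exp_XsubC.
have := congr1 (fun g : {poly K} => deg g) RFE.
rewrite /= deg_comp deg_scale ?oppr_eq0 // size_exp_XsubC /= dm -/r => rm.
exists 'X^m; split.
  constructor 1; exists m => //; rewrite -cardK -rm; split; first exact: dvdn_mull.
  move=> eqm; have := r_gt1; have : (0 < m)%N by rewrite -dm.
  by move: eqm; clear; nia.
exists 1, (- a), (c2 / c1), y0; rewrite oner_eq0 mulf_neq0 ?invr_eq0 //; split=> //.
by rewrite scale1r polyCN rmorphXn /= comp_polyX -eF subrK.
Qed.

(** Here #Z <= p + deg C, while #Z is the maximum of p^3 deg B and p^3 deg C + 1; as p^3 >= p + 2,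
    both B and C are constant. *)
Lemma level3_card j v A B C S : level p Z F R j 3 v A B C S -> #|Z| = 1%N.
Proof.
move=> lv; have := level_degE p_pr cardK Z_gt0 F_gt0 c0_neq0 RF (isT : 0 < 3)%N (isT : 3 <= 4)%N lv.
have M0 := level_M_gt0 lv; have dL := level_degL p_pr cardK Z_gt0 (isT : 0 < 3)%N lv.
have := leq_mul M0 (leqnn #|Z|); rewrite mul1n expn1.
have n3 : (p + 2 <= p ^ 3)%N.
  have := leq_mul (leqnn p) (leq_mul p_gt1 p_gt1); rewrite (mulnn p) -expnS.
  by move: (p ^ 3)%N p_gt1; clear; move: p => m x; lia.
have := leq_mul n3 (leqnn (deg B)); have := leq_mul n3 (leqnn (deg C)).
rewrite !mulnDl dL; move: (_ * maxn _ _)%N (j * _)%N (_ * deg F)%N => x y z.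
have [-> | b1] := posnP (deg B); have [-> | c1] := posnP (deg C); rewrite ?muln0 //.
- have := leq_mul (leqnn p) c1; rewrite muln1.
  by move: (p ^ 3 * _)%N (p * _)%N c1 => u w; size_lia.
- have := leq_mul (leqnn p) b1; rewrite muln1.
  by move: (p ^ 3 * _)%N (p * _)%N b1 => u w; size_lia.
have := leq_mul (leqnn p) c1; rewrite muln1.
have := leq_mul (leqnn p) b1; rewrite muln1.
by move: (p ^ 3 * _)%N (p * _)%N (p ^ 3 * _)%N (p * _)%N b1 c1 => u w u' w'; size_lia.
Qed.

Lemma affine_equiv_scale (g G : {poly K}) a b : a != 0 -> g = a *: G + b%:P ->
  affine_equiv g G.
Proof.
move=> a0 ->; exists 1, 0, a, b; rewrite oner_eq0; split=> //.
by rewrite scale1r addr0 comp_polyXr.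
Qed.

Lemma horner_off_fiber a : a \notin Z -> R.[F.[a]] = - c0.
Proof.
move=> aZ; have La : L.[a] != 0 by rewrite -[_ == 0]/(root L a) root_lin_prod.
have := congr1 (horner^~ a) RF; rewrite /= hornerM horner_comp [in RHS]hornerZ.
rewrite [in RHS]hornerD [in RHS]hornerM horner_genPoly mul0r addr0.
by move/(mulIf La).
Qed.

(** Off the fibre R(F) = - c0, so g^(n-1) is constant there; dividing g by one of its values off the
    fibre puts all values in the subfield. The degree bound comes from (n - 1) deg g = r deg F. *)
Lemma exp_classified rho c g n v : (1 < n)%N -> (v * r = n - 1)%N ->
    R = rho *: 'X^r -> c != 0 -> F = c *: g ^+ v ->
  exists G, [/\ mvsp G, value_set G = subfield_of_order K n, proper_divisor v (n - 1)
              & affine_equiv f (G ^+ v)].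
Proof.
move=> n1 vr eR c_neq0 eF.
have n1_gt0 : (0 < n - 1)%N by rewrite subn_gt0.
have v0 : (0 < v)%N by move: n1_gt0; rewrite -vr; case: (v).
have rho0 : rho != 0.
  by apply: contraTneq r_gt1 => rho0; rewrite /r eR rho0 scale0r size_poly0.
have [a0 a0Z] : exists a, a \notin Z.
  have [y1 [y2 [y3 [[V1 V2 _] [n12 _ _]]]]] := card_gt2P V_gt2.
  have [y Vy ny] : exists2 y, y \in value_set f & y != y0.
    by have [e1|] := eqVneq y1 y0; [exists y2; rewrite // -e1 eq_sym | exists y1].
  by case/imsetP: Vy ny => a _ -> ny; exists a; rewrite inE.
have g_off a : a \notin Z -> g.[a] ^+ (n - 1) = - c0 / (rho * c ^+ r).
  move=> /horner_off_fiber; rewrite eR eF !hornerE exprMn -exprM vr => eqa.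
  have rc : rho * c ^+ r != 0 by rewrite mulf_neq0 ?expf_neq0.
  by apply: (mulfI rc); rewrite [RHS]mulrC divfK // -eqa mulrA.
have g0_neq0 : g.[a0] != 0.
  have := g_off _ a0Z; apply: contra_eqN => /eqP ->; rewrite expr0n gtn_eqF //=.
  by rewrite eq_sym mulf_neq0 ?oppr_eq0 // invr_eq0 mulf_neq0 ?expf_neq0.
pose G := g.[a0]^-1 *: g.
have dG : deg G = deg g by rewrite deg_scale ?invr_eq0.
have dFg : deg F = (v * deg g)%N by rewrite eF deg_scale // deg_expn.
have Gn x : G.[x] ^+ n = G.[x].
  rewrite /G hornerZ; have [xZ|/g_off gx] := boolP (x \in Z).
    have : F.[x] == 0 by move: xZ; rewrite inE /F !hornerE subr_eq0.
    rewrite eF !hornerE mulf_eq0 (negPf c_neq0) expf_eq0 v0 /= => /eqP ->.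
    by rewrite mulr0 expr0n gtn_eqF // ltnW.
  rewrite -{1}(subnK (ltnW n1)) addn1 exprSr exprMn gx -(g_off _ a0Z) -exprMn mulVf //.
  by rewrite expr1n mul1r.
have [mG VG] : mvsp G /\ value_set G = subfield_of_order K n.
  apply: (mvsp_subfield p_pr cardK) => //.
    by rewrite dG; move: F_gt0; rewrite dFg muln_gt0 => /andP[].
  by rewrite dG -vr [(v * r)%N]mulnC -mulnA -dFg.
exists G; split=> //.
  split; first by rewrite -vr dvdn_mulr.
  by move=> eqv; move: vr; rewrite -eqv; move: r_gt1 v0; clear; nia.
apply: (@affine_equiv_scale _ _ (c * g.[a0] ^+ v) y0); first by rewrite mulf_neq0 ?expf_neq0.
rewrite /G exprZn scalerA -mulrA -exprMn mulfV // expr1n mulr1 -eF.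
by rewrite /F subrK.
Qed.

Lemma level_degR k j v A B C S : level p Z F R j k v A B C S ->
  r = (j + p ^ k * deg S)%N.
Proof.
move=> lv; have S0 : S != 0 by apply: contraNneq (lv_S lv) => ->; rewrite horner0.
rewrite /r {1}(lv_R lv) degM ?expf_neq0 ?polyX_eq0 // size_polyXn.
by rewrite deg_expn.
Qed.

Lemma level_R_monomial k j v A B C S : level p Z F R j k v A B C S -> deg S = 0%N ->
  j = r /\ exists s, [/\ s != 0, S = s%:P & R = s ^+ (p ^ k) *: 'X^r].
Proof.
move=> lv dS; have jr : j = r by rewrite (level_degR lv) dS muln0 addn0.
split=> //; have [s eS] := deg0_polyC dS; exists s; split=> //.
  by apply: contraNneq (lv_S lv) => s0; rewrite eS s0 hornerC.
by rewrite {1}(lv_R lv) jr eS -polyC_exp mulrC mul_polyC.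
Qed.

Let p2_gt1 : (1 < p ^ 2)%N.
Proof. by rewrite -(exp1n 2) ltn_exp2r. Qed.

Lemma type_ii_classified j A B C S : level p Z F R j 1 t A B C S -> deg S = 0%N ->
  ((t * j + 1) %/ p ^ 1)%N = 1%N -> classified f.
Proof.
move=> lv dS M1; have [jr [s [s0 eS eR]]] := level_R_monomial lv dS.
have trp : (t * r + 1 = p)%N by rewrite -jr (level_M lv) M1 muln1 expn1.
have tr : (t * r = p - 1)%N by rewrite -trp addnK.
have t0 : (0 < t)%N by case/andP: (nf_t nf).
have [kap kap0 eE] := level_E p_pr cardK c0_neq0 RF (isT : 0 < 1)%N lv isT.
have eF := lv_F lv; rewrite expn1 in eF.
have eL := lv_L lv; rewrite !expn1 in eL.
have F0 : F != 0 by rewrite -size_poly_gt0; move: F_gt0; size_lia.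
have dF4 : (deg F <= digit_bound p t 4)%N.
  have p1 : (0 < p - 1)%N by rewrite subn_gt0.
  rewrite -(leq_pmul2l p1) -(leq_add2r t) (digit_boundE p_pr) -{1}tr -mulnA.
  apply: leq_trans (_ : t * (p ^ 4 - 1) + t <= _)%N.
    by rewrite leq_add2r leq_mul2l -cardK rd_leq orbT.
  by rewrite -mulnSr subn1 prednK // expn_gt0 prime_gt0.
have [|||||c [g [c_neq0 eg]]] :=
  @split_power K p 3 p_pr cardK t r L A B C (kap / s) 3 t0 r_gt1 tr eL.
- by rewrite -eF.
- by rewrite mulf_neq0 ?invr_eq0.
- move: eE; rewrite M1 expr1 -/L jr eS comp_polyC [RHS]mulrC mul_polyC => eE.
  by rewrite mulrC -scalerA eE scalerA mulVf // scale1r.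
- by rewrite -eF.
- move=> i it; have dFE := level_degF p_pr Z_gt0 F_gt0 (isT : 0 < 1)%N lv.
  have dLE := level_degL p_pr cardK Z_gt0 (isT : 0 < 1)%N lv.
  have tp : (t < p)%N by case/andP: (nf_t nf).
  rewrite expn1 in dFE dLE; have pB : (p * deg B <= #|Z|)%N by rewrite dLE leq_maxl.
  have pC : (p * deg C <= #|Z|)%N by rewrite dLE ltnW // leq_maxr.
  rewrite -ltnS -(ltn_pmul2l (prime_gt0 p_pr)).
  apply: leq_ltn_trans (_ : deg F < _)%N; last first.
    by rewrite (leq_ltn_trans dF4) //= mulnS addnC ltn_add2r.
  rewrite dFE; apply: leq_trans (leq_mul (leqnn p) (degM_leq _ _)) _.
  rewrite mulnDr addnC leq_add2r.
  apply: leq_trans (leq_mul (leqnn p) (degM_leq _ _)) _; rewrite !deg_expn mulnDr.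
  rewrite -{2}(subnK it) mulnDl mulnCA [(p * (i * _))%N]mulnCA.
  by rewrite leq_add // leq_mul2l ?pB ?pC orbT.
have [G [mG VG dv aff]] := exp_classified (prime_gt1 p_pr) tr eR c_neq0 (etrans eF eg).
by exists (G ^+ t); split=> //; constructor 2; exists t, G.
Qed.

(** M >= 2 leads to level 3. For M = 1 one has v r = p^2 - 1, and #Z + r deg A <= p^2 + deg C leaves
    A constant unless B and C both are. *)
Lemma level2_classified j v A B C S : (0 < j)%N -> level p Z F R j 2 v A B C S ->
  deg S = 0%N -> classified f.
Proof.
move=> j0 lv dS; have [jr [s [s0 eS eR]]] := level_R_monomial lv dS.
have M0 := level_M_gt0 lv; have eM := level_M lv.
have [M2|M2] := ltnP 1 ((v * j + 1) %/ p ^ 2).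
  have LW := level_M_gt1 p_pr cardK c0_neq0 RF (isT : 0 < 2)%N lv isT M2.
  have [v' [A' [B' [C' [S' lv']]]]] :=
    level_up p_pr cardK Z_gt0 F_gt0 c0_neq0 RF (isT : 0 < 2)%N lv isT j0 LW.
  exact/linear_classified/(level3_card lv').
have {M0}M1 : ((v * j + 1) %/ p ^ 2 = 1)%N by apply/eqP; rewrite eqn_leq M2.
rewrite M1 muln1 jr in eM.
have vr : (v * r = p ^ 2 - 1)%N by rewrite -eM addnK.
have := level_degE p_pr cardK Z_gt0 F_gt0 c0_neq0 RF (isT : 0 < 2)%N isT lv.
rewrite M1 mul1n dS mul0n addn0 jr => dE.
have dL := level_degL p_pr cardK Z_gt0 (isT : 0 < 2)%N lv.
have [bc|bc] := eqVneq (deg B + deg C)%N 0%N.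
  apply: linear_classified; move/eqP: bc; rewrite addn_eq0 => /andP[/eqP b0 /eqP c0'].
  by rewrite dL b0 c0' !muln0.
have a0 : deg A = 0%N.
  have n4 := p2_gt1; rewrite (_ : 4 - 2 = 2)%N // in dE.
  have h1 := leq_mul n4 (leqnn (deg C)); have h2 := leq_mul r_gt1 (leqnn (deg A)).
  move: bc dE h1 h2; rewrite dL -lt0n.
  have [-> |c1] := posnP (deg C).
    rewrite addn0 !muln0 => b1; have := leq_mul (leqnn (p ^ 2)) b1; rewrite muln1.
    by move: (p ^ 2)%N (p ^ 2 * _)%N (r * _)%N; clear => n x y; size_lia.
  move=> _; have : ((p ^ 2 - 1) * (deg C - 1) + p ^ 2 + deg C = p ^ 2 * deg C + 1)%N.
    by move: c1 n4; case: (deg C) (p ^ 2)%N => // n [|m] // _ _; rewrite !subn1 mulSn mulnS; clear; lia.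
  by move: (p ^ 2)%N (_ * (deg C - 1))%N (p ^ 2 * deg C)%N (p ^ 2 * deg B)%N (r * _)%N;
    clear => n x y z u; size_lia.
have [a eA] := deg0_polyC a0.
have eF : F = a ^+ (p ^ 2) *: L ^+ v.
  by rewrite {1}(lv_F lv) eA -polyC_exp mulrC mul_polyC.
have an : a ^+ (p ^ 2) != 0.
  rewrite expf_neq0 //; have := level_A_neq0 p_pr Z_gt0 F_gt0 (isT : 0 < 2)%N lv.
  by rewrite eA polyC_eq0.
have [G [mG VG dv aff]] := exp_classified p2_gt1 vr eR an eF.
by exists (G ^+ v); split=> //; constructor 3; exists v, G.
Qed.

(** At level 2 a nonconstant S adds at least deg F >= #Z to the degree inequality; 2 #Z <= p^2 + deg
    C then allows only constant B and C. *)
Lemma wronskian_classified j A B C S : (0 < j)%N -> level p Z F R j 1 t A B C S ->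
  L %| wronskian B C -> classified f.
Proof.
move=> j0 lv LW; have [v [A2 [B2 [C2 [S2 lv2]]]]] :=
  level_up p_pr cardK Z_gt0 F_gt0 c0_neq0 RF (isT : 0 < 1)%N lv isT j0 LW.
have [s0|s0] := posnP (deg S2); first exact: level2_classified j0 lv2 s0.
have := level_degE p_pr cardK Z_gt0 F_gt0 c0_neq0 RF (isT : 0 < 2)%N isT lv2.
have M0 := leq_mul (level_M_gt0 lv2) (leqnn #|Z|).
have sd := leq_mul s0 (leqnn (deg F)).
have v0 : (0 < v)%N.
  by have := level_v_neq0 p_pr cardK (isT : 0 < 2)%N lv2; case: (v); rewrite ?eqxx.
have vl := leq_mul v0 (leqnn #|Z|).
have dF2 := level_degF p_pr Z_gt0 F_gt0 (isT : 0 < 2)%N lv2.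
have dL2 := level_degL p_pr cardK Z_gt0 (isT : 0 < 2)%N lv2.
rewrite (_ : 4 - 2 = 2)%N // => dE; apply: linear_classified; rewrite dL2.
have h1 := leq_mul p2_gt1 (leqnn (deg C2)).
have [b0|b0] := posnP (deg B2); have [c1|c1] := posnP (deg C2).
- by rewrite b0 c1 !muln0.
- have h2 := leq_mul (leqnn (p ^ 2)) c1.
  exfalso; move: M0 sd vl dF2 dL2 dE h1 h2; rewrite !mul1n muln1 b0 muln0.
  move: (p ^ 2)%N (_ * deg C2)%N (_ * deg A2)%N (j * _)%N (_ * #|Z|)%N (v * _)%N (deg S2 * _)%N.
  by clear; move: #|Z| => l m x y z u w n; size_lia.
- have h2 := leq_mul (leqnn (p ^ 2)) b0.
  exfalso; move: M0 sd vl dF2 dL2 dE h1 h2 p2_gt1; rewrite !mul1n muln1 c1 muln0.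
  move: (p ^ 2)%N (_ * deg B2)%N (_ * deg A2)%N (j * _)%N (_ * #|Z|)%N (v * _)%N (deg S2 * _)%N.
  by clear; move: #|Z| => l m x y z u w n; size_lia.
have h2 := leq_mul (leqnn (p ^ 2)) c1.
exfalso; move: M0 sd vl dF2 dL2 dE h1 h2; rewrite !mul1n muln1.
move: (p ^ 2)%N (_ * deg B2)%N (_ * deg C2)%N (_ * deg A2)%N (j * _)%N (_ * #|Z|)%N (v * _)%N (deg S2 * _)%N.
by clear; move: #|Z| => l m x y z u w n; size_lia.
Qed.

Lemma monomial_classified j A B C S : (0 < j)%N -> level p Z F R j 1 t A B C S ->
  deg S = 0%N -> classified f.
Proof.
move=> j0 lv s0; have M0 := level_M_gt0 lv.
have [M2|M2] := ltnP 1 ((t * j + 1) %/ p ^ 1).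
  exact: wronskian_classified j0 lv (level_M_gt1 p_pr cardK c0_neq0 RF _ lv isT M2).
by apply: type_ii_classified lv s0 _; apply/eqP; rewrite eqn_leq M2.
Qed.

End NormalForm.
End Classify.

(** * First level without an L-divisible Wronskian *)

Section FirstLevel.
Variables (K : finFieldType) (p : nat).
Hypotheses (p_pr : prime p) (cardK : #|K| = (p ^ 4)%N).
Let chp : p \in [pchar K] := card_finPcharP cardK p_pr.
Let p_gt1 : (1 < p)%N := prime_gt1 p_pr.
Variables (Z : {set K}) (F R : {poly K}) (c0 : K) (j : nat).
Hypotheses (Z_gt0 : (0 < #|Z|)%N) (F_gt0 : (0 < deg F)%N) (c0_neq0 : c0 != 0).
Hypothesis RF : (R \Po F) * lin_prod Z
  = - c0 *: (lin_prod Z + ('X^#|K| - 'X) * (lin_prod Z)^`()).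
Variables (t : nat) (A B C S : {poly K}).
Hypothesis lv : level p Z F R j 1 t A B C S.
Hypothesis M1 : (t * j + 1 = p)%N.
Let L := lin_prod Z.

(** For E = L A^j S(F), [S2] and [Y] collect the terms of C E' - C' E without and with a factor L.
    The derivative of S(F) falls among the former because F' L = t F C^p. *)
Let S2 : {poly K} := S + t%:R *: ('X * S^`()).
Let Y : {poly K} := j%:R *: (C * A^`()) - C^`() * A.

Lemma first_level_logderiv : F^`() * L = t%:R *: (F * C ^+ p).
Proof.
have eF := lv_F lv.
rewrite {1}eF (deriv_mul_expp p_pr cardK) // deriv_exp; rewrite expn1 in eF *.
have dL := level_deriv p_pr cardK (isT : 0 < 1)%N lv; rewrite expn1 in dL.
rewrite -/L dL eF scaler_nat -/L; case: (t) => [|n]; first by rewrite !mulr0n !mul0r.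
by rewrite /= exprS; move: (A ^+ p) (L ^+ n) (C ^+ p) => x y z; ring.
Qed.

Lemma first_level_wronskian : (0 < j)%N -> exists2 kap, kap != 0 &
  kap *: wronskian B C = C ^+ p.+1 * A ^+ j * (S2 \Po F) + A ^+ j.-1 * L * Y * (S \Po F).
Proof.
move=> j0; have [kap kap0 eW] := level_wronskian p_pr cardK c0_neq0 RF (isT : 0 < 1)%N lv isT.
exists kap => //; apply: etrans eW _; rewrite expn1 M1 divnn prime_gt0 // expr1 -/L.
have dL := level_deriv p_pr cardK (isT : 0 < 1)%N lv; rewrite expn1 -/L in dL.
have lF := first_level_logderiv.
rewrite !derivM deriv_exp deriv_comp dL /S2 comp_polyD comp_polyZ comp_polyM comp_polyX.
have eA : A ^+ j = A * A ^+ j.-1 by rewrite -exprS prednK.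
rewrite !eA [C ^+ p.+1]exprS /Y scaler_nat.
rewrite (_ : C * _ = C * (C ^+ p * (A * A ^+ j.-1) * (S \Po F)
  + L * (A^`() * A ^+ j.-1 *+ j) * (S \Po F) + A * A ^+ j.-1 * (S^`() \Po F) * (F^`() * L)));
  last by move: (C ^+ p) (A ^+ j.-1) => x y; ring.
rewrite lF scaler_nat scaler_nat; move: (C ^+ p) (A ^+ j.-1) (S \Po F) (S^`() \Po F) => x y z w.
ring.
Qed.

Hypotheses (S_gt0 : (0 < deg S)%N) (j_gt0 : (0 < j)%N).
Hypothesis LW : ~~ (L %| wronskian B C).

(** The Wronskian identity reduces to kap B' = s0 C^p A^j with A' = C' = 0. The top coefficient of
    S2 vanishes, so p divides t deg S + 1 and deg S >= j. With [level_degE] this forces A and C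
    constant and deg B <= p, so that B = D^p + b0 x with deg D <= 1. *)
Lemma additive_level : Y = 0 -> (size S2 <= 1)%N ->
  exists u0 u1 u2 u3 a, [/\ u2 != 0, a != 0,
    L = u0%:P + u1 *: 'X + u2 *: 'X^p + u3 *: 'X^(p ^ 2) & F = a *: L ^+ t].
Proof.
move=> Y0 sS2; have [kap kap0] := first_level_wronskian j_gt0.
have [s0 ->] : exists s0, S2 = s0%:P by exists S2`_0; apply: size1_polyC.
rewrite Y0 mulr0 mul0r addr0 comp_polyC => eW.
have W0 : wronskian B C != 0 by apply: contraNneq LW => ->; rewrite dvdp0.
have C0 := level_C_neq0 p_pr cardK Z_gt0 (isT : 0 < 1)%N lv.
have A0 := level_A_neq0 p_pr Z_gt0 F_gt0 (isT : 0 < 1)%N lv.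
have cBC := level_coprime p_pr cardK (isT : 0 < 1)%N lv.
have C'0 : C^`() = 0.
  have CW : C %| wronskian B C.
    by rewrite -(dvdpZr _ _ kap0) eW exprS -!mulrA dvdp_mulr.
  have : C %| B * C^`() by rewrite -(dvdp_subr _ (dvdp_mull B^`() (dvdpp C))).
  rewrite Gauss_dvdpr 1?coprimep_sym // => CC'; apply/eqP/negPn/negP => C'0.
  by have := deg_deriv_lt C'0; rewrite ltnNge; apply/negP/negPn/dvdp_deg.
have j0 : j%:R != 0 :> K.
  apply/eqP => j0; have := level_vj p_pr cardK (isT : 0 < 1)%N lv.
  by rewrite j0 mulr0 => /eqP; rewrite eq_sym oppr_eq0 oner_eq0.
have A'0 : A^`() = 0.
  move/eqP: Y0; rewrite /Y C'0 mul0r subr0 -mul_polyC !mulf_eq0 polyC_eq0.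
  by rewrite (negPf j0) (negPf C0) => /eqP.
have eB : kap *: B^`() = s0 *: (C ^+ p * A ^+ j).
  apply: (mulp_inj C0); move: eW; rewrite /wronskian C'0 mulr0 subr0 => eW.
  rewrite [in RHS]mulrC -scalerAr [C * _]mulrC eW -mul_polyC exprS.
  by move: (C ^+ p) (A ^+ j) => x y; ring.
have B'0 : B^`() != 0.
  by apply: contraNneq W0 => B'0; rewrite /wronskian B'0 C'0 mul0r mulr0 subr0.
have s00 : s0 != 0.
  apply: contraNneq B'0 => s00; move: eB; rewrite s00 scale0r => /eqP.
  by rewrite scaler_eq0 (negPf kap0).
have dB' : deg B^`() = (p * deg C + j * deg A)%N.
  have := congr1 (fun g : {poly K} => deg g) eB; rewrite /= !deg_scale // => ->.
  by rewrite degM ?expf_neq0 // !deg_expn.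
have dB := deg_deriv_lt B'0.
have sj : (j <= deg S)%N.
  have S0 : S != 0 by apply: contraNneq (lv_S lv) => ->; rewrite horner0.
  have : (p %| t * deg S + 1)%N.
    rewrite (dvdn_pcharf chp); have : S2`_(deg S) = 0.
      by apply: nth_default; apply: leq_trans sS2 _.
    rewrite /S2 coefD coefZ coefXM gtn_eqF // coef_deriv prednK // -[_ *+ deg S]mulr_natl -lead_coefE.
    rewrite mulrA -{1}[lead_coef S]mul1r -mulrDl => /eqP.
    by rewrite mulf_eq0 lead_coef_eq0 (negPf S0) orbF natrD natrM addrC.
  rewrite addn1 => /(dvdn_leq (ltn0Sn _)) ptj.
  move: ptj; rewrite -[in X in (X <= _)%N]M1 addn1 ltnS leq_pmul2l // lt0n.
  by apply: contraTneq p_gt1 => t0; rewrite -M1 t0.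
have dE := level_degE p_pr cardK Z_gt0 F_gt0 c0_neq0 RF (isT : 0 < 1)%N isT lv.
have dF := level_degF p_pr Z_gt0 F_gt0 (isT : 0 < 1)%N lv.
have dL := level_degL p_pr cardK Z_gt0 (isT : 0 < 1)%N lv.
have dA : (p * #|Z| + p.+1 * (j * deg A) <= p ^ 3 + deg C)%N.
  rewrite expn1 M1 divnn prime_gt0 // mul1n (_ : 4 - 1 = 3)%N // in dE.
  apply: leq_trans dE; have := leq_mul sj (leqnn (deg F)).
  have -> : (p * #|Z| + p.+1 * (j * deg A) = #|Z| + j * deg A + j * deg F)%N.
    by rewrite dF expn1 -{1}M1 mulSn; ring.
  by rewrite leq_add2l.
have pB : (p * deg B <= #|Z|)%N by rewrite dL expn1 leq_maxl.
have pb1 : (p ^ 2 * (p * deg C + j * deg A + 1) <= p * #|Z|)%N.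
  rewrite -dB' addn1; apply: leq_trans (leq_mul (leqnn p) pB).
  by rewrite -mulnn -mulnA !leq_mul2l dB !orbT.
have p2_gt1 : (1 < p ^ 2)%N by have := @ltn_exp2r 1 p 2 isT; rewrite exp1n p_gt1.
have p3_gt2 : (2 < p ^ 3)%N.
  by have := @leq_exp2r 2 p 3 isT; rewrite p_gt1; apply: leq_trans.
have c0' : deg C = 0%N.
  apply/eqP; rewrite -leqn0 leqNgt; apply/negP => c1.
  have := leq_trans (leq_add pb1 (leqnn _)) dA.
  rewrite !mulnDr muln1 mulnA -expnSr.
  move: c1; case: (deg C) => // n _; have := leq_mul p3_gt2 (leqnn n); rewrite mulnS.
  move: p2_gt1; move: (p ^ 3)%N (p ^ 2)%N (p ^ 3 * n)%N (_ * (j * _))%N (_ * (j * _))%N.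
  by clear => *; lia.
have {}dA : (p * #|Z| + p.+1 * (j * deg A) <= p ^ 3)%N by rewrite c0' addn0 in dA.
have a0 : deg A = 0%N.
  have [A1 eA] := deriv_eq0_expp p_pr cardK A'0.
  apply/eqP; rewrite eA deg_expn muln_eq0 (gtn_eqF (prime_gt0 p_pr)) /= -leqn0 leqNgt.
  apply/negP => a1; have pja : (p <= j * deg A)%N.
    rewrite eA deg_expn; apply: leq_trans (leq_pmull _ j_gt0); exact: leq_pmulr.
  have := leq_trans (leq_add pb1 (leqnn _)) dA; have := leq_mul (leqnn (p ^ 2)) pja.
  rewrite -expnSr !mulnDr muln1; move: p2_gt1.
  move: (p ^ 2)%N (p ^ 3)%N (p.+1 * (j * _))%N (p ^ 2 * (j * _))%N (p ^ 2 * (p * _))%N.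
  by clear => *; lia.
have l2 : (#|Z| <= p ^ 2)%N.
  rewrite -(leq_pmul2l (prime_gt0 p_pr)) -expnS; apply: leq_trans dA; exact: leq_addr.
have b1 : (deg B <= p)%N.
  by rewrite -(leq_pmul2l (prime_gt0 p_pr)) mulnn; apply: leq_trans pB l2.
have [a eA] := deg0_polyC a0; have [c eC] := deg0_polyC c0'.
have [b0 eB'] : exists b, B^`() = b%:P by apply: deg0_polyC; rewrite dB' c0' a0 !muln0.
have [D eD'] : exists D, B - b0 *: 'X = D ^+ p.
  by apply: (deriv_eq0_expp p_pr cardK); rewrite derivB derivZ derivX eB' alg_polyC subrr.
have dD : (deg D <= 1)%N.
  rewrite -(leq_pmul2l (prime_gt0 p_pr)) muln1 -deg_expn -eD'.
  have := degD_leq B (- (b0 *: 'X)); have := deg_scale_leq b0 'X; rewrite deg_opp size_polyX.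
  by move: b1 p_gt1; clear=> *; size_lia.
have eD : D = (D`_0)%:P + D`_1 *: 'X.
  apply/polyP => i; rewrite coefD coefC coefZ coefX.
  case: i => [|[|i]]; rewrite ?mulr0 ?mulr1 ?addr0 ?add0r //.
  by apply: nth_default; move: dD; clear => *; size_lia.
have b00 : b0 != 0 by apply: contraNneq B'0 => b00; rewrite eB' b00.
have c00 : c ^+ p != 0 by rewrite expf_neq0 // -polyC_eq0 -eC.
exists (D`_0 ^+ (p ^ 2)), (c ^+ p), (b0 ^+ p), (D`_1 ^+ (p ^ 2)), (a ^+ p).
have a00 : a ^+ p != 0 by rewrite expf_neq0 // -polyC_eq0 -eA.
rewrite expf_neq0 //; split=> //; last first.
  by rewrite {1}(lv_F lv) expn1 eA -polyC_exp mulrC mul_polyC.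
have eBp : B ^+ p = (D`_0 ^+ (p ^ 2))%:P + D`_1 ^+ (p ^ 2) *: 'X^(p ^ 2) + b0 ^+ p *: 'X^p.
  have := expDp p_pr cardK 1 (B - b0 *: 'X) (b0 *: 'X); rewrite subrK expn1 => ->.
  by rewrite eD' -exprM mulnn {1}eD (expDp p_pr cardK) !exprZn -polyC_exp.
rewrite {1}/L (lv_L lv) !expn1 eBp eC -polyC_exp -!mul_polyC.
by move: 'X^(p ^ 2) 'X^p (_%:P) (_%:P) => x y z w; ring.
Qed.


Lemma coef_small_eq0 (N : {poly {poly K}}) i : (forall i, (size (N`_i)%R < size F)%N) ->
  N.[F] = 0 -> N`_i = 0.
Proof. by move=> sN NF; rewrite (horner_small_eq0 sN NF) coef0. Qed.

(** Since deg F >= 2 #Z + j deg A, the Wronskian identity is a base-F expansion and can be read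
    coefficientwise. A nonzero coefficient of S2 at index deg S would make L divide C^(p+1) A^j and
    hence the Wronskian. *)
Lemma first_level_t_gt1 : (1 < t)%N -> Y = 0 /\ (size S2 <= 1)%N.
Proof.
move=> t1; have [kap kap0 eW] := first_level_wronskian j_gt0.
have C0 := level_C_neq0 p_pr cardK Z_gt0 (isT : 0 < 1)%N lv.
have A0 := level_A_neq0 p_pr Z_gt0 F_gt0 (isT : 0 < 1)%N lv.
have L0 : L != 0 := lin_prod_neq0 Z.
have dF := level_degF p_pr Z_gt0 F_gt0 (isT : 0 < 1)%N lv.
have dL := level_degL p_pr cardK Z_gt0 (isT : 0 < 1)%N lv.
set P := C ^+ p.+1 * A ^+ j in eW; set Q := A ^+ j.-1 * L * Y in eW.
have P0 : P != 0 by rewrite mulf_neq0 ?expf_neq0.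
pose N : {poly {poly K}} := S2^:P * P%:P + S^:P * Q%:P - (kap *: wronskian B C)%:P.
have Ni i : N`_i = S2`_i *: P + S`_i *: Q - (if i == 0%N then kap *: wronskian B C else 0).
  by rewrite coefB coefD !coefMC coefC !coef_map /= !mul_polyC.
have N0 i : N`_i = 0.
  apply: coef_small_eq0 => [{}i|].
    have jp : (j <= p)%N by move: t1 M1; case: (t) => // n _; rewrite mulSn; clear; lia.
    have dF2 : (2 * #|Z| + j * deg A <= deg F)%N by rewrite dF leq_add // leq_mul2r ?expn1 ?t1 ?jp orbT.
    have pB : (p * deg B <= #|Z|)%N by rewrite dL expn1 leq_maxl.
    have pC : (p * deg C < #|Z|)%N by rewrite dL expn1 leq_maxr.
    have hB := leq_mul p_gt1 (leqnn (deg B)); have hC := leq_mul p_gt1 (leqnn (deg C)).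
    have dP : (deg P < deg F)%N.
      apply: leq_ltn_trans (degM_leq _ _) _; rewrite !deg_expn mulSn.
      by move: dF2 pC hC; move: (j * _)%N (p * _)%N; clear => *; size_lia.
    have dQ : (deg Q < deg F)%N.
      have dY : (deg Y <= deg C + deg A)%N.
        rewrite /Y; have := degD_leq (j%:R *: (C * A^`())) (- (C^`() * A)); rewrite deg_opp.
        have := deg_scale_leq j%:R (C * A^`()); have := degM_leq C A^`(); have := degM_leq C^`() A.
        by have := deg_deriv_leq A; have := deg_deriv_leq C; clear => *; size_lia.
      apply: leq_ltn_trans (degM_leq _ _) _.
      have := degM_leq (A ^+ j.-1) L; rewrite deg_expn deg_lin_prod.
      move: dF2 pC hC dY; rewrite -{1}(prednK j_gt0) [(_.-1.+1 * _)%N]mulSn; move: (j.-1 * _)%N (p * _)%N.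
      by clear => *; size_lia.
    have dW : (deg (kap *: wronskian B C) < deg F)%N.
      rewrite deg_scale // /wronskian.
      have := degD_leq (B^`() * C) (- (B * C^`())); rewrite deg_opp.
      have := degM_leq B^`() C; have := degM_leq B C^`().
      have := deg_deriv_leq B; have := deg_deriv_leq C.
      move: dF2 pB pC hB hC; move: (p * deg B)%N (p * deg C)%N (j * _)%N.
      by clear => *; size_lia.
    rewrite Ni; have := degD_leq (S2`_i *: P + S`_i *: Q) (- (if i == 0%N then kap *: wronskian B C else 0)).
    have := degD_leq (S2`_i *: P) (S`_i *: Q); have := deg_scale_leq S2`_i P.
    have := deg_scale_leq S`_i Q; move: dP dQ dW F_gt0; rewrite deg_opp.
    by case: ifP => _; rewrite ?size_poly0; clear => *; size_lia.
  rewrite hornerD hornerN hornerD !hornerM !hornerC eW /comp_poly.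
  by rewrite [P * _]mulrC [Q * _]mulrC subrr.
have S0 : lead_coef S != 0.
  by rewrite lead_coef_eq0; apply: contraNneq (lv_S lv) => ->; rewrite horner0.
have Q0 : Q = 0.
  have := N0 (deg S); rewrite Ni gtn_eqF // subr0 -lead_coefE => eQ.
  have LQ : L %| Q by rewrite /Q mulrAC dvdp_mull.
  have [S20|S20] := eqVneq (S2`_(deg S)) 0.
    by move/eqP: eQ; rewrite S20 scale0r add0r scaler_eq0 (negPf S0) => /eqP.
  case/negP: LW; rewrite -(dvdpZr _ _ kap0) eW; apply: dvdp_add; last exact: dvdp_mulr.
  apply: dvdp_mulr; rewrite -(dvdpZr _ _ S20); move/eqP: eQ; rewrite addr_eq0 => /eqP ->.
  by rewrite -scaleNr dvdpZr // oppr_eq0.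
split.
  by move/eqP: Q0; rewrite /Q !mulf_eq0 expf_eq0 (negPf A0) (negPf L0) andbF => /eqP.
apply/leq_sizeP => i i0; have := N0 i; rewrite Ni Q0 scaler0 addr0 gtn_eqF // subr0.
by move/eqP; rewrite scaler_eq0 (negPf P0) orbF => /eqP.
Qed.

(** C^(p+1) A^j may now be too large for a base-F digit. With D = A C, u the image of deg Q and T =
    u Q - x Q', the large term is moved into J = F D' - u D^(p+1), and the relation T(F) D' + Q'(F)
    J = u kap W itself bounds deg J by deg F. *)
Lemma first_level_t1 : t = 1%N -> (Y = 0 /\ (size S2 <= 1)%N) \/
  exists lam D u, [/\ u != 0, F^`() = D ^+ p & (F + lam%:P) * D^`() = u *: D ^+ p.+1].
Proof.
move=> t1.
have C0 := level_C_neq0 p_pr cardK Z_gt0 (isT : 0 < 1)%N lv.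
have A0 := level_A_neq0 p_pr Z_gt0 F_gt0 (isT : 0 < 1)%N lv.
have eF : F = L * A ^+ p by rewrite {1}(lv_F lv) t1 expr1 expn1.
have eL : L = B ^+ p + 'X * C ^+ p by rewrite {1}/L (lv_L lv) expn1.
pose G := A * B; pose D := A * C; pose Q := 'X * S.
have D0 : D != 0 by rewrite mulf_neq0.
have eFD : F = G ^+ p + 'X * D ^+ p.
  by rewrite eF eL /G /D !exprMn; move: (A ^+ p) (B ^+ p) (C ^+ p) => x y z; ring.
have F'D : F^`() = D ^+ p.
  have := deriv_expp p_pr cardK G (isT : 0 < 1)%N; have := deriv_mul_expp p_pr cardK 'X D (isT : 0 < 1)%N.
  by rewrite !expn1 eFD derivD derivX mul1r => -> ->; rewrite add0r.
have dF : deg F = maxn (p * deg G) (p * deg D).+1 by rewrite eFD deg_split.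
have hG := leq_mul p_gt1 (leqnn (deg G)); have hD := leq_mul p_gt1 (leqnn (deg D)).
have pG : (p * deg G <= deg F)%N by rewrite dF leq_maxl.
have pD : (p * deg D < deg F)%N by rewrite dF leq_maxr.
have Q'S2 : Q^`() = S2.
  by rewrite /Q derivM derivX mul1r /S2 t1 scale1r.
have [kap kap0 eE] : exists2 kap, kap != 0 & kap *: (G + 'X^(p ^ 3) * D) = Q \Po F.
  have [kap kap0 eE] := level_E p_pr cardK c0_neq0 RF (isT : 0 < 1)%N lv isT.
  exists kap => //; rewrite comp_polyM comp_polyX [X in _ = X * _]eF.
  rewrite (_ : G + _ = A * (B + 'X^(p ^ (4 - 1)) * C)); last by rewrite /G /D (_ : 4 - 1 = 3)%N //; ring.
  rewrite scalerAr eE expn1 M1 divnn prime_gt0 // expr1 -/L.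
  rewrite -[in RHS]M1 t1 mul1n addn1 exprS; move: (A ^+ j) => x; ring.
have eE' : kap *: (G^`() + 'X^(p ^ 3) * D^`()) = (S2 \Po F) * D ^+ p.
  rewrite -Q'S2 -F'D -deriv_comp -eE derivZ derivD [('X^_ * _)^`()]derivM derivXn.
  by rewrite (pmul_eq0 p_pr cardK) ?dvdn_exp // mul0r add0r.
have eW : (Q \Po F) * D^`() - (S2 \Po F) * D ^+ p.+1 = kap *: (G * D^`() - G^`() * D).
  rewrite exprSr mulrA -eE' -eE -!mul_polyC; move: 'X^(p ^ 3) => x; ring.
have [D'0|D'0] := eqVneq D^`() 0.
  left; split.
    have j1 : j%:R = -1 :> K by have := level_vj p_pr cardK (isT : 0 < 1)%N lv; rewrite t1 mul1r.
    have -> : Y = - D^`() by rewrite /Y j1 scaleN1r /D derivM; ring.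
    by rewrite D'0 oppr0.
  have [-> |S20] := eqVneq S2 0; first by rewrite size_poly0.
  have := congr1 (fun g : {poly K} => deg g) eE'; rewrite /= D'0 mulr0 addr0 deg_scale //.
  have FC0 : S2 \Po F != 0 by rewrite comp_poly_eq0 //; move: F_gt0; clear => *; size_lia.
  rewrite degM ?expf_neq0 // deg_comp => dG; rewrite leqNgt; apply/negP => sS2.
  have s1 : (0 < deg S2)%N by move: sS2; clear => *; size_lia.
  have := leq_mul s1 (leqnn (deg F)); have := deg_deriv_leq G; rewrite mul1n dG.
  move: F_gt0 pG hG; move: (_ * deg F)%N (deg (D ^+ p)) (p * _)%N; clear => *; size_lia.
right; set s := deg S; pose q := lead_coef S; pose u : K := s.+1%:R.
have S0 : S != 0 by apply: contraNneq (lv_S lv) => ->; rewrite horner0.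
have q0 : q != 0 by rewrite lead_coef_eq0.
have Qs : Q`_s.+1 = q by rewrite /Q coefXM.
have sQ : (size Q <= s.+2)%N.
  by rewrite /Q mulrC size_mulX // /s; move: S0; rewrite -size_poly_gt0; clear => *; size_lia.
clearbody G D Q.
have Q'i i : (Q^`())`_i = i.+1%:R * Q`_i.+1 by rewrite coef_deriv mulr_natl.
have sQ' : (size Q^`() <= s.+1)%N.
  by apply/leq_sizeP => i i0; rewrite Q'i (leq_sizeP _ _ sQ) ?mulr0.
pose T := u *: Q - 'X * Q^`().
have Ti i : T`_i = (u - i%:R) * Q`_i.
  rewrite coefB coefZ mulrBl; congr (_ - _).
  by case: i => [|i]; rewrite [LHS]coefXM /= ?mul0r ?Q'i.
have sT : (size T <= s.+1)%N.
  apply/leq_sizeP => i; rewrite leq_eqVlt => /orP[/eqP <-|i0]; first by rewrite Ti subrr mul0r.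
  by rewrite Ti (leq_sizeP _ _ sQ) ?mulr0.
pose J := F * D^`() - u *: D ^+ p.+1; pose W := G * D^`() - G^`() * D.
have eJ : (T \Po F) * D^`() + (Q^`() \Po F) * J = (u * kap) *: W.
  rewrite -scalerA -eW Q'S2 comp_polyB comp_polyZ comp_polyM comp_polyX -Q'S2 /J -!mul_polyC.
  by move: (D ^+ p.+1) (D^`()) (Q \Po F) (Q^`() \Po F) => x y z w; ring.
have dW : (deg W < deg F)%N.
  have := degD_leq (G * D^`()) (- (G^`() * D)); rewrite deg_opp.
  have := degM_leq G D^`(); have := degM_leq G^`() D; have := deg_deriv_leq D; have := deg_deriv_leq G.
  by move: hG hD pG pD; move: (p * _)%N (p * _)%N; clear => *; size_lia.
have dD' : (deg D^`() < deg F)%N.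
  by have := deg_deriv_leq D; move: hD pD; move: (p * _)%N; clear => *; size_lia.
have F_neq0 : F != 0 by rewrite -size_poly_gt0; move: F_gt0; clear => *; size_lia.
have compF0 g : g != 0 -> g \Po F != 0.
  by move=> g0; rewrite comp_poly_eq0 //; move: F_gt0; clear => *; size_lia.
(* If p divided deg Q, then deg Q' would drop further and nothing could balance the degree of Q(F)
   D'. *)
have u0 : u != 0.
  apply/eqP => u0; have dQ : (deg Q = s.+1)%N.
    have : (s.+1 < size Q)%N by rewrite ltnNge; apply: contra q0 => /leq_sizeP/(_ _ (leqnn _)); rewrite Qs => ->.
    by move: sQ; clear => *; size_lia.
  have dQ' : (deg Q^`() <= s.-1)%N.
    have : (size Q^`() <= s)%N.
      apply/leq_sizeP => i; rewrite leq_eqVlt => /orP[/eqP <-|i0]; first by rewrite Q'i -/u u0 mul0r.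
      by apply: (leq_sizeP _ _ sQ').
    by clear => *; size_lia.
  have := congr1 (fun g : {poly K} => deg g) eW; rewrite -Q'S2 /= [in RHS]deg_scale // => eq.
  have Q_neq0 : Q != 0 by rewrite -size_poly_gt0; move: dQ; clear => *; size_lia.
  have := degD_leq (kap *: W) ((Q^`() \Po F) * D ^+ p.+1); rewrite -eW -Q'S2 subrK.
  rewrite degM ?compF0 // deg_comp dQ Q'S2 eW deg_scale // -Q'S2.
  have := degM_leq (Q^`() \Po F) (D ^+ p.+1); rewrite deg_comp deg_expn !mulSn.
  have := leq_mul dQ' (leqnn (deg F)); rewrite -{2}(prednK (S_gt0 : (0 < s)%N)) mulSn -/W.
  move: dW F_gt0 hD pD; move: (_ * deg F)%N (_ * deg F)%N (p * _)%N => x y z.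
  by clear; size_lia.
have dJ : (deg J < deg F)%N.
  have [-> |J0] := eqVneq J 0; first by rewrite size_poly0.
  have dQ' : deg Q^`() = s.
    have : (s < size Q^`())%N.
      rewrite ltnNge; apply: contra q0 => /leq_sizeP/(_ _ (leqnn _)); rewrite Q'i Qs -/u => /eqP.
      by rewrite mulf_eq0 (negPf u0).
    by move: sQ'; clear => *; size_lia.
  have Q'0 : Q^`() != 0 by rewrite -size_poly_gt0; move: dQ' S_gt0; rewrite /s; clear => *; size_lia.
  have := degD_leq ((u * kap) *: W) (- ((T \Po F) * D^`())).
  have <- : (Q^`() \Po F) * J = (u * kap) *: W - (T \Po F) * D^`().
    by rewrite -eJ [RHS]addrC addKr.
  rewrite deg_opp degM ?compF0 // deg_comp dQ' deg_scale ?mulf_neq0 //.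
  have := degM_leq (T \Po F) D^`(); rewrite deg_comp.
  have : (deg T <= s)%N by move: sT; clear => *; size_lia.
  move=> sT'; have := leq_mul sT' (leqnn (deg F)); have := leq_mul S_gt0 (leqnn (deg F)).
  rewrite mul1n -/s; move: dW dD'; move: (_ * deg F)%N (_ * deg F)%N => x y.
  by clear; size_lia.
pose N : {poly {poly K}} := T^:P * D^`()%:P + Q^`()^:P * J%:P - ((u * kap) *: W)%:P.
have Ni i : N`_i = T`_i *: D^`() + Q^`()`_i *: J - (if i == 0%N then (u * kap) *: W else 0).
  by rewrite coefB coefD !coefMC coefC !coef_map /= !mul_polyC.
have N0 : N`_s = 0.
  apply: coef_small_eq0 => [i|].
    rewrite Ni; have := degD_leq (T`_i *: D^`() + Q^`()`_i *: J) (- (if i == 0%N then (u * kap) *: W else 0)).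
    have := degD_leq (T`_i *: D^`()) (Q^`()`_i *: J); have := deg_scale_leq T`_i D^`().
    have := deg_scale_leq Q^`()`_i J; have := deg_scale_leq (u * kap) W.
    move: dJ dD' dW F_gt0; rewrite deg_opp.
    by case: ifP => _; rewrite ?size_poly0; clear => *; size_lia.
  by rewrite hornerD hornerN hornerD !hornerM !hornerC -eJ /comp_poly subrr.
(* Read at index s, where T has coefficient (u - s) Q_s = Q_s and Q' has u q. *)
exists (Q`_s / (u * q)), D, u; split=> //.
move: N0; rewrite Ni gtn_eqF // subr0 Ti Q'i Qs -/u.
have -> : u - s%:R = 1 by rewrite /u -addn1 natrD addrC addKr.
rewrite mul1r /J => eN; have uq : u * q != 0 by rewrite mulf_neq0.
rewrite mulrDl; apply/eqP; rewrite -subr_eq0 addrAC addrC -/J.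
rewrite -(inj_eq (scalerI uq)) scaler0 scalerDr mul_polyC scalerA mulrCA divff // mulr1.
by rewrite eN.
Qed.

End FirstLevel.

(** * Split linearized polynomials *)

Section AdditivePolynomials.
Variables (K : finFieldType) (p : nat).
Hypotheses (p_pr : prime p) (cardK : #|K| = (p ^ 4)%N).
Let p_gt1 : (1 < p)%N := prime_gt1 p_pr.
Let p2_gt_p : (p < p ^ 2)%N.
Proof. by rewrite -{1}(expn1 p) ltn_exp2l. Qed.

Lemma annihilatorD beta x y : annihilator p beta (x + y : K) = annihilator p beta x + annihilator p beta y.
Proof.
rewrite /annihilator (expDpp p_pr cardK) !expr_p2 !(expDpp p_pr cardK).
by move: (_ ^+ (p - 1)) (x ^+ p) (y ^+ p) => c z w; ring.
Qed.

Lemma annihilatorZ beta i y : i \in subfield_of_order K p ->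
  annihilator p beta (i * y) = i * annihilator p beta y.
Proof.
rewrite inE => /eqP ip; rewrite /annihilator !expr_p2 !exprMn !ip.
by move: (_ ^+ (p - 1)) (y ^+ p) => c z; ring.
Qed.

Lemma annihilator1 beta : annihilator p beta (1 : K) = 0.
Proof. by rewrite /annihilator !expr1n; ring. Qed.

Lemma annihilator_id (beta : K) : beta ^+ p != beta -> annihilator p beta beta = 0.
Proof.
rewrite -subr_eq0 => g0; rewrite /annihilator.
have -> : beta ^+ (p ^ 2) = (beta ^+ p - beta) ^+ (p - 1) * (beta ^+ p - beta) + beta ^+ p.
  rewrite -exprSr subn1 (prednK (prime_gt0 p_pr)) (expDpp p_pr cardK) (expNpp p_pr cardK).
  by rewrite expr_p2 subrK.
by move: (_ ^+ (p - 1)) => c; ring.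
Qed.

Lemma linearized_eq0 (w0 w1 w2 w3 : K) :
  (forall x, w0 * x + w1 * x ^+ p + w2 * x ^+ (p ^ 2) + w3 * x ^+ (p ^ 3) = 0) ->
  w0 = 0 /\ w3 = 0.
Proof.
move=> w; pose P := w0 *: 'X + w1 *: 'X^p + w2 *: 'X^(p ^ 2) + w3 *: 'X^(p ^ 3) : {poly K}.
have p3_gt : (p ^ 2 < p ^ 3)%N by rewrite ltn_exp2l.
have p4_gt : (p ^ 3 < p ^ 4)%N by rewrite ltn_exp2l.
have P0 : P = 0.
  apply/eqP/negPn/negP => P0.
  have : (#|[set: K]| <= deg P)%N.
    apply: card_roots_leq P0 _ => x _.
    by rewrite -[RHS](w x) /P !(hornerD, hornerZ, hornerXn, hornerX).
  rewrite cardsT cardK leqNgt => /negP; apply; apply: leq_ltn_trans p4_gt.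
  have := deg_scale_leq w0 'X; have := deg_scale_leq w1 'X^p; have := deg_scale_leq w2 'X^(p ^ 2).
  have := deg_scale_leq w3 'X^(p ^ 3); rewrite !size_polyXn size_polyX /=.
  have := degD_leq (w0 *: 'X) (w1 *: 'X^p).
  have := degD_leq (w0 *: 'X + w1 *: 'X^p) (w2 *: 'X^(p ^ 2)).
  have := degD_leq (w0 *: 'X + w1 *: 'X^p + w2 *: 'X^(p ^ 2)) (w3 *: 'X^(p ^ 3)).
  rewrite -/P; move: p_gt1 p2_gt_p p3_gt; move: (p ^ 3)%N (p ^ 2)%N.
  by clear => *; size_lia.
have cP i : w0 * (i == 1)%N%:R + w1 * (i == p)%:R + w2 * (i == p ^ 2)%N%:R
    + w3 * (i == p ^ 3)%N%:R = 0.
  by have := congr1 (fun g : {poly K} => g`_i) P0; rewrite /P coef0 !(coefD, coefZ, coefX, coefXn).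
have := cP 1%N; have := cP (p ^ 3)%N; rewrite !eqxx.
have n1 : (p ^ 3 == 1)%N = false by apply/gtn_eqF; apply: ltn_trans p3_gt; exact: ltn_trans p2_gt_p.
have n2 : (1 == p)%N = false by apply/ltn_eqF.
have n3 : (1 == p ^ 2)%N = false by apply/ltn_eqF; apply: ltn_trans p2_gt_p.
rewrite n1 [(1 == p ^ 3)%N]eq_sym n1 n2 n3 (gtn_eqF p3_gt) (gtn_eqF (ltn_trans p2_gt_p p3_gt)).
by rewrite !mulr0 !mulr1 !add0r !addr0.
Qed.

Variables (Z : {set K}) (u0 u1 u2 u3 : K).
Hypotheses (Z_gt0 : (0 < #|Z|)%N) (u2_neq0 : u2 != 0).
Hypothesis eL : lin_prod Z = u0%:P + u1 *: 'X + u2 *: 'X^p + u3 *: 'X^(p ^ 2).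

Let h (x : K) := u1 * x + u2 * x ^+ p + u3 * x ^+ (p ^ 2).

Let hD x y : h (x + y) = h x + h y.
Proof.
rewrite /h !expr_p2 !(expDpp p_pr cardK); move: (x ^+ p) (y ^+ p) => z w; ring.
Qed.

Let hZ i x : i \in subfield_of_order K p -> h (i * x) = i * h x.
Proof.
rewrite inE => /eqP ip; rewrite /h !expr_p2 !exprMn !ip; move: (x ^+ p) => z; ring.
Qed.

Let Lh x : (lin_prod Z).[x] = u0 + h x.
Proof. by rewrite eL !(hornerD, hornerZ, hornerXn, hornerX, hornerC) /h !addrA. Qed.

Let deg_u3 : u3 != 0 -> #|Z| = (p ^ 2)%N.
Proof.
move=> u30; rewrite -deg_lin_prod eL addrC size_polyDl size_scale // size_polyXn //.
have := deg_scale_leq u1 'X; have := deg_scale_leq u2 'X^p; rewrite size_polyX size_polyXn /=.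
have := degD_leq (u0%:P + u1 *: 'X) (u2 *: 'X^p); have := degD_leq u0%:P (u1 *: 'X).
have := size_polyC_leq1 u0; move: p2_gt_p p_gt1; move: (p ^ 2)%N.
by clear => *; size_lia.
Qed.

(** The difference d of two roots is a zero of the additive part, whence u1 = - u2 d^(p-1); the
    substitution x / d normalises it. *)
Lemma linearized_lin_prod_v : u3 = 0 -> exists a1 b1 a2, [/\ a1 != 0, a2 != 0 &
  lin_prod Z = a2 *: (('X^p - 'X) \Po (a1 *: 'X + b1%:P))].
Proof.
move=> u30; have dZ : #|Z| = p.
  rewrite -deg_lin_prod eL u30 scale0r addr0 addrC size_polyDl size_scale // size_polyXn //.
  have := deg_scale_leq u1 'X; rewrite size_polyX /=.
  have := degD_leq u0%:P (u1 *: 'X); have := size_polyC_leq1 u0; move: p_gt1.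
  by clear => *; size_lia.
have /card_gt1P[a [a' [aZ a'Z naa]]] : (1 < #|Z|)%N by rewrite dZ.
have rt x : x \in Z -> u0 = - h x.
  move=> xZ; have : (lin_prod Z).[x] == 0 by rewrite -[_ == 0]/(root _ x) root_lin_prod.
  by rewrite Lh addr_eq0 => /eqP.
pose d := a' - a; have d0 : d != 0 by rewrite subr_eq0 eq_sym.
have eu1 : u1 = - (u2 * d ^+ (p - 1)).
  have : h d = 0.
    by apply: (addrI (h a)); rewrite -hD /d addrC subrK addr0; apply: oppr_inj; rewrite -!rt.
  rewrite /h u30 mul0r addr0 => /eqP; rewrite addr_eq0 => /eqP hd; apply: (mulIf d0).
  by rewrite hd mulNr -mulrA -exprSr subn1 prednK // prime_gt0.
exists d^-1, (- a / d), (u2 * d ^+ p); rewrite invr_eq0 mulf_neq0 ?expf_neq0 //; split=> //.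
rewrite eL (rt a aZ) /h u30 mul0r addr0 scale0r addr0 comp_polyB comp_Xn_poly comp_polyX.
have := expDp p_pr cardK 1 (d^-1 *: 'X) (- a / d)%:P; rewrite expn1 => ->.
rewrite exprZn -polyC_exp expr_div_n (expNpp p_pr cardK) exprVn eu1.
have -> : u2 * d ^+ p = u2 * d ^+ (p - 1) * d by rewrite -mulrA -exprSr subn1 prednK // prime_gt0.
have -> : d ^+ p = d ^+ (p - 1) * d by rewrite -exprSr subn1 prednK // prime_gt0.
have : d ^+ (p - 1) != 0 by rewrite expf_neq0.
move: (d ^+ (p - 1)) (a ^+ p) 'X^p => e ap x e0.
apply/polyP => i; rewrite !(coefD, coefN, coefZ, coefC, coefX).
by move: (x`_i) (i == 1)%N => y b; case: (i == 0)%N; field; rewrite d0 e0.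
Qed.

Let V := [set h x | x : K].

Let rootZ x : x \in Z -> u0 = - h x.
Proof.
move=> xZ; have : (lin_prod Z).[x] == 0 by rewrite -[_ == 0]/(root _ x) root_lin_prod.
by rewrite Lh addr_eq0 => /eqP.
Qed.

(** Each fibre of [h] contains a translate of Z, hence p^2 points, while q <= #V p^2 by degree. *)
Let card_V : u3 != 0 -> #|V| = (p ^ 2)%N.
Proof.
move=> /deg_u3 dZ; apply/eqP; rewrite eqn_leq.
have p2_gt0 : (0 < p ^ 2)%N by rewrite expn_gt0 prime_gt0.
have [a aZ] : exists a, a \in Z by apply/set0Pn; rewrite -card_gt0.
have eV : value_set (lin_prod Z) = V.
  apply/setP => y; apply/imsetP/imsetP => [[x _ ->]|[x _ ->]].
    by exists (x - a) => //; apply/esym/(addIr (h a)); rewrite -(hD (x - a) a) subrK Lh (rootZ aZ) addrAC addNr add0r.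
  by exists (x + a) => //; rewrite Lh (hD x a) (rootZ aZ) addrC addrK.
apply/andP; split; last first.
  have := @card_leq_value_set K (lin_prod Z); rewrite eV deg_lin_prod => /(_ Z_gt0).
  by rewrite dZ cardK -[4%N]/(2 + 2)%N expnD leq_pmul2r.
rewrite -(leq_pmul2r p2_gt0) -expnD -[(2 + 2)%N]/4%N -cardK -sum_nat_const -sum1_card.
rewrite [X in (_ <= X)%N](partition_big h [in V]) /= => [|x _]; last by apply/imsetP; exists x.
apply: leq_sum => y /imsetP[x _ ->].
rewrite sum1_card -dZ -(card_imset _ (@addrI _ (x - a))).
apply/subset_leq_card/subsetP => w /imsetP[z zZ ->].
rewrite unfold_in /= (hD (x - a) z); apply/eqP/(addIr (h a)).
have -> : h z = h a by apply: oppr_inj; rewrite -!rootZ.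
by rewrite addrAC -(hD (x - a) a) subrK.
Qed.

Let VD x y : x \in V -> y \in V -> x + y \in V.
Proof. by move=> /imsetP[a _ ->] /imsetP[b _ ->]; rewrite -(hD a b) imset_f. Qed.

Let VZ i x : i \in subfield_of_order K p -> x \in V -> i * x \in V.
Proof. by move=> ip /imsetP[a _ ->]; rewrite -(hZ a ip) imset_f. Qed.

(** V is a plane over the prime field. Scaling one of its nonzero elements to 1 gives a basis 1,
    beta, on which [annihilator] vanishes. *)
Lemma linearized_annihilated : u3 != 0 -> exists a0 beta, [/\ a0 != 0,
  beta \notin subfield_of_order K p & forall x, annihilator p beta (a0^-1 * h x) = 0].
Proof.
move=> /card_V cV; set Fp := subfield_of_order K p.
have cFp : #|Fp| = p := card_subfield_p p_pr cardK.
have [a0 Va a00] : exists2 a0, a0 \in V & a0 != 0.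
  have /card_gt1P[a [b [Va Vb nab]]] : (1 < #|V|)%N by rewrite cV; apply: ltn_trans p2_gt_p.
  by have [a0|] := eqVneq a 0; [exists b; rewrite // -a0 eq_sym | exists a].
have [beta Vb nb] : exists2 beta, a0 * beta \in V & beta \notin Fp.
  have /subsetPn[y Vy ny] : ~~ (V \subset [set a0 * i | i in Fp]).
    apply/negP => /subset_leq_card; rewrite cV leqNgt => /negP; apply.
    by apply: leq_ltn_trans (leq_imset_card _ _) _; rewrite cFp.
  exists (a0^-1 * y); first by rewrite mulVKf.
  by apply: contra ny => yF; apply/imsetP; exists (a0^-1 * y); rewrite ?mulVKf.
exists a0, beta; split=> // x.
have nb' : beta ^+ p != beta by move: nb; rewrite inE.
pose phi (ij : K * K) := ij.1 * a0 + ij.2 * (a0 * beta).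
have FpB i i' : i \in Fp -> i' \in Fp -> i - i' \in Fp.
  by rewrite !inE (expDpp p_pr cardK) (expNpp p_pr cardK) => /eqP -> /eqP ->.
have FpV i i' : i \in Fp -> i' \in Fp -> i / i' \in Fp.
  by rewrite !inE expr_div_n => /eqP -> /eqP ->.
have inj_phi : {in setX Fp Fp &, injective phi}.
  move=> [i k] [i' k'] /setXP[/= iF kF] /setXP[/= i'F k'F].
  rewrite /phi /= [a0 * _]mulrC !mulrA -!mulrDl => /(mulIf a00) e.
  have e1 : (k - k') * beta = i' - i.
    have -> : i' = i + k * beta - k' * beta by rewrite e addrK.
    by move: e => _; ring.
  have [ek|nk] := eqVneq k k'.
    by move: e1; rewrite ek subrr mul0r => /esym/eqP; rewrite subr_eq0 => /eqP ->.
  case/negP: nb; rewrite (_ : beta = (i' - i) / (k - k')); first exact: FpV (FpB _ _ _ _) (FpB _ _ _ _).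
  by rewrite -e1 mulrC mulKf // subr_eq0.
have eV : phi @: setX Fp Fp = V.
  apply/eqP; rewrite eqEcard cV card_in_imset // cardsX cFp mulnn leqnn andbT.
  by apply/subsetP => y /imsetP[[i k] /setXP[iF kF] ->]; rewrite VD // VZ.
have : h x \in V by rewrite imset_f.
rewrite -eV => /imsetP[[i k] /setXP[/= iF kF] ->]; rewrite /phi /=.
have -> : a0^-1 * (i * a0 + k * (a0 * beta)) = i * 1 + k * beta by field.
rewrite annihilatorD !annihilatorZ // annihilator1 annihilator_id //.
by rewrite !mulr0 addr0.
Qed.

(** Composing [annihilator] with h / a0 and reducing x^q to x gives a linearized polynomial that
    vanishes on [K]. Its coefficients at x and x^(p^3) determine m1 and m2 from m3. *)
Lemma linearized_lin_prod_iv : u3 != 0 -> exists beta a1 b1 a2,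
  [/\ beta \notin subfield_of_order K p, a1 != 0, a2 != 0 &
  lin_prod Z = a2 *: (poly_iv p beta \Po (a1 *: 'X + b1%:P))].
Proof.
move=> u30; have [a0 [beta [a00 nb ann]]] := linearized_annihilated u30.
have [a aZ] : exists a, a \in Z by apply/set0Pn; rewrite -card_gt0.
pose m1 := a0^-1 * u1; pose m2 := a0^-1 * u2; pose m3 := a0^-1 * u3.
have [eu1 eu2 eu3] : [/\ u1 = a0 * m1, u2 = a0 * m2 & u3 = a0 * m3].
  by rewrite /m1 /m2 /m3 !mulVKf.
have m30 : m3 != 0 by rewrite mulf_neq0 // invr_eq0.
have hm x : a0^-1 * h x = m1 * x + m2 * x ^+ p + m3 * x ^+ p ^+ p.
  by rewrite /h /m1 /m2 /m3 expr_p2 !mulrDr !mulrA.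
clearbody m1 m2 m3.
set d := (beta ^+ p - beta) ^+ (p - 1).
have d0 : d != 0 by rewrite expf_neq0 // subr_eq0; move: nb; rewrite inE.
have [] := @linearized_eq0 (m3 ^+ (p ^ 2) + d * m1) (d * m2 - (1 + d) * m1 ^+ p)
  (m1 ^+ (p ^ 2) - (1 + d) * m2 ^+ p + d * m3) (m2 ^+ (p ^ 2) - (1 + d) * m3 ^+ p).
  move=> x; rewrite -[RHS](ann x) /annihilator -/d hm.
  rewrite !expr_p3 !expr_p2 !(expDpp p_pr cardK, exprMn) (expr_p4 cardK).
  by move: (x ^+ p ^+ p ^+ p) (x ^+ p ^+ p) (x ^+ p) => *; ring.
(* As y^(p^4) = y, this is also the p^2-th root of m3: the scaling for which [poly_iv] at b x has
   leading coefficient m3. *)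
pose b := m3 ^+ (p ^ 2).
have b0 : b != 0 by rewrite expf_neq0.
have m3E : m3 = b ^+ (p ^ 2) by rewrite /b !expr_p2 (expr_p4 cardK).
rewrite -/b; clearbody b => e1 e2.
have m1E : m1 = - (d^-1 * b).
  by apply: (mulfI d0); rewrite mulrN mulVKf //; apply/eqP; rewrite -addr_eq0 addrC e1.
have m2E : m2 = (1 + d ^+ (p ^ 2)) * b ^+ p.
  move/eqP: e2; rewrite subr_eq0 => /eqP/(congr1 (fun x => x ^+ (p ^ 2))).
  rewrite /= m3E exprMn !expr_p2 !(expr_p4 cardK) => ->.
  by rewrite !(expDpp p_pr cardK) !expr1n.
exists beta, b, (- (b * a)), a0; split=> //.
rewrite eL (rootZ aZ) /h eu1 eu2 eu3 m1E m2E m3E.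
rewrite /poly_iv comp_polyB comp_polyD !comp_polyZ comp_polyX !comp_Xn_poly.
rewrite (expDp p_pr cardK).
have := expDp p_pr cardK 1 (b *: 'X) (- (b * a))%:P; rewrite expn1 => ->.
rewrite !exprZn -!polyC_exp (expNpK p_pr cardK) (expNpp p_pr cardK) !exprMn.
rewrite (_ : (beta ^+ (p ^ 3) - beta ^+ (p ^ 2)) ^+ (p - 1) = d ^+ (p ^ 2)); last first.
  by rewrite /d exprAC; congr (_ ^+ _); rewrite expr_p3 !expr_p2 !(expDpp p_pr cardK) !(expNpp p_pr cardK).
rewrite -/d.
apply/polyP => i; rewrite !(coefD, coefN, coefZ, coefC, coefX).
by move: 'X^(p ^ 2)`_i 'X^p`_i (i == 1)%N (b ^+ (p ^ 2)) (b ^+ p) (d ^+ (p ^ 2)) (a ^+ p) (a ^+ (p ^ 2)) => *; case: (i == 0)%N; field.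
Qed.

End AdditivePolynomials.

(** * Conclusion *)

Section Assembly.
Variables (K : finFieldType) (p : nat).
Hypotheses (p_pr : prime p) (cardK : #|K| = (p ^ 4)%N).
Variables (f : {poly K}) (f_mvsp : mvsp f) (V_gt2 : (2 < #|value_set f|)%N).

Let f_gt0 : (0 < deg f)%N.
Proof. by case: f_mvsp; case: (size f). Qed.

Lemma additive_classified y0 u0 u1 u2 u3 a t : (0 < #|fiber f y0|)%N -> (t %| p - 1)%N ->
  u2 != 0 -> a != 0 ->
  lin_prod (fiber f y0) = u0%:P + u1 *: 'X + u2 *: 'X^p + u3 *: 'X^(p ^ 2) ->
  f - y0%:P = a *: lin_prod (fiber f y0) ^+ t -> classified p f.
Proof.
move=> Z0 tp u20 a0 eL eF.
have aff g a1 b1 a2 : a1 != 0 -> a2 != 0 ->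
    lin_prod (fiber f y0) = a2 *: (g \Po (a1 *: 'X + b1%:P)) -> affine_equiv f (g ^+ t).
  move=> a10 a20 eg; exists a1, b1, (a * a2 ^+ t), y0; split; rewrite ?mulf_neq0 ?expf_neq0 //.
  by rewrite rmorphXn /= -scalerA -exprZn -eg -eF subrK.
have [u30|u30] := eqVneq u3 0.
  have [a1 [b1 [a2 [a10 a20 eg]]]] := linearized_lin_prod_v p_pr cardK u20 eL u30.
  exists (('X^p - 'X) ^+ t); split; last exact: aff eg.
  by constructor 4; right; exists t.
have [beta [a1 [b1 [a2 [nb a10 a20 eg]]]]] := linearized_lin_prod_iv p_pr cardK Z0 eL u30.
exists (poly_iv p beta ^+ t); split; last exact: aff eg.
by constructor 4; left; exists beta, t.
Qed.

Section NormalForm.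
Variables (y0 : K) (R : {poly K}) (c0 : K) (t : nat).
Hypotheses (nf : normal_form p f y0 R c0 t) (y0V : y0 \in value_set f).
Let Z := fiber f y0.
Let F : {poly K} := f - y0%:P.
Let F_gt0 : (0 < deg F)%N. Proof. by rewrite deg_subC. Qed.
Let Z_gt0 : (0 < #|Z|)%N.
Proof.
by rewrite card_gt0; apply/set0Pn; case/imsetP: y0V => a _ ya; exists a; rewrite inE ya.
Qed.

Lemma classified_or_simple_exponent : classified p f \/ t = 1%N /\
  exists lam D u, [/\ u != 0, F^`() = D ^+ p & (F + lam%:P) * D^`() = u *: D ^+ p.+1].
Proof.
have [j [A [B [C [S [j0 lv]]]]]] := normal_form_level p_pr cardK f_mvsp V_gt2 nf y0V.
have [S0|S0] := posnP (deg S).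
  by left; apply: (monomial_classified p_pr cardK f_mvsp V_gt2 nf y0V j0 lv S0).
have [LW|LW] := boolP (lin_prod Z %| wronskian B C).
  by left; apply: (wronskian_classified p_pr cardK f_mvsp V_gt2 nf y0V j0 lv LW).
have M1 : (t * j + 1 = p)%N.
  have := level_M lv; rewrite expn1; have := level_M_gt0 lv.
  have := level_M_gt1 p_pr cardK (nf_c0 nf) (nf_eq nf) (isT : 0 < 1)%N lv isT; rewrite expn1.
  case: (_ %/ p)%N => [|[|m]] // LW2; last by case/negP: LW; apply: LW2.
  by rewrite muln1.
have fin : j%:R *: (C * A^`()) - C^`() * A = 0 /\ (size (S + t%:R *: ('X * S^`()))%R <= 1)%N ->
    classified p f.
  case=> Y0 sS2; have [u0 [u1 [u2 [u3 [a [u20 a0 eL eF]]]]]] :=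
    additive_level p_pr cardK Z_gt0 F_gt0 (nf_c0 nf) (nf_eq nf) lv M1 S0 j0 LW Y0 sS2.
  apply: additive_classified Z_gt0 _ u20 a0 eL eF.
  by rewrite -M1 addnK dvdn_mulr.
have [t1|t1] := ltnP 1 t.
  left; apply: fin.
  apply: (first_level_t_gt1 p_pr cardK Z_gt0 F_gt0 (nf_c0 nf) (nf_eq nf) lv M1 S0 j0 LW t1).
have {}t1 : t = 1%N by apply/eqP; rewrite eqn_leq t1; case/andP: (nf_t nf).
case: (first_level_t1 p_pr cardK Z_gt0 F_gt0 (nf_c0 nf) (nf_eq nf) lv M1 S0 t1) => [/fin|]; first by left.
by right.
Qed.

(* If [D] vanishes on a fibre over an exceptional value, then so does [A] at
   its first level, and this forces [L] to divide the Wronskian. *)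
Lemma classified_of_fiber_root D u : t = 1%N -> u != 0 -> f^`() = D ^+ p ->
  F * D^`() = u *: D ^+ p.+1 -> classified p f.
Proof.
move=> t1 u0 eD eFD.
have [j [A [B [C [S [j0 lv]]]]]] := normal_form_level p_pr cardK f_mvsp V_gt2 nf y0V.
apply: (wronskian_classified p_pr cardK f_mvsp V_gt2 nf y0V j0 lv).
have LA : lin_prod Z %| A.
  apply/lin_prod_dvdP => a aZ.
  have Fa : F.[a] = 0 by move: aZ; rewrite inE => /eqP fa; rewrite /F !hornerE fa subrr.
  have Da : D.[a] = 0.
    have := congr1 (horner^~ a) eFD; rewrite hornerM Fa mul0r hornerZ horner_exp => /esym/eqP.
    by rewrite mulf_eq0 (negPf u0) expf_eq0 => /eqP.
  have F'E : F^`() = (lin_prod Z)^`() * A ^+ p.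
    have := deriv_mul_expp p_pr cardK (lin_prod Z) A (isT : 0 < 1)%N.
    by rewrite expn1 => <-; rewrite {1}/F (lv_F lv) t1 expn1.
  have : F^`().[a] = 0.
    by rewrite /F derivB derivC subr0 eD horner_exp Da expr0n gtn_eqF // prime_gt0.
  rewrite F'E hornerM horner_exp => /eqP; rewrite mulf_eq0 expf_eq0 => /orP[|/andP[_ /eqP //]].
  have La : root (lin_prod Z) a by rewrite root_lin_prod.
  have := coprimep_root (lin_prod_coprime_deriv p_pr cardK Z) La.
  by move=> /negPf ->.
have [M2|M2] := ltnP 1 ((t * j + 1) %/ p ^ 1).
  exact: (level_M_gt1 p_pr cardK (nf_c0 nf) (nf_eq nf) (isT : 0 < 1)%N lv isT M2).
have M1 : (t * j + 1 = p)%N.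
  have := level_M lv; have := level_M_gt0 lv; rewrite expn1 in M2 *.
  by case: (_ %/ p)%N M2 => [|[|m]] // _ _; rewrite muln1.
have [kap kap0 eW] := first_level_wronskian p_pr cardK (nf_c0 nf) (nf_eq nf) lv M1 j0.
rewrite -(dvdpZr _ _ kap0) eW; apply: dvdp_add; apply: dvdp_mulr.
  by rewrite dvdp_mull // -[X in X %| _]expr1; apply: dvdp_trans (dvdp_exp2r _ LA) _; rewrite expr1 -{1}[A]expr1 dvdp_exp2l.
by rewrite -mulrA dvdp_mull // dvdp_mulr.
Qed.

End NormalForm.

Lemma mvsp_classified : classified p f.
Proof.
have [y0 [c ev]] := mvsp_exceptional_value p_pr cardK f_mvsp V_gt2.
have [R [t [nf Py0]]] := exceptional_normal_form p_pr cardK f_mvsp V_gt2 ev.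
have [y0V c0 slope PV] := ev.
have [//|[t1 [lam [D [u [u0 F'D eF]]]]]] := classified_or_simple_exponent nf y0V.
pose y1 := y0 - lam.
have eFy : f - y0%:P + lam%:P = f - y1%:P by rewrite /y1 polyCB opprB addrAC addrA.
have f'D : f^`() = D ^+ p by rewrite -F'D derivB derivC subr0.
rewrite eFy in eF.
(* Otherwise P(f) would be a nonzero constant modulo f - y1, so its divisor f' = D^p would be prime
   to f - y1, which nevertheless divides D^(p+1). *)
have y1V : y1 \in value_set f.
  apply/negPn/negP => ny1.
  have Py1 : (lin_prod (value_set f)).[y1] != 0.
    by rewrite -[_ == 0]/(root _ y1) root_lin_prod.
  set P := lin_prod (value_set f) in PV Py1.
  have /factor_theorem[Q eQ] : root (P - P.[y1]%:P) y1 by rewrite /root !hornerE subrr.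
  have {}eQ : P \Po f = (Q \Po f) * (f - y1%:P) + P.[y1]%:P.
    have := congr1 (comp_poly f) eQ; rewrite comp_polyM !comp_polyB !comp_polyC comp_polyX.
    by move=> <-; rewrite subrK.
  have cop : coprimep (f - y1%:P) (P \Po f).
    apply/coprimepP => E Ef; rewrite eQ dvdp_addr ?dvdp_mull //.
    move=> EP; rewrite -size_poly_eq1 eqn_leq.
    have c1 : P.[y1]%:P != 0 by rewrite polyC_eq0.
    rewrite size_poly_gt0 (dvdpN0 EP c1) andbT.
    by apply: leq_trans (dvdp_leq c1 EP) (size_polyC_leq1 _).
  have GD : f - y1%:P %| D ^+ p.+1 by rewrite -(dvdpZr _ _ u0) -eF dvdp_mulr.
  have : coprimep (f - y1%:P) (f - y1%:P).
    apply: coprimep_dvdl GD _; apply: coprimep_expr; apply: coprimep_dvdl cop.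
    rewrite PV dvdpZr ?oppr_eq0 // dvdp_mulr // f'D.
    by rewrite -[X in X %| _]expr1 dvdp_exp2l // prime_gt0.
  by rewrite coprimepp => /eqP e1; move: f_gt0; rewrite -(deg_subC y1 f_gt0) e1.
(* For t = 1 the slope at y0 is [c] too, so all values are exceptional; the exponent t' at y1
   satisfies c t' = c, hence is again 1. *)
have ev1 : exceptional_value f y1 c.
  by apply: (exceptional_value_any ev _ y1V); rewrite Py0 t1.
have [R1 [t' [nf1 Py1]]] := exceptional_normal_form p_pr cardK f_mvsp V_gt2 ev1.
have t'1 : t' = 1%N.
  have [y2 [y3 [y4 [[V2 V3 _] [n23 _ _]]]]] := card_gt2P V_gt2.
  have [_ _ slope1 _] := ev1.
  have [y Vy ny] : exists2 y, y \in value_set f & y != y1.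
    by have [e2|] := eqVneq y2 y1; [exists y3; rewrite // -e2 eq_sym | exists y2].
  have : c *+ t' = c.
    rewrite -Py1; have [->|ny0] := eqVneq y1 y0; first by rewrite Py0 t1.
    exact: slope ny0.
  have /andP[t'0 t'p] := nf_t nf1.
  move=> ct; have /eqP : c * (t'.-1)%:R = 0.
    by apply: (addrI c); rewrite addr0 mulr_natr -mulrS prednK.
  rewrite mulf_eq0 (negPf c0) /= -(dvdn_pcharf (card_finPcharP cardK p_pr)).
  case: t' t'0 t'p {nf1 Py1 ct} => [|[|m]] // _ mp /= /(dvdn_leq (ltn0Sn _)).
  by rewrite leqNgt (ltnW mp).
apply: (classified_of_fiber_root nf1 y1V t'1 u0 f'D eF).
Qed.

End Assembly.

Theorem theorem2p7 (p : nat) (p_prime : prime p)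
    (F : finFieldType) (cardF : #|F| = (p ^ 4)%N) :
  [/\ forall f : {poly F},
        (mvsp f /\ (2 <= #|value_set f| - 1)%N) <->
        (exists G : {poly F},
           [\/ type_i p G, type_ii p G, type_iii p G | type_iv p G \/ type_v p G]
           /\ affine_equiv f G),
      forall g : {poly F},
        (mvsp g /\ value_set g = subfield_of_order F p) <->
        ((1 < size g)%N /\ formFp p g)
    & forall g : {poly F},
        (mvsp g /\ value_set g = subfield_of_order F (p ^ 2)) <->
        ((1 < size g)%N /\ formFp2 p g)].
Proof.
split=> [f|g|g]; last exact: formFp2P; last exact: formFpP.
split=> [[mf Vf]|]; last exact: classified_mvsp.
by apply: mvsp_classified => //; move: Vf; rewrite ltn_subRL.
Qed.
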